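(* Let $f$ be a transcendental entire function with a multiply connected wandering domain $U$ and let $z_0 \in U$. For large $n\in\mathbb{N}$ let $r_n=|f^n(z_0)|$, let $B_n=A(r_n^{a_n},r_n^{b_n})$ be the maximal annulus centred at $0$ that is contained in $U_n=f^n(U)$ and contains $f^n(z_0)$, and let $$C_n = A\left(r_n^{a_n+2\pi\delta_n},r_n^{b_n(1-3\pi\delta_n)}\right), \quad\text{where } \delta_n = 1/\sqrt{\log r_n}.$$ Then, for each compact subset $C$ of $U$, there exists $N\in\mathbb{N}$ such that $$f^n(C)\subset B_n,\quad\text{for }n\ge N.$$ Moreover, for each compact subset $C$ of $U$, there exists $N\in\mathbb{N}$ such that $$f^n(C)\subset C_n,\quad\text{for }n\ge N.$$
   Context: $A(r,R)=\{z\in\mathbb{C}:r<|z|<R\}$ for $0<r<R$. A transcendental entire function is an entire function $f:\mathbb{C}\to\mathbb{C}$ that is not a polynomial; $f^n$ denotes its $n$-th iterate, and $\mathbb{N}=\{1,2,\dots\}$. The Fatou set $F(f)$ is the set of points of $\mathbb{C}$ having a neighbourhood on which the iterates $f^n$ form a normal family (locally uniform convergence to $\infty$ being allowed). A Fatou component is a connected component of $F(f)$. For a Fatou component $U$, $U_n$ denotes the Fatou component containing $f^n(U)$, with $U_0=U$; $U$ is a wandering domain if the sequence $(U_n)$ is not eventually periodic. A domain is multiply connected if it is not simply connected. By results of Baker, if $U$ is a multiply connected wandering domain then each $U_n$ is bounded and multiply connected, $U_n=f^n(U)$, for all large $n$ both $U_n$ and $0$ lie in a bounded complementary component of $U_{n+1}$,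 and $\mathrm{dist}(U_n,0)\to\infty$ as $n\to\infty$. The annulus $B_n$ is well defined for large $n$: there exists $\alpha>0$ such that, for all large $n$, the maximal annulus centred at $0$ that is contained in $U_n$ and contains $f^n(z_0)$ exists and has the form $A(r_n^{a_n},r_n^{b_n})$ with $r_n=|f^n(z_0)|$ and $0<a_n<1-\alpha<1+\alpha<b_n$; this defines $a_n$ and $b_n$. *)

(* Defs.v *)
From HB Require Import structures.
From mathcomp Require Export all_boot all_order all_algebra.
From mathcomp Require Export all_classical all_reals all_analysis.
From mathcomp Require Export complex.
Export Order.TTheory GRing.Theory Num.Theory.
Export numFieldNormedType.Exports.

Set Implicit Arguments.
Unset Strict Implicit.
Unset Printing Implicit Defensive.

Local Open Scope classical_set_scope.
Local Open Scope ring_scope.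
Local Open Scope complex_scope.

(* The topology and normed structure of the field R[i], over itself. *)
#[export, non_forgetful_inheritance]
HB.instance Definition _ (R : realType) := GRing.ComAlgebra.copy R[i] R[i]^o.
#[export, non_forgetful_inheritance]
HB.instance Definition _ (R : realType) := Vector.copy R[i] R[i]^o.
#[export, non_forgetful_inheritance]
HB.instance Definition _ (R : realType) := NormedModule.copy R[i] R[i]^o.

Section Definitions.
Context {R : realType}.
Implicit Types (f g : R[i] -> R[i]) (U V : set R[i]).

(* `|z| takes its values in R[i]; radii and powers need the modulus in R. *)
Definition modulus (z : R[i]) : R := Normc.normc z.

Definition annulus (r s : R) : set R[i] := [set z | r < modulus z < s].

Definition entire f := forall z : R[i], derivable f z (1 : R[i]).

Definition transcendental_entire f :=
  entire f /\ ~ exists p : {poly R[i]}, forall z, f z = p.[z].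

Definition locally_uniformly_cvg V (s : nat -> R[i] -> R[i]) g :=
  forall z, V z -> exists2 W, nbhs z W & {uniform W, s @ \oo --> g}.

Definition locally_uniformly_cvg_infty V (s : nat -> R[i] -> R[i]) :=
  forall z, V z -> exists2 W, nbhs z W &
    forall M : R, \forall k \near \oo, forall w, W w -> M < modulus (s k w).

Definition normal_family V (F : set (R[i] -> R[i])) :=
  forall s : nat -> R[i] -> R[i], (forall k, F (s k)) ->
  exists phi : nat -> nat,
    {homo phi : j k / (j < k)%N} /\
    ((exists g, locally_uniformly_cvg V (s \o phi) g) \/
     locally_uniformly_cvg_infty V (s \o phi)).

Definition fatou f : set R[i] :=
  [set z | exists2 V, open_nbhs z V &
             normal_family V [set iter n f | n in [set n | (0 < n)%N]]].

Definition fatou_component f U :=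
  exists2 z, fatou f z & U = connected_component (fatou f) z.

(* The Fatou component containing f^n(U): for a Fatou component U, all the
   components of the union below coincide, since f^n(U) is a connected subset
   of the Fatou set. *)
Definition component_orbit f U (n : nat) : set R[i] :=
  \bigcup_(z in U) connected_component (fatou f) (iter n f z).

Definition wandering_domain f U :=
  fatou_component f U /\
  ~ exists m p : nat, (0 < p)%N /\
      forall n, (m <= n)%N ->
        component_orbit f U (n + p) = component_orbit f U n.

Definition domain U := [/\ open U, connected U & U !=set0].

Definition null_homotopic U (gamma : R -> R[i]) :=
  exists H : R * R -> R[i],
    [/\ {within `[0, 1] `*` `[0, 1], continuous H},
        H @` (`[0, 1] `*` `[0, 1]) `<=` U,
        forall s, s \in `[0, 1] -> H (s, 0) = gamma s,
        forall s, s \in `[0, 1] -> H (s, 1) = gamma 0 &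
        forall t, t \in `[0, 1] -> H (0, t) = gamma 0 /\ H (1, t) = gamma 0].

Definition simply_connected U :=
  domain U /\
  forall gamma : R -> R[i],
    {within `[0, 1], continuous gamma} ->
    gamma @` `[0, 1] `<=` U ->
    gamma 0 = gamma 1 ->
    null_homotopic U gamma.

Definition multiply_connected U := domain U /\ ~ simply_connected U.

Definition maximal_annulus U (w : R[i]) (r s : R) :=
  [/\ 0 < r < s, annulus r s `<=` U, annulus r s w &
      forall r' s', 0 < r' < s' -> annulus r' s' `<=` U -> annulus r' s' w ->
        annulus r' s' `<=` annulus r s].

End Definitions.

(* Main.v *)
(**
Everything rests on one consequence of Goursat's subdivision argument, carried
out on Riemann sums of the [2 pi i]-periodic function [f (a + exp z)] so that no
integral is needed: on a circle centred at [a], [Re f] takes a value at least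
[Re (f a)].  The maximum principle follows, and from it Schwarz's lemma, a
Harnack inequality, holomorphic logarithms on discs and a quantitative open
mapping theorem.

The images [f^n(U)] lie in pairwise different Fatou components and contain the
circles [|z| = r_n].  By the maximum principle [r_n] is eventually monotone,
and it increases to infinity, since otherwise a disc mapped into itself, which
lies in the Fatou set, would meet two of these components.  As [f] is
transcendental, [r_(n+2) > r_n ^ 2], so log-convexity of the maximum modulus
shows that the positive harmonic functions [u_n = log |f^n|] oscillate by a
fixed proportion of their size on a fixed compact subset of some [f^m(U)].

Near a point [p] write [f^n = exp (u_n(p) g_n)].  Were the image under [g_n] of
a fixed disc not to contain a fixed disc about [g_n(p)], for infinitely many
[n], then [g_n] would be nearly constant there, and by Harnack's inequality and
the two-constants theorem so would [u_n / u_n(p)] on compact sets, contradicting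
the oscillation.  Hence [f^n(U)] contains the annulus
[|f^n(z)|^(1-alpha) < |w| < |f^n(z)|^(1+alpha)] with [alpha] locally uniform in
[z]; overlapping annuli and the maximality of [B_n] put it inside [B_n], and
since [log |f^n(z)|] is comparable to [log r_n], which is much larger than its
square root, [f^n(z)] lies in [C_n].
*)
From mathcomp Require Import ring lra zify.
Require Import Defs.
Set Implicit Arguments. Unset Strict Implicit. Unset Printing Implicit Defensive.
Local Open Scope classical_set_scope.
Local Open Scope ring_scope.
Local Open Scope complex_scope.

(** * Complex differentiability *)

Section Basics.
Variable R : realType.
Implicit Types (f g q : R[i] -> R[i]) (z w : R[i]) (e r : R).

(** Differentiability is expressed by Caratheodory's factorisation, and a divided difference is then
    only known to be continuous at its node. For this reason the mean-value inequality and the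
    maximum principle allow a function that fails to be holomorphic at the centre of a disc;
    Schwarz's lemma and Newton interpolation need exactly this.

    A disc covered in the logarithmic plane yields a full annulus because, after multiplication by
    u_n(p), a disc of fixed radius about g_n(p) = 1 is taller than 2 pi once u_n(p) is large. Read
    backwards: a point w omitted by f^n gives g_n an omitted value whose imaginary part is at most 2
    pi / u_n(p), hence negligible.

    The exponent alpha comes out of a contradiction and is not explicit. Moreover B_n is maximal
    only among annuli through f^n(z_0), so membership in B_n must be transported from z_0 to other
    points through overlapping annuli. The comparison of log |f^n(z)| with log r_n is transported
    along with it, by Harnack's inequality. *)

Lemma normE z : `|z| = (modulus z)%:C.
Proof. by case: z. Qed.

Lemma modulus_ge0 z : 0 <= modulus z.
Proof. by case: z => a b; exact: sqrtr_ge0. Qed.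

Lemma modulus0 : modulus (0 : R[i]) = 0.
Proof. exact: Normc.normc0. Qed.

Lemma modulus_eq0 z : (modulus z == 0) = (z == 0).
Proof. by apply/eqP/eqP => [/Normc.eq0_normc//|->]; exact: modulus0. Qed.

Lemma modulus_gt0 z : (0 < modulus z) = (z != 0).
Proof. by rewrite lt_def modulus_eq0 modulus_ge0 andbT. Qed.

Lemma modulusM z w : modulus (z * w) = modulus z * modulus w.
Proof. exact: Normc.normcM. Qed.

Lemma modulus1 : modulus (1 : R[i]) = 1.
Proof. exact: Normc.normc1. Qed.

Lemma modulusV z : modulus z^-1 = (modulus z)^-1.
Proof. exact: Normc.normcV. Qed.

Lemma modulusX z n : modulus (z ^+ n) = modulus z ^+ n.
Proof.
by elim: n => [|n ih]; rewrite ?expr0 ?modulus1// !exprS modulusM ih.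
Qed.

Lemma modulusN z : modulus (- z) = modulus z.
Proof. exact: normcN. Qed.

Lemma modulusB z w : modulus (z - w) = modulus (w - z).
Proof. by rewrite -modulusN opprB. Qed.

Lemma modulusD z w : modulus (z + w) <= modulus z + modulus w.
Proof. exact: le_normcD. Qed.

Lemma modulus_real (x : R) : modulus x%:C = `|x|.
Proof. by rewrite /modulus /= expr0n /= addr0 sqrtr_sqr. Qed.

Lemma modulus_sqr z : modulus z ^+ 2 = complex.Re z ^+ 2 + complex.Im z ^+ 2.
Proof. by case: z => a b /=; rewrite sqr_sqrtr// addr_ge0// sqr_ge0. Qed.

Lemma le_Re_modulus z : `|complex.Re z| <= modulus z.
Proof. by rewrite -lecR -normE normc_ge_Re. Qed.

Lemma le_Im_modulus z : `|complex.Im z| <= modulus z.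
Proof.
rewrite -(@ler_pXn2r _ 2%N) ?nnegrE ?modulus_ge0// modulus_sqr real_normK ?num_real//.
by rewrite lerDr sqr_ge0.
Qed.

Lemma modulus_le_ReIm z : modulus z <= `|complex.Re z| + `|complex.Im z|.
Proof.
rewrite -(@ler_pXn2r _ 2%N) ?nnegrE ?modulus_ge0 ?addr_ge0// modulus_sqr.
rewrite sqrrD !real_normK ?num_real//.
have : 0 <= `|complex.Re z| * `|complex.Im z| by rewrite mulr_ge0.
lra.
Qed.

Lemma modulusi : modulus ('i : R[i]) = 1.
Proof. by rewrite /modulus /= expr0n /= add0r expr1n sqrtr1. Qed.

Lemma ler_modulusB z w : modulus z - modulus w <= modulus (z - w).
Proof. by rewrite lerBlDr; apply: le_trans (modulusD _ _); rewrite subrK. Qed.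

Lemma modulus_sum I (s : seq I) (P : pred I) (F : I -> R[i]) :
  modulus (\sum_(i <- s | P i) F i) <= \sum_(i <- s | P i) modulus (F i).
Proof.
elim/big_rec2: _ => [|i y x _ h]; first by rewrite modulus0.
by apply: le_trans (modulusD _ _) _; rewrite lerD2l.
Qed.

Lemma ReD z w : complex.Re (z + w) = complex.Re z + complex.Re w.
Proof. by case: z; case: w. Qed.
Lemma ImD z w : complex.Im (z + w) = complex.Im z + complex.Im w.
Proof. by case: z; case: w. Qed.
Lemma ReN z : complex.Re (- z) = - complex.Re z.
Proof. by case: z. Qed.
Lemma ImN z : complex.Im (- z) = - complex.Im z.
Proof. by case: z. Qed.

(** Continuity in terms of the real-valued modulus, so that all estimates take place in [R] and not
    in the ordered part of [R[i]]. *)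
Definition contat f z := forall e, 0 < e -> exists2 r, 0 < r &
  forall w, modulus (w - z) < r -> modulus (f w - f z) < e.

(* Caratheodory's form of complex differentiability. *)
Definition holo f z := exists2 q, contat q z & forall w, f w = f z + q w * (w - z).

Lemma contat_ext_near f g z r : 0 < r -> (forall w, modulus (w - z) < r -> f w = g w) ->
  contat f z -> contat g z.
Proof.
move=> r0 fg cf e e0; have [d d0 h] := cf e e0.
exists (Num.min r d); first by rewrite lt_min r0.
move=> w; rewrite lt_min => /andP[w1 w2]; rewrite -!fg ?h//.
by rewrite subrr modulus0.
Qed.

Lemma contat_cst (c : R[i]) z : contat (fun=> c) z.
Proof. by move=> e e0; exists 1 => // w _; rewrite subrr modulus0. Qed.

Lemma contat_id z : contat id z.
Proof. by move=> e e0; exists e. Qed.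

Lemma contatD f g z : contat f z -> contat g z -> contat (fun w => f w + g w) z.
Proof.
move=> cf cg e e0.
have e2 : 0 < e / 2 by rewrite divr_gt0.
have [d d0 h] := cf _ e2; have [d' d'0 h'] := cg _ e2.
exists (Num.min d d'); first by rewrite lt_min d0.
move=> w; rewrite lt_min => /andP[w1 w2].
have -> : f w + g w - (f z + g z) = (f w - f z) + (g w - g z) by ring.
have := modulusD (f w - f z) (g w - g z); have := h _ w1; have := h' _ w2.
lra.
Qed.

Lemma contatN f z : contat f z -> contat (fun w => - f w) z.
Proof.
move=> cf e e0; have [d d0 h] := cf _ e0; exists d => // w /h.
by rewrite -opprD modulusN.
Qed.

Lemma contatB f g z : contat f z -> contat g z -> contat (fun w => f w - g w) z.
Proof. by move=> cf cg; apply: contatD => //; exact: contatN. Qed.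

Lemma contatM f g z : contat f z -> contat g z -> contat (fun w => f w * g w) z.
Proof.
move=> cf cg e e0.
set A := modulus (f z) + 1; set B := modulus (g z) + 1.
have A0 : 0 < A by have := modulus_ge0 (f z); rewrite /A; lra.
have B0 : 0 < B by have := modulus_ge0 (g z); rewrite /B; lra.
have [d1 d10 h1] := cf _ (@ltr01 R).
have [d2 d20 h2] := cf _ (divr_gt0 e0 (mulr_gt0 (ltr0n R 2) B0)).
have [d3 d30 h3] := cg _ (divr_gt0 e0 (mulr_gt0 (ltr0n R 2) A0)).
exists (Num.min d1 (Num.min d2 d3)); first by rewrite !lt_min d10 d20.
move=> w; rewrite !lt_min => /and3P[w1 w2 w3].
have -> : f w * g w - f z * g z = f w * (g w - g z) + (f w - f z) * g z by ring.
apply: le_lt_trans (modulusD _ _) _; rewrite !modulusM.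
have k1 : modulus (f w) <= A.
  have := h1 _ w1; have := ler_modulusB (f w) (f z); rewrite /A; lra.
have k2 : modulus (f w) * modulus (g w - g z) <= A * modulus (g w - g z).
  by rewrite ler_wpM2r ?modulus_ge0.
have k3 : A * modulus (g w - g z) < e / 2.
  by have := h3 _ w3; rewrite ltr_pdivlMr ?mulr_gt0//; lra.
have k4 : modulus (f w - f z) * modulus (g z) <= modulus (f w - f z) * B.
  by rewrite ler_wpM2l ?modulus_ge0// /B lerDl.
have k5 : modulus (f w - f z) * B < e / 2.
  by have := h2 _ w2; rewrite ltr_pdivlMr ?mulr_gt0//; lra.
lra.
Qed.

Lemma contatV f z : contat f z -> f z != 0 -> contat (fun w => (f w)^-1) z.
Proof.
move=> cf fz0 e e0.
have m0 : 0 < modulus (f z) by rewrite modulus_gt0.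
set m := modulus (f z) in m0 *.
have [d1 d10 h1] := cf _ (divr_gt0 m0 (ltr0n R 2)).
have k0 : 0 < e * (m ^+ 2 / 2) by rewrite mulr_gt0// divr_gt0// exprn_gt0.
have [d2 d20 h2] := cf _ k0.
exists (Num.min d1 d2); first by rewrite !lt_min d10 d20.
move=> w; rewrite !lt_min => /andP[w1 w2].
have k1 : m / 2 < modulus (f w).
  have := h1 _ w1; have := ler_modulusB (f z) (f w); rewrite modulusB -/m; lra.
have fw0 : f w != 0 by rewrite -modulus_gt0; apply: lt_trans k1; rewrite divr_gt0.
have -> : (f w)^-1 - (f z)^-1 = (f z - f w) / (f w * f z).
  by field; rewrite fz0 fw0.
rewrite modulusM modulusV modulusM -/m modulusB ltr_pdivrMr; last first.
  by rewrite mulr_gt0// modulus_gt0.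
apply: lt_le_trans (h2 _ w2) _; rewrite ler_pM2l//.
by move: k1 m0; clear; nra.
Qed.

Lemma contat_comp f g z : contat f z -> contat g (f z) -> contat (fun w => g (f w)) z.
Proof.
move=> cf cg e e0; have [d d0 h] := cg _ e0; have [d' d'0 h'] := cf _ d0.
by exists d' => // w /h' /h.
Qed.

Lemma holo_contat f z : holo f z -> contat f z.
Proof.
move=> [q cq fE].
suff : contat (fun w => f z + q w * (w - z)) z.
  by apply: contat_ext_near ltr01 _ => w _; rewrite -fE.
apply: contatD; first exact: contat_cst.
apply: contatM => //; apply: contatB; [exact: contat_id|exact: contat_cst].
Qed.

Lemma holo_cst (c z : R[i]) : holo (fun=> c) z.
Proof. by exists (fun=> 0) => [|w]; [exact: contat_cst|rewrite mul0r addr0]. Qed.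

Lemma holo_id z : holo id z.
Proof.
by exists (fun=> 1) => [|w]; [exact: contat_cst|rewrite mul1r addrC subrK].
Qed.

Lemma holoD f g z : holo f z -> holo g z -> holo (fun w => f w + g w) z.
Proof.
move=> [q cq fE] [p cp gE]; exists (fun w => q w + p w); first exact: contatD.
by move=> w; rewrite {1}fE {1}gE; ring.
Qed.

Lemma holoN f z : holo f z -> holo (fun w => - f w) z.
Proof.
move=> [q cq fE]; exists (fun w => - q w); first exact: contatN.
by move=> w; rewrite {1}fE; ring.
Qed.

Lemma holoB f g z : holo f z -> holo g z -> holo (fun w => f w - g w) z.
Proof. by move=> hf hg; apply: holoD => //; exact: holoN. Qed.

Lemma holoM f g z : holo f z -> holo g z -> holo (fun w => f w * g w) z.
Proof.
move=> hf [p cp gE]; have cf := holo_contat hf; case: hf => [q cq fE].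
exists (fun w => f w * p w + q w * g z).
  by apply: contatD; apply: contatM => //; exact: contat_cst.
by move=> w; rewrite {1}gE mulrDr {1}fE; ring.
Qed.

Lemma holo_comp f g z : holo f z -> holo g (f z) -> holo (fun w => g (f w)) z.
Proof.
move=> hf [p cp gE]; have cf := holo_contat hf; case: hf => [q cq fE].
exists (fun w => p (f w) * q w).
  by apply: contatM => //; exact: contat_comp cp.
by move=> w; rewrite (gE (f w)) {2}(fE w); ring.
Qed.

Lemma holoX f n z : holo f z -> holo (fun w => f w ^+ n) z.
Proof.
move=> hf; elim: n => [|n ih]; first exact: holo_cst.
by have [q cq E] := holoM hf ih; exists q => // w; rewrite !exprS -E.
Qed.

Lemma diff_holo f z (d : R[i]) : (forall e, 0 < e -> exists2 s, 0 < s &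
   forall w, modulus (w - z) < s -> modulus (f w - f z - d * (w - z)) <= e * modulus (w - z)) ->
  holo f z.
Proof.
move=> h.
exists (fun w => if w == z then d else (f w - f z) / (w - z)).
  move=> e e0; have [s s0 hs] := h _ (divr_gt0 e0 (ltr0n R 2)).
  exists s => // w hw; rewrite eqxx; case: eqVneq => [_|wz]; first by rewrite subrr modulus0.
  have wz0 : w - z != 0 by rewrite subr_eq0.
  have -> : (f w - f z) / (w - z) - d = (f w - f z - d * (w - z)) / (w - z) by field.
  rewrite modulusM modulusV ltr_pdivrMr ?modulus_gt0//.
  apply: le_lt_trans (hs _ hw) _; rewrite ltr_pM2r ?modulus_gt0//; lra.
move=> w; case: eqVneq => [->|wz]; first by rewrite subrr mulr0 addr0.
by rewrite divfK ?subr_eq0// addrC subrK.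
Qed.

Lemma holo_diff f z : holo f z -> exists d, forall e, 0 < e -> exists2 s, 0 < s &
   forall w, modulus (w - z) < s -> modulus (f w - f z - d * (w - z)) <= e * modulus (w - z).
Proof.
move=> [q cq fE]; exists (q z) => e e0; have [s s0 h] := cq _ e0.
exists s => // w /h hw.
have -> : f w - f z - q z * (w - z) = (q w - q z) * (w - z) by rewrite [f w]fE; ring.
by rewrite modulusM ler_wpM2r ?modulus_ge0// ltW.
Qed.

(** The factorisation in [holo] is an identity on the whole plane and does not localise by itself;
    the first-order expansion at [z] does, and [diff_holo] rebuilds a global factor from it. *)
Lemma holo_ext_near f g z r : 0 < r -> (forall w, modulus (w - z) < r -> f w = g w) ->
  holo f z -> holo g z.
Proof.
move=> r0 fg /holo_diff[d hd]; apply: (@diff_holo _ _ d) => e e0.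
have [s s0 h] := hd _ e0; exists (Num.min r s); first by rewrite lt_min r0.
move=> w; rewrite lt_min => /andP[w1 w2]; rewrite -!fg ?h//.
by rewrite subrr modulus0.
Qed.

Lemma holo_inv z : z != 0 -> holo (fun w => w^-1) z.
Proof.
move=> z0; have m0 : 0 < modulus z by rewrite modulus_gt0.
pose h w := z^-1 + (- (w^-1 / z)) * (w - z).
have : holo h z.
  exists (fun w => - (w^-1 / z)); last by move=> w; rewrite /h subrr mulr0 addr0.
  by apply/contatN/contatM; [apply: contatV => //; exact: contat_id|exact: contat_cst].
apply: holo_ext_near m0 _ => w hw.
have w0 : w != 0.
  by apply: contraTneq hw => ->; rewrite sub0r modulusN ltxx.
by rewrite /h; field; rewrite w0.
Qed.

Lemma holoV f z : holo f z -> f z != 0 -> holo (fun w => (f w)^-1) z.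
Proof. by move=> hf fz; apply: holo_comp hf (holo_inv fz). Qed.

Lemma nbhs_modulusP z (A : set R[i]) :
  nbhs z A <-> exists2 e, 0 < e & forall w, modulus (w - z) < e -> A w.
Proof.
split.
  move/nbhs_ballP; case=> e /= e0 h.
  have ee : e = (complex.Re e)%:C by rewrite RRe_real// realE ltW.
  exists (complex.Re e); first by move: e0; rewrite ee ltcR.
  by move=> w hw; apply: h; rewrite /ball /= distrC normE ee ltcR.
case=> e e0 h; apply/nbhs_ballP; exists e%:C; first by rewrite /= ltcR.
by move=> w; rewrite /ball /= distrC normE ltcR; exact: h.
Qed.

Lemma open_modulusP (A : set R[i]) :
  open A <-> forall z, A z -> exists2 e, 0 < e & forall w, modulus (w - z) < e -> A w.
Proof.
split=> [|h]; first by rewrite openE => h z /h /nbhs_modulusP.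
by rewrite openE => z /h /nbhs_modulusP.
Qed.

Lemma entire_holo f : entire f -> forall z, holo f z.
Proof.
move=> ef z; have /cvg_ex [d] := ef z; rewrite /= => fd.
apply: (@diff_holo _ _ d) => e e0.
have /fd : nbhs d [set w | modulus (w - d) < e] by apply/nbhs_modulusP; exists e.
rewrite /nbhs /= /dnbhs /within /= => /nbhs_modulusP[s s0 h].
exists s => // w ws; have [->|wz] := eqVneq w z.
  by rewrite !subrr mulr0 subr0 modulus0 mulr0.
have wz0 : w - z != 0 by rewrite subr_eq0.
have := h (w - z); rewrite subr0 => /(_ ws wz0) /ltW.
have -> : (w - z)%:A + z = w by rewrite /GRing.scale /= mulr1 subrK.
rewrite /GRing.scale /= => k.
have -> : f w - f z - d * (w - z) = ((w - z)^-1 * (f w - f z) - d) * (w - z).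
  by field.
by rewrite modulusM ler_wpM2r ?modulus_ge0.
Qed.

End Basics.

(** * The complex exponential and logarithm *)

Section ComplexExp.
Variable R : realType.
Implicit Types (f g q : R[i] -> R[i]) (z w : R[i]) (e r x y : R).

Definition cexp z : R[i] :=
  (expR (complex.Re z) * cos (complex.Im z)) +i* (expR (complex.Re z) * sin (complex.Im z)).

Lemma cexp0 : cexp 0 = 1.
Proof. by rewrite /cexp /= expR0 cos0 sin0 mulr1 mulr0. Qed.

Lemma cexpD z w : cexp (z + w) = cexp z * cexp w.
Proof.
case: z w => [a b] [c d]; rewrite /cexp /= expRD cosD sinD.
by apply/eqP; rewrite eq_complex /=; apply/andP; split; apply/eqP; ring.
Qed.

Lemma modulus_cexp z : modulus (cexp z) = expR (complex.Re z).
Proof.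
apply/eqP; rewrite -(@eqrXn2 _ 2%N) ?modulus_ge0 ?expR_ge0//; apply/eqP.
rewrite modulus_sqr /= !exprMn -mulrDr.
by rewrite (cos2Dsin2 (complex.Im z)) mulr1.
Qed.

Lemma cexp_neq0 z : cexp z != 0.
Proof. by rewrite -modulus_gt0 modulus_cexp expR_gt0. Qed.

Lemma cexp_periodic z : cexp (z + 0 +i* (2 * pi)) = cexp z.
Proof. by case: z => a b; rewrite /cexp /= addr0 mulr_natl cosD2pi sinD2pi. Qed.

Lemma is_derive_littleo (h : R -> R) x d : is_derive x 1 h d ->
  forall e, 0 < e -> exists2 s, 0 < s &
    forall y, `|y| < s -> `|h (x + y) - h x - d * y| <= e * `|y|.
Proof.
move=> /is_derive1_caratheodory [q [hE cq qx]] e e0.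
have /cvgrPdist_lt /(_ e e0) := cq.
move=> /nbhs_ballP[s s0 hs]; exists s => // y ys.
have := hs (x + y); rewrite /ball /= opprD addNKr normrN => /(_ ys) /ltW.
rewrite hE qx => k.
have -> : q (x + y) * (x + y - x) - d * y = - ((d - q (x + y)) * y) by ring.
by rewrite normrN normrM ler_wpM2r.
Qed.

Lemma cexp_diff0 e : 0 < e -> exists2 s, 0 < s &
  forall h, modulus h < s -> modulus (cexp h - 1 - h) <= e * modulus h.
Proof.
move=> e0; 
have [e' [e'0 e'1 e'e]] : exists e', [/\ 0 < e', e' <= 1 & e' <= e / 8].
  by exists (Num.min (e / 8) 1); rewrite lt_min !ge_min !lexx orbT divr_gt0/= ?ltr01.
have [s1 s10 h1] := is_derive_littleo (is_derive_expR (0 : R)) e'0.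
have [s2 s20 h2] := is_derive_littleo (is_derive_cos (0 : R)) e'0.
have [s3 s30 h3] := is_derive_littleo (is_derive_sin (0 : R)) e'0.
exists (Num.min e' (Num.min s1 (Num.min s2 s3))).
  by rewrite !lt_min e'0 s10 s20.
case=> x y; set m := modulus (x +i* y); rewrite !lt_min => /and4P[m0 m1 m2 m3].
have xm : `|x| <= m := le_Re_modulus (x +i* y).
have ym : `|y| <= m := le_Im_modulus (x +i* y).
have := h1 x (le_lt_trans xm m1); have := h2 y (le_lt_trans ym m2).
have := h3 y (le_lt_trans ym m3).
rewrite !add0r expR0 sin0 cos0 oppr0 mul0r !mul1r !subr0 ?addr0 => k3 k2 k1.
apply: le_trans (modulus_le_ReIm _) _ => /=.
have -> : expR x * cos y - 1 - x = (expR x - 1 - x) * cos y + (1 + x) * (cos y - 1) by ring.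
rewrite subr0.
have -> : expR x * sin y - y = (expR x - 1 - x) * sin y + x * sin y + (sin y - y) by ring.
have m_ge0 : 0 <= m by exact: modulus_ge0.
have c1 : `|cos y| <= 1 by rewrite ler_norml cos_geN1 cos_le1.
have s1' : `|sin y| <= 1 by rewrite ler_norml sin_geN1 sin_le1.
have K1 : `|expR x - 1 - x| <= e' * m.
  by apply: le_trans k1 _; rewrite ler_wpM2l// ltW.
have K2 : `|cos y - 1| <= e' * m.
  by apply: le_trans k2 _; rewrite ler_wpM2l// ltW.
have K3 : `|sin y - y| <= e' * m.
  by apply: le_trans k3 _; rewrite ler_wpM2l// ltW.
have L1 : `|(expR x - 1 - x) * cos y| <= e' * m.
  by rewrite normrM; apply: le_trans _ K1; rewrite ler_piMr.
have L2 : `|(1 + x) * (cos y - 1)| <= 2 * (e' * m).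
  rewrite normrM; apply: ler_pM => //.
  by apply: le_trans (ler_normD _ _) _; rewrite normr1; lra.
have L3 : `|(expR x - 1 - x) * sin y| <= e' * m.
  by rewrite normrM; apply: le_trans _ K1; rewrite ler_piMr.
have L4 : `|x * sin y| <= 2 * (e' * m).
  rewrite normrM.
  have S : `|sin y| <= 2 * e'.
    have -> : sin y = (sin y - y) + y by ring.
    apply: le_trans (ler_normD _ _) _.
    have : e' * m <= e' by rewrite ler_piMr//; lra.
    lra.
  have -> : 2 * (e' * m) = m * (2 * e') by ring.
  exact: ler_pM.
have := ler_normD ((expR x - 1 - x) * cos y) ((1 + x) * (cos y - 1)).
have := ler_normD ((expR x - 1 - x) * sin y + x * sin y) (sin y - y).
have := ler_normD ((expR x - 1 - x) * sin y) (x * sin y).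
have : 0 <= e' * m by rewrite mulr_ge0// ltW.
have : 8 * (e' * m) <= e * m.
  by rewrite mulrA ler_wpM2r//; lra.
lra.
Qed.

Lemma cexp_caratheodory z : exists q, [/\ contat q z, q z = cexp z &
  forall w, cexp w = cexp z + q w * (w - z)].
Proof.
pose p (h : R[i]) := if h == 0 then 1 else (cexp h - 1) / h.
have pE h : cexp h = 1 + p h * h.
  rewrite /p; case: eqVneq => [->|h0]; first by rewrite cexp0 mulr0 addr0.
  by rewrite divfK// addrC subrK.
have cp : contat p 0.
  move=> e e0; have [s s0 hs] := cexp_diff0 (divr_gt0 e0 (ltr0n R 2)).
  exists s => // w; rewrite subr0 => hw; rewrite /p eqxx.
  case: eqVneq => [_|w0]; first by rewrite subrr modulus0.
  have -> : (cexp w - 1) / w - 1 = (cexp w - 1 - w) / w by field.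
  rewrite modulusM modulusV ltr_pdivrMr ?modulus_gt0//.
  apply: le_lt_trans (hs _ hw) _; rewrite ltr_pM2r ?modulus_gt0//; lra.
exists (fun w => cexp z * p (w - z)); split.
- apply: contatM; first exact: contat_cst.
  apply: contat_comp; last by rewrite subrr.
  by apply: contatB; [exact: contat_id|exact: contat_cst].
- by rewrite subrr /p eqxx mulr1.
- move=> w; have -> : cexp w = cexp z * cexp (w - z) by rewrite -cexpD addrC subrK.
  by rewrite (pE (w - z)); ring.
Qed.

Lemma holo_cexp z : holo cexp z.
Proof. by have [q [cq _ E]] := cexp_caratheodory z; exists q. Qed.

(** The bound on the argument is essential later: divided by the large number u_n(p), a bounded
    argument disappears. *)
Lemma polar z : z != 0 -> exists2 t, `|t| <= pi & z = cexp (ln (modulus z) +i* t).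
Proof.
move=> z0; have m0 : 0 < modulus z by rewrite modulus_gt0.
pose c := complex.Re z / modulus z.
have cb : -1 <= c <= 1.
  rewrite -ler_norml normrM normfV [`|modulus z|]ger0_norm ?modulus_ge0//.
  by rewrite ler_pdivrMr// mul1r le_Re_modulus.
have cin : c \in `[(-1), 1] by rewrite in_itv.
have mc : modulus z * c = complex.Re z by rewrite /c mulrC divfK// gt_eqF.
have s2 : modulus z * Num.sqrt (1 - c ^+ 2) = `|complex.Im z|.
  rewrite -{1}[modulus z]ger0_norm ?modulus_ge0// -sqrtr_sqr -sqrtrM ?sqr_ge0//.
  rewrite -sqrtr_sqr; congr Num.sqrt; rewrite mulrBr mulr1 -exprMn mc.
  by rewrite modulus_sqr; ring.
have pi0 := pi_ge0 R.
have [im0|im0] := leP 0 (complex.Im z).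
  exists (acos c).
    by rewrite ger0_norm ?acos_ge0// acos_lepi.
  rewrite /cexp /= lnK ?posrE// acosK// sin_acos// mc s2 ger0_norm//.
  by case: (z).
exists (- acos c).
  by rewrite normrN ger0_norm ?acos_ge0// acos_lepi.
rewrite /cexp /= lnK ?posrE// cosN sinN acosK// sin_acos// mulrN mc s2 ltr0_norm// opprK.
by case: (z).
Qed.

(** The principal branch, meaningful only on the right half-plane; it is applied to ratios close to
    1. *)
Definition clog z : R[i] := ln (modulus z) +i* atan (complex.Im z / complex.Re z).

Lemma clogK z : 0 < complex.Re z -> cexp (clog z) = z.
Proof.
case: z => a b /= a0; rewrite /cexp /clog.
have m0 : 0 < modulus (a +i* b).
  by apply: lt_le_trans (le_Re_modulus _); rewrite /= normr_gt0 gt_eqF.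
have E : modulus (a +i* b) = a * Num.sqrt (1 + (b / a) ^+ 2).
  have -> : a * Num.sqrt (1 + (b / a) ^+ 2) = Num.sqrt (a ^+ 2) * Num.sqrt (1 + (b / a) ^+ 2).
    by rewrite sqrtr_sqr ger0_norm// ltW.
  rewrite -sqrtrM ?sqr_ge0// /modulus /=; congr Num.sqrt.
  by field; exact: lt0r_neq0.
rewrite [complex.Re _]/= [complex.Im _]/= lnK ?posrE//.
have s0 : 0 < Num.sqrt (1 + (b / a) ^+ 2).
  by rewrite sqrtr_gt0 ltr_wpDr ?sqr_ge0.
have C : modulus (a +i* b) * cos (atan (b / a)) = a.
  by rewrite cos_atan E mulfK// gt_eqF.
have S : sin (atan (b / a)) = (b / a) * cos (atan (b / a)).
  rewrite -{2}[b / a]atanK /tan divfK// cos_atan invr_neq0// gt_eqF//.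
rewrite C S mulrCA C; congr (_ +i* _).
by rewrite divfK// gt_eqF.
Qed.

Lemma clog1 : clog 1 = 0.
Proof. by rewrite /clog modulus1 ln1 /= mul0r atan0. Qed.

Lemma contat_clog z : 0 < complex.Re z -> contat clog z.
Proof.
move=> a0.
have m0 : 0 < modulus z.
  by apply: lt_le_trans (le_Re_modulus _); rewrite /= normr_gt0 gt_eqF.
move=> e e0.
have e2 : 0 < e / 2 by rewrite divr_gt0.
have /cvgrPdist_lt /(_ _ e2) := continuous_ln m0.
move=> /nbhs_ballP[s s0 hs].
set t0 := complex.Im z / complex.Re z.
have /cvgrPdist_lt /(_ _ e2) := @continuous_atan R t0.
move=> /nbhs_ballP[s' s'0 hs'].
have cdiv : forall d, 0 < d -> exists2 r, 0 < r & forall w, modulus (w - z) < r ->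
    `|t0 - complex.Im w / complex.Re w| < d.
  move=> d d0.
  have cRe : contat (fun w => (complex.Re w)%:C) z.
    move=> d' d'0; exists d' => // w hw.
    by rewrite -rmorphB modulus_real -ReN -ReD; apply: le_lt_trans (le_Re_modulus _) hw.
  have cIm : contat (fun w => (complex.Im w)%:C) z.
    move=> d' d'0; exists d' => // w hw.
    by rewrite -rmorphB modulus_real -ImN -ImD; apply: le_lt_trans (le_Im_modulus _) hw.
  have n0 : (complex.Re z)%:C != 0 by rewrite -modulus_gt0 modulus_real normr_gt0 gt_eqF.
  have [r r0 hr] := contatM cIm (contatV cRe n0) d0.
  exists r => // w /hr; rewrite -!fmorphV -!rmorphM -rmorphB modulus_real distrC//.
have [r r0 hr] := cdiv _ s'0.
exists (Num.min r s); first by rewrite lt_min r0.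
move=> w; rewrite lt_min => /andP[w1 w2].
apply: le_lt_trans (modulus_le_ReIm _) _; rewrite !ReD !ImD !ReN !ImN.
have k1 : `|ln (modulus z) - ln (modulus w)| < e / 2.
  apply: hs; rewrite /ball /=; apply: le_lt_trans w2.
  by rewrite ler_norml lerNl opprB {2}modulusB !ler_modulusB.
have k2 : `|atan t0 - atan (complex.Im w / complex.Re w)| < e / 2.
  by apply: hs'; exact: hr.
by rewrite /clog /= distrC [X in _ + X]distrC; lra.
Qed.

(** Inverse function rule: the Caratheodory factor [q] of [cexp] at [clog z] has a non-zero value
    there, and near [z] the difference quotient of [clog] is the reciprocal of [q] along [clog]. *)
Lemma holo_clog z : 0 < complex.Re z -> holo clog z.
Proof.
move=> a0; have [q [cq qz qE]] := cexp_caratheodory (clog z).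
have cl := contat_clog a0.
have q0 : q (clog z) != 0 by rewrite qz cexp_neq0.
have [d hd] : exists d, forall e, 0 < e -> exists2 s, 0 < s &
    forall w, modulus (w - z) < s ->
      modulus (clog w - clog z - d * (w - z)) <= e * modulus (w - z); last first.
  exact: (diff_holo hd).
have cV : contat (fun w => (q (clog w))^-1) z.
  by apply: contatV => //; exact: contat_comp cq.
exists (q (clog z))^-1 => e e0.
have [s s0 hs] := cV _ e0.
exists (Num.min s (complex.Re z)); first by rewrite lt_min s0.
move=> w; rewrite lt_min => /andP[w1 w2].
have aw : 0 < complex.Re w.
  have := le_Re_modulus (w - z); rewrite ReD ReN => /ler_normlP[]; lra.
have := qE (clog w); rewrite !clogK// => E.
have qw0 : q (clog w) != 0.
  apply/negP => /eqP q0'; move: E; rewrite q0' mul0r addr0 => wz.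
  by move: q0; rewrite -wz q0' eqxx.
have -> : clog w - clog z - (q (clog z))^-1 * (w - z) =
    ((q (clog w))^-1 - (q (clog z))^-1) * (w - z).
  have -> : w - z = q (clog w) * (clog w - clog z) by rewrite {1}E; ring.
  by field; rewrite q0 qw0.
by rewrite modulusM ler_wpM2r ?modulus_ge0// ltW// hs.
Qed.

End ComplexExp.

(** * Goursat's theorem for Riemann sums *)

Section Goursat.
Variable R : realType.
Implicit Types (e r x y : R) (N i j k l : nat).
Variables (g : R[i] -> R[i]) (x0 y0 a b : R).
Hypotheses (a0 : 0 < a) (b0 : 0 < b).

Definition grid_point N i j : R[i] := (x0 + a * (i%:R / 2 ^+ N)) +i* (y0 + b * (j%:R / 2 ^+ N)).
Definition hsum N i0 i1 j := \sum_(i0 <= i < i1) g (grid_point N i j) * (a / 2 ^+ N)%:C.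
Definition vsum N j0 j1 i := \sum_(j0 <= j < j1) g (grid_point N i j) * (b / 2 ^+ N)%:C.
(* Riemann sums for minus the integral of g along the boundary of a sub-rectangle. *)
Definition bsum N i0 i1 j0 j1 :=
  hsum N i0 i1 j1 - hsum N i0 i1 j0 - 'i * (vsum N j0 j1 i1 - vsum N j0 j1 i0).

Lemma bsum_split_h N i0 i1 i2 j0 j1 : (i0 <= i1 <= i2)%N ->
  bsum N i0 i2 j0 j1 = bsum N i0 i1 j0 j1 + bsum N i1 i2 j0 j1.
Proof.
move=> /andP[h1 h2]; rewrite /bsum /hsum.
by rewrite !(big_cat_nat h1 h2)/=; ring.
Qed.

Lemma bsum_split_v N i0 i1 j0 j1 j2 : (j0 <= j1 <= j2)%N ->
  bsum N i0 i1 j0 j2 = bsum N i0 i1 j0 j1 + bsum N i0 i1 j1 j2.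
Proof.
move=> /andP[h1 h2]; rewrite /bsum /vsum.
by rewrite !(big_cat_nat h1 h2)/=; ring.
Qed.

(** The boundary sum of the cell with index (i, j) in the dyadic subdivision of level [k], sampled
    on the grid of level [k + l]. A cell and its four quarters are sampled on the same grid, so
    subdivision is an exact identity between sums. *)
Definition cell k i j l := bsum (k + l) (i * 2 ^ l) (i.+1 * 2 ^ l) (j * 2 ^ l) (j.+1 * 2 ^ l).

Lemma cell_split k i j l : cell k i j l.+1 =
  cell k.+1 i.*2 j.*2 l + cell k.+1 i.*2.+1 j.*2 l +
  cell k.+1 i.*2 j.*2.+1 l + cell k.+1 i.*2.+1 j.*2.+1 l.
Proof.
have E1 m : (m * 2 ^ l.+1 = m.*2 * 2 ^ l)%N by rewrite expnS mulnA muln2.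
have le1 m : (m * 2 ^ l <= m.+1 * 2 ^ l <= m.+2 * 2 ^ l)%N by rewrite !leq_mul2r !leqnSn !orbT.
rewrite /cell !E1 !doubleS addSnnS.
rewrite (bsum_split_h _ _ _ (le1 i.*2)) !(bsum_split_v _ _ _ (le1 j.*2)).
by rewrite addrACA !addrA.
Qed.

Lemma modulus_sumr i0 i1 (F : nat -> R[i]) (B : R) : (i0 <= i1)%N ->
  (forall i, (i0 <= i < i1)%N -> modulus (F i) <= B) ->
  modulus (\sum_(i0 <= i < i1) F i) <= (i1 - i0)%:R * B.
Proof.
move=> le FB; apply: le_trans (modulus_sum _ _ _) _.
rewrite big_nat; apply: le_trans (ler_sum _ FB) _.
by rewrite -big_nat sumr_const_nat mulr_natl.
Qed.

Lemma mulrn_real (c : R[i]) x n : (c * x%:C) *+ n = c * (x * n%:R)%:C.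
Proof.
elim: n => [|n ih]; first by rewrite mulr0n !mulr0.
by rewrite mulrS ih -natr1 mulrDr mulr1 rmorphD/= mulrDr addrC.
Qed.

(** The affine part of [g] contributes exactly zero already at the level of Riemann sums: both pairs
    of opposite sides give [d * 'i] times the area. Only the error [e] times the perimeter
    survives. *)
Lemma bsum_affine N i0 i1 j0 j1 (p d : R[i]) (e : R) :
  (i0 <= i1)%N -> (j0 <= j1)%N -> 0 <= e ->
  (forall i j, (i0 <= i <= i1)%N -> (j0 <= j <= j1)%N ->
     modulus (g (grid_point N i j) - g p - d * (grid_point N i j - p)) <= e) ->
  modulus (bsum N i0 i1 j0 j1) <=
    2 * e * (a * ((i1 - i0)%:R / 2 ^+ N) + b * ((j1 - j0)%:R / 2 ^+ N)).
Proof.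
move=> lei lej e0 h.
pose E i j := g (grid_point N i j) - g p - d * (grid_point N i j - p).
have gE i j : g (grid_point N i j) = g p + d * (grid_point N i j - p) + E i j.
  by rewrite /E; ring.
have H1 : hsum N i0 i1 j1 - hsum N i0 i1 j0 =
   d * 'i * ((b * ((j1 - j0)%:R / 2 ^+ N)) * (a * ((i1 - i0)%:R / 2 ^+ N)))%:C
   + \sum_(i0 <= i < i1) (E i j1 - E i j0) * (a / 2 ^+ N)%:C.
  rewrite /hsum -sumrB.
  have -> : d * 'i * ((b * ((j1 - j0)%:R / 2 ^+ N)) * (a * ((i1 - i0)%:R / 2 ^+ N)))%:C
    = \sum_(i0 <= i < i1) (d * 'i * ((b * ((j1 - j0)%:R / 2 ^+ N)) * (a / 2 ^+ N))%:C).
    by rewrite sumr_const_nat mulrn_real; congr (_ * _%:C); ring.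
  rewrite -big_split /=; apply: eq_big_nat => i _; rewrite -mulrBl !gE.
  have -> : (g p + d * (grid_point N i j1 - p) + E i j1 - (g p + d * (grid_point N i j0 - p) + E i j0))
     = d * (grid_point N i j1 - grid_point N i j0) + (E i j1 - E i j0) by ring.
  have -> : grid_point N i j1 - grid_point N i j0 = 'i * (b * ((j1 - j0)%:R / 2 ^+ N))%:C.
    by apply/eqP; rewrite eq_complex /= natrB//; apply/andP; split; apply/eqP; ring.
  by rewrite [(_ * (a / _))%:C]rmorphM; ring.
have H2 : vsum N j0 j1 i1 - vsum N j0 j1 i0 =
   d * ((b * ((j1 - j0)%:R / 2 ^+ N)) * (a * ((i1 - i0)%:R / 2 ^+ N)))%:C
   + \sum_(j0 <= j < j1) (E i1 j - E i0 j) * (b / 2 ^+ N)%:C.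
  rewrite /vsum -sumrB.
  have -> : d * ((b * ((j1 - j0)%:R / 2 ^+ N)) * (a * ((i1 - i0)%:R / 2 ^+ N)))%:C
    = \sum_(j0 <= j < j1) (d * ((a * ((i1 - i0)%:R / 2 ^+ N)) * (b / 2 ^+ N))%:C).
    by rewrite sumr_const_nat mulrn_real; congr (_ * _%:C); ring.
  rewrite -big_split /=; apply: eq_big_nat => j _; rewrite -mulrBl !gE.
  have -> : (g p + d * (grid_point N i1 j - p) + E i1 j - (g p + d * (grid_point N i0 j - p) + E i0 j))
     = d * (grid_point N i1 j - grid_point N i0 j) + (E i1 j - E i0 j) by ring.
  have -> : grid_point N i1 j - grid_point N i0 j = (a * ((i1 - i0)%:R / 2 ^+ N))%:C.
    by apply/eqP; rewrite eq_complex /= natrB//; apply/andP; split; apply/eqP; ring.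
  by rewrite [(_ * (b / _))%:C]rmorphM; ring.
rewrite /bsum H1 H2.
set S1 := \sum_(_ <= _ < _) _; set S2 := \sum_(_ <= _ < _) _; set c := _%:C.
have -> : d * 'i * c + S1 - 'i * (d * c + S2) = S1 - 'i * S2 by ring.
apply: le_trans (modulusD _ _) _; rewrite modulusN modulusM modulusi mul1r.
have ma : modulus ((a / 2 ^+ N)%:C) = a / 2 ^+ N.
  by rewrite modulus_real ger0_norm// mulr_ge0// ltW.
have mb : modulus ((b / 2 ^+ N)%:C) = b / 2 ^+ N.
  by rewrite modulus_real ger0_norm// mulr_ge0// ltW.
have k1 : modulus S1 <= (i1 - i0)%:R * (2 * e * (a / 2 ^+ N)).
  apply: modulus_sumr => // i /andP[i01 i11]; rewrite modulusM ma.
  apply: ler_wpM2r; first by rewrite mulr_ge0// ltW.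
  apply: le_trans (modulusD _ _) _.
  rewrite modulusN; have := h i j1; have := h i j0.
  by rewrite !leqnn lej i01 (ltnW i11) => /(_ isT isT) + /(_ isT isT); rewrite -/(E _ _) -/(E _ _); lra.
have k2 : modulus S2 <= (j1 - j0)%:R * (2 * e * (b / 2 ^+ N)).
  apply: modulus_sumr => // j /andP[i01 i11]; rewrite modulusM mb.
  apply: ler_wpM2r; first by rewrite mulr_ge0// ltW.
  apply: le_trans (modulusD _ _) _.
  rewrite modulusN; have := h i1 j; have := h i0 j.
  by rewrite !leqnn lei i01 (ltnW i11) => /(_ isT isT) + /(_ isT isT); rewrite -/(E _ _) -/(E _ _); lra.
apply: le_trans (lerD k1 k2) _; rewrite le_eqVlt; apply/orP; left; apply/eqP; ring.
Qed.

Lemma nested_dyadic (s : nat -> nat) (u c : R) : 0 < c ->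
  (forall k, (s k).*2 <= s k.+1 <= (s k).*2.+1)%N ->
  exists t, forall k, u + c * ((s k)%:R / 2 ^+ k) <= t <= u + c * ((s k).+1%:R / 2 ^+ k).
Proof.
move=> c0 hs; pose v k := u + c * ((s k)%:R / 2 ^+ k).
pose v' k := u + c * ((s k).+1%:R / 2 ^+ k).
have p2 k : 0 < 2 ^+ k :> R by rewrite exprn_gt0.
have dbl m k : m%:R / 2 ^+ k = m.*2%:R / 2 ^+ k.+1 :> R.
  by rewrite -muln2 natrM exprS invfM; field; rewrite gt_eqF.
have mono m n k : (m <= n)%N -> u + c * (m%:R / 2 ^+ k) <= u + c * (n%:R / 2 ^+ k).
  by move=> mn; rewrite lerD2l ler_pM2l// ler_pM2r ?invr_gt0// ler_nat.
have vS k : v k <= v k.+1 by rewrite /v dbl mono//; case/andP: (hs k).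
have v'S k : v' k.+1 <= v' k.
  by rewrite /v' [in leRHS]dbl mono// doubleS ltnS; case/andP: (hs k).
have vv' k : v k <= v' k.
  exact: mono.
have vm k n : v k <= v (n + k)%N by elim: n => // n ih; apply: le_trans ih (vS _).
have v'm k n : v' (n + k)%N <= v' k by elim: n => // n ih; apply: le_trans (v'S _) ih.
have vle k n : v k <= v' n.
  apply: le_trans (vm k n) _; apply: le_trans (vv' _) _; rewrite addnC; exact: v'm.
have ub n : ubound (range v) (v' n) by move=> _ [k _ <-].
exists (sup (range v)) => k; apply/andP; split.
  apply: ub_le_sup; last by exists k.
  by exists (v' 0%N); exact: ub.
apply: ge_sup; last exact: ub.
by exists (v 0%N), 0%N.
Qed.

(** The bisection runs on the property of being small for all sufficiently fine grids: a cell whose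
    quarters are good is good, so a bad rectangle contains a nested sequence of bad cells.
    Differentiability at their common point makes a small one good. *)
Lemma goursat_dyadic :
  (forall z, x0 <= complex.Re z <= x0 + a -> y0 <= complex.Im z <= y0 + b -> holo g z) ->
  forall e, 0 < e -> exists L, forall l, (L <= l)%N ->
    modulus (bsum l 0 (2 ^ l) 0 (2 ^ l)) <= e.
Proof.
move=> hol e e0.
pose good k i j := exists L, forall l, (L <= l)%N -> modulus (cell k i j l) <= e / 4 ^+ k.
suff : good 0%N 0%N 0%N.
  case=> L hL; exists L => l /hL; rewrite /cell !mul0n !mul1n expr0 divr1.
  by rewrite add0n.
apply: contrapT => bad0.
have step k (ij : nat * nat) : ~ good k ij.1 ij.2 -> exists ij' : nat * nat,
   [/\ (ij.1.*2 <= ij'.1 <= ij.1.*2.+1)%N, (ij.2.*2 <= ij'.2 <= ij.2.*2.+1)%N &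
      ~ good k.+1 ij'.1 ij'.2].
  case: ij => i j /= nb; apply: contrapT => nex; apply: nb.
  have G i' j' : (i.*2 <= i' <= i.*2.+1)%N -> (j.*2 <= j' <= j.*2.+1)%N -> good k.+1 i' j'.
    by move=> hi hj; apply: contrapT => ng; apply: nex; exists (i', j').
  have [] := G i.*2 j.*2; rewrite ?leqnn ?leqnSn// => L1 h1.
  have [] := G i.*2.+1 j.*2; rewrite ?leqnn ?leqnSn// => L2 h2.
  have [] := G i.*2 j.*2.+1; rewrite ?leqnn ?leqnSn// => L3 h3.
  have [] := G i.*2.+1 j.*2.+1; rewrite ?leqnn ?leqnSn// => L4 h4.
  (* The successor is needed because a cell refined [l.+1] times splits into quarters refined [l]
     times. *)
  exists (maxn (maxn L1 L2) (maxn L3 L4)).+1; case=> // l; rewrite ltnS !geq_max.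
  move=> /andP[/andP[l1 l2] /andP[l3 l4]]; rewrite cell_split.
  have -> : e / 4 ^+ k = 4 * (e / 4 ^+ k.+1).
    by rewrite exprS invfM; field; rewrite expf_neq0.
  have := h1 _ l1; have := h2 _ l2; have := h3 _ l3; have := h4 _ l4.
  set A := cell _ _ _ _; set B := cell _ _ _ _; set C := cell _ _ _ _; set D := cell _ _ _ _.
  have := modulusD (D + C + B) A; have := modulusD (D + C) B; have := modulusD D C.
  lra.
have /choice[next nextP] : forall kij : nat * (nat * nat), exists ij' : nat * nat,
    ~ good kij.1 kij.2.1 kij.2.2 ->
    [/\ (kij.2.1.*2 <= ij'.1 <= kij.2.1.*2.+1)%N, (kij.2.2.*2 <= ij'.2 <= kij.2.2.*2.+1)%N &
      ~ good kij.1.+1 ij'.1 ij'.2].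
  move=> [k ij]; have [gd|/step[ij' h]] := pselect (good k ij.1 ij.2); last by exists ij'.
  by exists (0%N, 0%N).
pose fix s k := if k is k'.+1 then next (k', s k') else (0%N, 0%N).
have sbad k : ~ good k (s k).1 (s k).2.
  by elim: k => // k ih; have [] := nextP (k, s k) ih.
have sS k : ((s k).1.*2 <= (s k.+1).1 <= (s k).1.*2.+1)%N /\
            ((s k).2.*2 <= (s k.+1).2 <= (s k).2.*2.+1)%N.
  by have [] := nextP (k, s k) (sbad k).
have [x hx] := nested_dyadic x0 a0 (fun k => (sS k).1).
have [y hy] := nested_dyadic y0 b0 (fun k => (sS k).2).
pose p := x +i* y.
have hp : holo g p.
  apply: hol => /=.
    by have := hx 0%N; rewrite /= expr0 mul0r mulr0 addr0 divr1 mulr1.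
  by have := hy 0%N; rewrite /= expr0 mul0r mulr0 addr0 divr1 mulr1.
have [d hd] := holo_diff hp.
have ab0 : 0 < a + b by rewrite addr_gt0.
(* In a cell of level k both the distance to p and the half perimeter are at most (a + b) / 2 ^ k,
   so this constant turns the bound of [bsum_affine] into exactly e / 4 ^ k. *)
have e'0 : 0 < e / (2 * (a + b) ^+ 2) by rewrite divr_gt0// mulr_gt0// exprn_gt0.
have [r r0 hr] := hd _ e'0.
have [k hk] : exists k, (a + b) / 2 ^+ k < r.
  exists (Num.bound ((a + b) / r)); rewrite ltr_pdivrMr ?exprn_gt0//.
  have := archi_boundP (ltW (divr_gt0 ab0 r0)); rewrite ltr_pdivrMr// mulrC => h.
  apply: lt_trans h _; rewrite ltr_pM2l// -natrX ltr_nat; exact: ltn_expl.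
apply: (sbad k); exists 0%N => l _; rewrite /cell.
set i := (s k).1; set j := (s k).2.
have p2 n : 0 < 2 ^+ n :> R by rewrite exprn_gt0.
have near (m n : nat) (t u c : R) : 0 < c -> (m * 2 ^ l <= n <= m.+1 * 2 ^ l)%N ->
   u + c * (m%:R / 2 ^+ k) <= t <= u + c * (m.+1%:R / 2 ^+ k) ->
   `|u + c * (n%:R / 2 ^+ (k + l)) - t| <= c / 2 ^+ k.
  move=> c0 /andP[mn nm] /andP[tl tu].
  have nE : n%:R / 2 ^+ (k + l) = (n%:R / 2 ^+ l) / 2 ^+ k :> R.
    by rewrite exprD invfM; ring.
  have q1 : m%:R / 2 ^+ k <= n%:R / 2 ^+ (k + l) :> R.
    by rewrite nE ler_pM2r ?invr_gt0// ler_pdivlMr// -natrX -natrM ler_nat.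
  have q2 : n%:R / 2 ^+ (k + l) <= m.+1%:R / 2 ^+ k :> R.
    by rewrite nE ler_pM2r ?invr_gt0// ler_pdivrMr// -natrX -natrM ler_nat.
  have q3 : m.+1%:R / 2 ^+ k = m%:R / 2 ^+ k + (2 ^+ k)^-1 :> R by rewrite -natr1 mulrDl mul1r.
  move: q1 q2; rewrite -(ler_pM2l c0) -(ler_pM2l c0 (n%:R / _)) q3 mulrDr => q1 q2.
  have {}tu : t <= u + (c * (m%:R / 2 ^+ k) + c / 2 ^+ k) by rewrite -mulrDr -q3.
  rewrite ler_norml; apply/andP; split; lra.
have B := @bsum_affine (k + l) (i * 2 ^ l) (i.+1 * 2 ^ l) (j * 2 ^ l) (j.+1 * 2 ^ l) p d
   (e / (2 * (a + b) ^+ 2) * ((a + b) / 2 ^+ k)).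
apply: le_trans (B _ _ _ _) _.
- by rewrite leq_mul2r leqnSn orbT.
- by rewrite leq_mul2r leqnSn orbT.
- by rewrite mulr_ge0// ?ltW// divr_gt0.
- move=> i' j' hi' hj'.
  have n1 := near _ _ _ _ _ a0 hi' (hx k); have n2 := near _ _ _ _ _ b0 hj' (hy k).
  have M : modulus (grid_point (k + l) i' j' - p) <= (a + b) / 2 ^+ k.
    by apply: le_trans (modulus_le_ReIm _) _; rewrite /= mulrDl lerD.
  apply: le_trans (hr _ (le_lt_trans M hk)) _.
  by rewrite ler_wpM2l// ltW.
- have dE m : (m.+1 * 2 ^ l - m * 2 ^ l)%:R / 2 ^+ (k + l) = (2 ^+ k)^-1 :> R.
    by rewrite -mulnBl subSn// subnn mul1n natrX exprD invfM mulrCA divff ?mulr1// gt_eqF.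
  rewrite !dE le_eqVlt; apply/orP; left; apply/eqP.
  have -> : 4 ^+ k = 2 ^+ k * 2 ^+ k :> R by rewrite -exprMn; congr (_ ^+ _); ring.
  by field; rewrite !gt_eqF//.
Qed.

End Goursat.

(** * The maximum principle *)

Section MaximumPrinciple.
Variable R : realType.
Implicit Types (f g : R[i] -> R[i]) (u v : R[i] -> R) (z w : R[i]) (e r x y : R).

Lemma Re_sum I (s : seq I) (P : pred I) (F : I -> R[i]) :
  complex.Re (\sum_(i <- s | P i) F i) = \sum_(i <- s | P i) complex.Re (F i).
Proof. by elim/big_rec2: _ => // i y1 y2 _ <-; rewrite ReD. Qed.

Lemma ReMr z (x : R) : complex.Re (z * x%:C) = complex.Re z * x.
Proof. by case: z => a b; rewrite /= mulr0 subr0. Qed.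

(** Under z -> a + exp z a rectangle of height 2 pi covers a ring about [a]. Periodicity cancels the
    horizontal sides, so the sums over the two vertical sides nearly agree. One side gives values
    near f(a), the other the values on the circle of radius r. Only continuity is required at [a],
    since the ring never reaches it. *)
Lemma circle_Re_ge f a r : 0 < r -> contat f a ->
  (forall z, 0 < modulus (z - a) <= r -> holo f z) ->
  exists2 w, modulus (w - a) = r & complex.Re (f a) <= complex.Re (f w).
Proof.
move=> r0 cf hf; apply: contrapT => nex.
pose pt (x t : R) : R[i] := a + cexp (x +i* t).
have ptE x t : modulus (pt x t - a) = expR x by rewrite /pt addrAC subrr add0r modulus_cexp.
have lt_circle t : complex.Re (f (pt (ln r) t)) < complex.Re (f a).
  rewrite ltNge; apply/negP => h; apply: nex; exists (pt (ln r) t) => //.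
  by rewrite ptE lnK.
have pi0 := pi_gt0 R.
have cont : {within `[0, 2 * pi], continuous (fun t => complex.Re (f (pt (ln r) t)))}.
  apply: continuous_subspaceT => t; apply/cvgrPdist_lt => e e0.
  have /holo_contat/contat_comp : holo (fun z => a + cexp (ln r +i* 0 + z)) ('i * t%:C).
    apply: holoD; first exact: holo_cst.
    apply: holo_comp; last exact: holo_cexp.
    by apply: holoD; [exact: holo_cst|exact: holo_id].
  have ptC s : pt (ln r) s = a + cexp (ln r +i* 0 + 'i * s%:C).
    by rewrite /pt; congr (_ + cexp _); apply/eqP; rewrite eq_complex /=; apply/andP; split; apply/eqP; ring.
  move=> /(_ f); rewrite -ptC => /(_ (holo_contat (hf _ _))).
  rewrite ptE lnK// r0 lexx => /(_ isT e e0)[s s0 hs].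
  apply/nbhs_ballP; exists s => // t'; rewrite /ball /= => tt'.
  have := hs ('i * t'%:C); rewrite -mulrBr modulusM modulusi mul1r -rmorphB modulus_real distrC.
  move=> /(_ tt'); rewrite -!ptC; apply: le_lt_trans.
  by rewrite distrC -ReN -ReD; exact: le_Re_modulus.
have twopi : 0 <= 2 * pi :> R by rewrite mulr_ge0// ltW.
have [c _ cmax] := EVT_max twopi cont.
pose d := complex.Re (f a) - complex.Re (f (pt (ln r) c)).
have d0 : 0 < d by rewrite subr_gt0.
have [s s0 hs] := cf _ (divr_gt0 d0 (ltr0n R 4)).
(* The left side is mapped to a circle so small that Re f differs there from Re (f a) by at most d /
   4. *)
pose x0 := ln (Num.min r s / 2).
have m0 : 0 < Num.min r s by rewrite lt_min r0.
have ex0 : expR x0 = Num.min r s / 2 by rewrite lnK// posrE divr_gt0.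
have ex0r : expR x0 < r.
  have : Num.min r s <= r by rewrite ge_min lexx.
  by rewrite ex0; move: m0; set m := Num.min _ _; lra.
have ex0s : expR x0 < s.
  have : Num.min r s <= s by rewrite ge_min lexx orbT.
  by rewrite ex0; move: m0; set m := Num.min _ _; lra.
have w0 : 0 < ln r - x0 by rewrite subr_gt0 -ltr_expR lnK.
pose g z := f (a + cexp z).
have gpt x t : g (x +i* t) = f (pt x t) by [].
have twopi0 : 0 < 2 * pi :> R by rewrite mulr_gt0.
have [z zr _|L] := goursat_dyadic w0 twopi0 (g := g) (x0 := x0) (y0 := 0) _ d0.
  apply: holo_comp.
    by apply: holoD; [exact: holo_cst|exact: holo_cexp].
  apply: hf; rewrite addrAC subrr add0r modulus_cexp expR_gt0/=.
  by case/andP: zr => _; rewrite addrC subrK -ler_expR lnK.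
move=> /(_ L (leqnn _)).
have L0 : 2 ^+ L != 0 :> R by rewrite expf_neq0.
have full : (2 ^ L)%:R / 2 ^+ L = 1 :> R by rewrite natrX divff.
rewrite /bsum.
have -> : hsum g x0 0 (ln r - x0) (2 * pi) L 0 (2 ^ L) (2 ^ L) =
          hsum g x0 0 (ln r - x0) (2 * pi) L 0 (2 ^ L) 0.
  apply: eq_bigr => i _; congr (_ * _); rewrite /g; congr (f (a + _)).
  rewrite -[RHS]cexp_periodic; congr cexp; rewrite /grid_point full mul0r.
  by apply/eqP; rewrite eq_complex /=; apply/andP; split; apply/eqP; ring.
rewrite subrr sub0r modulusN modulusM modulusi mul1r.
set V1 := vsum _ _ _ _ _ _ _ _ _; set V0 := vsum _ _ _ _ _ _ _ _ _.
have Vsum (B : R) : \sum_(0 <= j < 2 ^ L) (B * (2 * pi / 2 ^+ L)) = B * (2 * pi) :> R.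
  rewrite sumr_const_nat subn0 -[LHS]mulr_natr natrX -mulrA; congr (_ * _).
  by field.
have k1 : complex.Re V1 <= (complex.Re (f a) - d) * (2 * pi).
  rewrite -Vsum /V1 /vsum Re_sum; apply: ler_sum_nat => j /andP[_ jL].
  rewrite ReMr ler_wpM2r//; first by rewrite divr_ge0// exprn_ge0.
  rewrite /grid_point full mulr1 addrC subrK add0r gpt.
  have -> : complex.Re (f a) - d = complex.Re (f (pt (ln r) c)) by rewrite /d; ring.
  apply: cmax; rewrite in_itv/=; rewrite mulr_ge0//= ?divr_ge0// ?exprn_ge0//.
  by rewrite ler_piMr// ler_pdivrMr ?exprn_gt0// mul1r -natrX ler_nat ltnW.
have k0 : (complex.Re (f a) - d / 4) * (2 * pi) <= complex.Re V0.
  rewrite -Vsum /V0 /vsum Re_sum; apply: ler_sum_nat => j /andP[_ jL].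
  rewrite ReMr ler_wpM2r//; first by rewrite divr_ge0// exprn_ge0.
  rewrite /grid_point mul0r mulr0 addr0 gpt.
  set t := 0 + _; have := hs (pt x0 t); rewrite ptE => /(_ ex0s) /ltW.
  move=> /(le_trans (le_Re_modulus _)); rewrite ReD ReN ler_norml => /andP[+ _].
  by lra.
have := le_Re_modulus (V1 - V0); rewrite ReD ReN ler_norml => /andP[+ _].
(* The two sums differ by at least 2 pi (d - d / 4), which exceeds the Goursat error d because pi >=
   2. *)
have dp : 0 <= d * (pi - 2) by rewrite mulr_ge0 ?subr_ge0 ?pi_ge2// ltW.
move=> h1 h2.
lra.
Qed.

Definition contatR u z := forall e, 0 < e -> exists2 r, 0 < r &
  forall w, modulus (w - z) < r -> `|u w - u z| < e.

Lemma contatR_modulus f z : contat f z -> contatR (fun w => modulus (f w)) z.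
Proof.
move=> cf e e0; have [r r0 h] := cf _ e0; exists r => // w /h; apply: le_lt_trans.
have := ler_modulusB (f w) (f z); have := ler_modulusB (f z) (f w).
by rewrite [modulus (f z - _)]modulusB ler_norml => h1 h2; apply/andP; split; lra.
Qed.

Lemma compact_max (K : set R[i]) u : compact K -> K !=set0 ->
  (forall z, K z -> contatR u z) -> exists2 c, K c & forall z, K z -> u z <= u c.
Proof.
move=> cK K0 cu.
have cont : {within K, continuous u}.
  apply: continuous_in_subspaceT => z /set_mem /cu cuz.
  move=> A /nbhs_ballP[e e0 hA]; have [r r0 h] := cuz _ e0.
  by apply/nbhs_modulusP; exists r => // w /h uw; apply: hA; rewrite /ball /= distrC.
have [c cKc h] := compact_EVT_max K0 cK cont.
by exists c; [exact: set_mem|move=> z Kz; apply: h; exact: mem_set].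
Qed.

Lemma compact_bound (K : set R[i]) f : compact K -> (forall z, K z -> contat f z) ->
  exists2 B, 0 < B & forall z, K z -> modulus (f z) <= B.
Proof.
move=> cK cf; have [->|/set0P K0] := eqVneq K set0; first by exists 1.
have [c Kc h] := compact_max cK K0 (fun z Kz => contatR_modulus (cf z Kz)).
exists (modulus (f c) + 1); first by rewrite ltr_wpDl// modulus_ge0.
by move=> z /h; lra.
Qed.

Lemma modulus_sqrD z w :
  modulus (z + w) ^+ 2 = modulus z ^+ 2 + 2 * complex.Re (z^* * w) + modulus w ^+ 2.
Proof. by case: z w => [a b] [c d]; rewrite !modulus_sqr /=; ring. Qed.

Lemma contatR_sqr u z : contatR u z -> contatR (fun w => u w ^+ 2) z.
Proof.
move=> cu e e0.
have A0 : 0 < 2 * `|u z| + 1 by have := normr_ge0 (u z); lra.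
have [r r0 h] := cu _ (@ltr01 R).
have [s s0 h'] := cu _ (divr_gt0 e0 A0).
exists (Num.min r s); first by rewrite lt_min r0.
move=> w; rewrite lt_min => /andP[/h k1 /h']; rewrite ltr_pdivlMr// => k2.
rewrite subr_sqr normrM; apply: le_lt_trans k2; rewrite ler_wpM2l//.
have -> : u w + u z = (u w - u z) + 2 * u z by ring.
apply: le_trans (ler_normD _ _) _; rewrite normrM (ger0_norm (ler0n R 2)); lra.
Qed.

Lemma contatRD u v z : contatR u z -> contatR v z -> contatR (fun w => u w + v w) z.
Proof.
move=> cu cv e e0.
have e2 : 0 < e / 2 by rewrite divr_gt0.
have [r r0 h] := cu _ e2; have [s s0 h'] := cv _ e2.
exists (Num.min r s); first by rewrite lt_min r0.
move=> w; rewrite lt_min => /andP[/h k1 /h' k2].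
have -> : u w + v w - (u z + v z) = (u w - u z) + (v w - v z) by ring.
have := ler_normD (u w - u z) (v w - v z); lra.
Qed.

(** Adding a small multiple of |z| ^ 2 to |f| ^ 2 makes the function strictly subharmonic, so that
    its maximum over [K] must lie in [S], which plays the part of the boundary. No discussion of the
    case of constant functions is needed. *)
Theorem max_principle (K S : set R[i]) f (M : R) : compact K ->
  (forall z, K z -> contat f z) ->
  (forall z, K z -> ~ S z -> exists2 r, 0 < r &
     (forall w, modulus (w - z) <= r -> K w) /\
     (forall w, 0 < modulus (w - z) <= r -> holo f w)) ->
  (forall z, K z -> S z -> modulus (f z) <= M) ->
  forall z, K z -> modulus (f z) <= M.
Proof.
move=> cK cf hol hM z1 Kz1; rewrite leNgt; apply/negP => Mlt.
have K0 : K !=set0 by exists z1.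
have [B B0 hB] := compact_bound cK (fun z _ => @contat_id R z).
have peak e : 0 < e -> exists2 c, K c /\ S c &
    modulus (f z1) ^+ 2 <= modulus (f c) ^+ 2 + e * B ^+ 2.
  move=> e0; pose v z := modulus (f z) ^+ 2 + modulus ((Num.sqrt e)%:C * z) ^+ 2.
  have vE z : v z = modulus (f z) ^+ 2 + e * modulus z ^+ 2.
    by rewrite /v modulusM exprMn modulus_real real_normK ?num_real// sqr_sqrtr// ltW.
  have cv z : K z -> contatR v z.
    move=> Kz; apply: contatRD; apply: contatR_sqr; apply: contatR_modulus; first exact: cf.
    by apply: contatM; [exact: contat_cst|exact: contat_id].
  have [c Kc cmax] := compact_max cK K0 cv.
  exists c.
    split => //; apply: contrapT => nSc.
    have [r r0 [rK rhol]] := hol c Kc nSc.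
    (* Twice Re k is the linear part of the increment of v at c. The remaining part is |f w - f c| ^
       2 + e r ^ 2 > 0, so a point of the circle with Re k >= 0 contradicts the maximality of c. *)
    pose k w := (f c)^* * (f w - f c) + e%:C * c^* * (w - c).
    have ck : contat k c.
      apply: contatD; apply: contatM; try exact: contat_cst.
        by apply: contatB; [exact: cf|exact: contat_cst].
      by apply: contatB; [exact: contat_id|exact: contat_cst].
    have [w wr] : exists2 w, modulus (w - c) = r & complex.Re (k c) <= complex.Re (k w).
      apply: circle_Re_ge => // z /rhol hz.
      apply: holoD; apply: holoM; try exact: holo_cst.
        by apply: holoB => //; exact: holo_cst.
      by apply: holoB; [exact: holo_id|exact: holo_cst].
    rewrite {1}/k !subrr !mulr0 addr0 /= /k -mulrA ReD.
    have -> : complex.Re (e%:C * (c^* * (w - c))) = e * complex.Re (c^* * (w - c)).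
      by rewrite mulrC ReMr mulrC.
    move=> kw.
    have wK : K w by apply: rK; rewrite wr.
    have := cmax w wK; rewrite !vE.
    have -> : modulus (f w) ^+ 2 = modulus (f c) ^+ 2 + 2 * complex.Re ((f c)^* * (f w - f c))
       + modulus (f w - f c) ^+ 2 by rewrite -modulus_sqrD addrC subrK.
    have -> : modulus w ^+ 2 = modulus c ^+ 2 + 2 * complex.Re (c^* * (w - c)) + r ^+ 2.
      by rewrite -wr -modulus_sqrD addrC subrK.
    have : 0 < e * r ^+ 2 by rewrite mulr_gt0// exprn_gt0.
    have : 0 <= modulus (f w - f c) ^+ 2 by exact: sqr_ge0.
    move: kw.
    set A := complex.Re _; set C := complex.Re _; lra.
  have := cmax z1 Kz1; rewrite !vE.
  have := hB c Kc; have := modulus_ge0 c; rewrite -/(id c) => c0 cB.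
  have : e * modulus c ^+ 2 <= e * B ^+ 2.
    by rewrite ler_pM2l// ler_pXn2r// nnegrE ?modulus_ge0// ltW.
  have : 0 <= e * modulus z1 ^+ 2 by rewrite mulr_ge0 ?sqr_ge0// ltW.
  lra.
have [c [Kc Sc] _] := peak _ ltr01.
have M0 : 0 <= M by apply: le_trans (modulus_ge0 (f c)) (hM _ Kc Sc).
have D0 : 0 < modulus (f z1) ^+ 2 - M ^+ 2.
  by rewrite subr_gt0 ltr_pXn2r// nnegrE ?modulus_ge0.
have B2 : 0 < 2 * B ^+ 2 by rewrite mulr_gt0// exprn_gt0.
have [c' [Kc' Sc']] := peak _ (divr_gt0 D0 B2).
have : modulus (f c') ^+ 2 <= M ^+ 2.
  by rewrite ler_pXn2r// ?nnegrE ?modulus_ge0// hM.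
have -> : (modulus (f z1) ^+ 2 - M ^+ 2) / (2 * B ^+ 2) * B ^+ 2 =
  (modulus (f z1) ^+ 2 - M ^+ 2) / 2 by field; rewrite gt_eqF.
by lra.
Qed.

Lemma compact_box (B : R) : compact [set z : R[i] | `|complex.Re z| <= B /\ `|complex.Im z| <= B].
Proof.
have cm : continuous (fun p : R * R => p.1 +i* p.2 : R[i]).
  move=> [x y] A /nbhs_modulusP[e e0 hA].
  have e2 : 0 < e / 2 by rewrite divr_gt0.
  have : nbhs (x, y) (ball x (e / 2) `*` ball y (e / 2)).
    by exists (ball x (e / 2), ball y (e / 2)) => //; split; exact: nbhsx_ballx.
  apply: filterS => -[x' y'] [/= bx by_]; apply: hA.
  apply: le_lt_trans (modulus_le_ReIm _) _ => /=.
  move: bx by_; rewrite /ball /= !(distrC x) !(distrC y); lra.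
have -> : [set z : R[i] | `|complex.Re z| <= B /\ `|complex.Im z| <= B] =
   (fun p : R * R => p.1 +i* p.2 : R[i]) @` (`[- B, B] `*` `[- B, B]).
  apply/seteqP; split => [[x y] /= [hx hy]|_ [[x y] [/= hx hy] <-]] /=.
    by exists (x, y) => //; split; rewrite /= in_itv /= -ler_norml.
  by move: hx hy; rewrite !in_itv /= -!ler_norml.
apply: continuous_compact; first exact: continuous_subspaceT.
by apply: compact_setX; exact: segment_compact.
Qed.

Lemma closed_modulusP (A : set R[i]) : (forall z, ~ A z ->
  exists2 e, 0 < e & forall w, modulus (w - z) < e -> ~ A w) -> closed A.
Proof. by move=> h; rewrite -openC; apply/open_modulusP. Qed.

Lemma compact_ring (a : R[i]) r s : compact [set z | r <= modulus (z - a) <= s].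
Proof.
apply: (subclosed_compact _ (@compact_box (s + modulus a))).
  apply: closed_modulusP => z /= /negP; rewrite negb_and -!ltNge => /orP[h|h].
    exists (r - modulus (z - a)); first by rewrite subr_gt0.
    move=> w; have := modulusD (w - z) (z - a); rewrite addrA subrK => h1 h2 /andP[]; lra.
  exists (modulus (z - a) - s); first by rewrite subr_gt0.
  move=> w; have := modulusD (z - w) (w - a); rewrite addrA subrK (modulusB z).
  by move=> h1 h2 /andP[]; lra.
move=> z /= /andP[_ zs]; have := modulusD (z - a) a; rewrite subrK.
have := le_Re_modulus z; have := le_Im_modulus z; lra.
Qed.

Lemma compact_disc (a : R[i]) r : compact [set z | modulus (z - a) <= r].
Proof.
have -> : [set z | modulus (z - a) <= r] = [set z | 0 <= modulus (z - a) <= r].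
  by apply/seteqP; split => z /=; rewrite modulus_ge0.
exact: compact_ring.
Qed.

Lemma max_principle_ring f (a : R[i]) r s (M : R) :
  (forall z, r <= modulus (z - a) <= s -> contat f z) ->
  (forall z, r < modulus (z - a) < s -> exists2 d, 0 < d & forall w, 0 < modulus (w - z) < d -> holo f w) ->
  (forall z, modulus (z - a) = r \/ modulus (z - a) = s -> modulus (f z) <= M) ->
  forall z, r <= modulus (z - a) <= s -> modulus (f z) <= M.
Proof.
move=> cf hol hM.
have P := @max_principle _ [set z | modulus (z - a) = r \/ modulus (z - a) = s] f M (@compact_ring a r s).
apply: P => //.
  move=> z /= /andP[rz zs] /not_orP[/eqP nr /eqP ns].
  have {}rz : r < modulus (z - a) by rewrite lt_def nr.
  have {}zs : modulus (z - a) < s by rewrite lt_def eq_sym ns.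
  have [d d0 hd] := hol z (introT andP (conj rz zs)).
  pose m := Num.min (d / 2) (Num.min (modulus (z - a) - r) (s - modulus (z - a))).
  have m0 : 0 < m by rewrite !lt_min divr_gt0//= !subr_gt0 rz.
  have [m1 [m2 m3]] : m <= d / 2 /\ m <= modulus (z - a) - r /\ m <= s - modulus (z - a).
    by rewrite /m !ge_min !lexx !orbT.
  exists m => //; split => w.
    move=> wm; have := modulusD (w - z) (z - a); rewrite addrA subrK => h1.
    have := modulusD (z - w) (w - a); rewrite addrA subrK (modulusB z w) => h2.
    apply/andP; split; lra.
  by move=> /andP[w0 wm]; apply: hd; rewrite w0; lra.
by move=> z _ /hM.
Qed.

End MaximumPrinciple.

(** * Holomorphic functions on discs *)

Section DiscTheory.
Variable R : realType.
Implicit Types (f g L F : R[i] -> R[i]) (p z w c : R[i]) (e r s M B : R).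

Lemma max_principle_disc f p r M :
  (forall z, modulus (z - p) <= r -> contat f z) ->
  (forall z, modulus (z - p) < r -> exists2 d, 0 < d & forall w, 0 < modulus (w - z) < d -> holo f w) ->
  (forall z, modulus (z - p) = r -> modulus (f z) <= M) ->
  forall z, modulus (z - p) <= r -> modulus (f z) <= M.
Proof.
(* With inner radius -1 the ring is the whole disc and its inner circle is empty. *)
move=> cf hf hM z zr; apply: (@max_principle_ring _ f p (-1) r) => [w /andP[_]|w /andP[_]|w []|].
- exact: cf.
- exact: hf.
- by have := modulus_ge0 (w - p); lra.
- exact: hM.
by rewrite zr andbT; have := modulus_ge0 (z - p); lra.
Qed.

Lemma holo_divdiff f (p : R[i]) q : (forall w, f w = f p + q w * (w - p)) ->
  forall w, w != p -> holo f w -> holo q w.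
Proof.
move=> fE w wp hf; have wp0 : 0 < modulus (w - p) by rewrite modulus_gt0 subr_eq0.
apply: (holo_ext_near (f := fun z => (f z - f p) / (z - p)) wp0).
  move=> z zw; rewrite fE addrC addKr mulfK// subr_eq0.
  by apply: contraTneq zw => ->; rewrite modulusB ltxx.
apply: holoM; first by apply: holoB => //; exact: holo_cst.
apply: holoV; last by rewrite subr_eq0.
by apply: holoB; [exact: holo_id|exact: holo_cst].
Qed.

(** The maximum principle is applied to the divided difference of [f] at [p], for which continuity
    at [p] is enough. *)
Lemma schwarz f p r M : 0 < r -> (forall z, modulus (z - p) <= r -> holo f z) -> f p = 0 ->
  (forall z, modulus (z - p) <= r -> modulus (f z) <= M) ->
  forall z, modulus (z - p) <= r -> modulus (f z) <= M / r * modulus (z - p).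
Proof.
move=> r0 hf fp0 hM z zr.
have pp : modulus (p - p) <= r by rewrite subrr modulus0 ltW.
have [q cq fE] := hf p pp.
have hq w : w != p -> modulus (w - p) <= r -> holo q w.
  by move=> wp wr; apply: holo_divdiff fE _ wp (hf _ wr).
have qM w : modulus (w - p) <= r -> modulus (q w) <= M / r.
  apply: max_principle_disc => {}w.
  - have [->//|wp wr] := eqVneq w p; exact/holo_contat/hq.
  - have [->|wp] := eqVneq w p => wr.
      by exists r => // w' /andP[w0 /ltW wr']; apply: hq => //; rewrite -subr_eq0 -modulus_gt0.
    have m0 : 0 < modulus (w - p) by rewrite modulus_gt0 subr_eq0.
    exists (Num.min (modulus (w - p)) (r - modulus (w - p))).
      by rewrite lt_min m0 subr_gt0.
    move=> w' /andP[_]; rewrite lt_min => /andP[w1 w2]; apply: hq.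
      by apply: contraTneq w1 => ->; rewrite modulusB ltxx.
    by have := modulusD (w' - w) (w - p); rewrite addrA subrK; lra.
  - move=> wr; have := hM w (eq_ind_r (fun x => x <= r) (lexx r) wr).
    by rewrite fE fp0 add0r modulusM wr ler_pdivlMr.
by rewrite fE fp0 add0r modulusM ler_wpM2r ?modulus_ge0// qM.
Qed.

(** The Cayley transform (L - u0) / (L + u0) sends the right half-plane to the unit disc and [p] to
    0. By Schwarz's lemma it is at most 1 / 2 on the disc of half the radius; the constants 3, 1 / 3
    and 4 follow. *)
Lemma harnack_disc L p r (u0 : R) : 0 < r ->
  (forall z, modulus (z - p) <= r -> holo L z) ->
  (forall z, modulus (z - p) <= r -> 0 < complex.Re (L z)) -> L p = u0%:C ->
  forall z, modulus (z - p) <= r / 2 ->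
  [/\ modulus (L z) <= 3 * u0, u0 / 3 <= complex.Re (L z) &
      modulus (L z - u0%:C) <= 4 * u0 / r * modulus (z - p)].
Proof.
move=> r0 hL pL Lp z zr.
have pp : modulus (p - p) <= r by rewrite subrr modulus0 ltW.
have u00 : 0 < u0 by have := pL _ pp; rewrite Lp.
pose phi w := (L w - u0%:C) / (L w + u0%:C).
have den w : modulus (w - p) <= r -> L w + u0%:C != 0.
  move=> wr; apply/eqP => /(congr1 (@complex.Re R)); rewrite ReD /= => h.
  by have := pL w wr; lra.
have phi1 w : modulus (w - p) <= r -> modulus (phi w) <= 1.
  move=> wr; rewrite /phi modulusM modulusV ler_pdivrMr ?modulus_gt0 ?den// mul1r.
  rewrite -(@ler_pXn2r _ 2) ?nnegrE ?modulus_ge0// !modulus_sqr !ReD !ImD !ReN !ImN /=.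
  have := mulr_gt0 (pL w wr) u00; nra.
have hphi w : modulus (w - p) <= r -> holo phi w.
  move=> wr; apply: holoM; first by apply: holoB; [exact: hL|exact: holo_cst].
  by apply: holoV; [apply: holoD; [exact: hL|exact: holo_cst]|exact: den].
have zr' : modulus (z - p) <= r by lra.
have phip : phi p = 0 by rewrite /phi Lp subrr mul0r.
have := schwarz r0 hphi phip phi1 zr'.
rewrite /phi modulusM modulusV ler_pdivrMr ?modulus_gt0 ?den//.
set t := 1 / r * _ => h.
have t0 : 0 <= t by rewrite mulr_ge0 ?modulus_ge0// divr_ge0// ltW.
have t2 : t <= 1 / 2 by rewrite /t mulrC mulrA mulr1 ler_pdivrMr//; lra.
have mu : modulus (u0%:C : R[i]) = u0 by rewrite modulus_real gtr0_norm.
have h2 : modulus (L z - u0%:C) <= 1 / 2 * modulus (L z + u0%:C).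
  by apply: le_trans h _; rewrite ler_wpM2r ?modulus_ge0.
have a1 := modulusD (L z) u0%:C; have a2 := ler_modulusB (L z) u0%:C.
rewrite mu in a1 a2.
have b1 : modulus (L z) <= 3 * u0 by lra.
split => //.
  have := pL z zr'.
  have : modulus (L z - u0%:C) ^+ 2 <= (1 / 2 * modulus (L z + u0%:C)) ^+ 2.
    by rewrite ler_pXn2r ?nnegrE ?modulus_ge0// mulr_ge0 ?modulus_ge0.
  rewrite exprMn !modulus_sqr !ReD !ImD !ReN !ImN /=; move: u00.
  set x := complex.Re (L z); set y := complex.Im (L z); clear; nra.
apply: le_trans h _.
have -> : 4 * u0 / r * modulus (z - p) = t * (4 * u0) by rewrite /t; ring.
by rewrite ler_wpM2l//; lra.
Qed.

Lemma lipschitz_disc f p r B : 0 < r -> (forall z, modulus (z - p) <= r -> holo f z) ->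
  (forall z, modulus (z - p) <= r -> modulus (f z) <= B) ->
  forall z w, modulus (z - p) <= r / 2 -> modulus (w - p) <= r / 2 ->
    modulus (w - z) <= r / 2 ->
    modulus (f w - f z) <= 4 * B / r * modulus (w - z).
Proof.
move=> r0 hf hB z w zr wr wz.
have r2 : 0 < r / 2 by rewrite divr_gt0.
have inr x : modulus (x - z) <= r / 2 -> modulus (x - p) <= r.
  by have := modulusD (x - z) (z - p); rewrite addrA subrK; lra.
have -> : 4 * B / r = 2 * B / (r / 2) by field; rewrite gt_eqF.
apply: (@schwarz (fun x => f x - f z)) => //.
- by move=> x /inr xr; apply: holoB; [exact: hf|exact: holo_cst].
- exact: subrr.
move=> x /inr xr; apply: le_trans (modulusD _ _) _; rewrite modulusN.
have zr' : modulus (z - p) <= r by lra.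
have := hB _ xr; have := hB _ zr'; lra.
Qed.

(** F z / F p is a telescoping product of ratios at successive points of the segment from [p] to
    [z]. With N steps each ratio lies within distance 1 of 1, hence in the domain of [clog], and the
    logarithms are added up. *)
Lemma holo_log F p r l : 0 < r ->
  (forall z, modulus (z - p) <= r -> holo F z) ->
  (forall z, modulus (z - p) <= r -> F z != 0) -> cexp l = F p ->
  exists L, L p = l /\ forall z, modulus (z - p) <= r / 2 -> holo L z /\ cexp (L z) = F z.
Proof.
move=> r0 hF F0 lF.
have [B B0 hB] := compact_bound (@compact_disc R p r) (fun z zr => holo_contat (hF z zr)).
have [B' B'0 hB'] := compact_bound (@compact_disc R p r)
  (fun z zr => contatV (holo_contat (hF z zr)) (F0 z zr)).
pose N := (Num.bound (2 * B * B')).+1.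
have N0 : 0 < N%:R :> R by rewrite ltr0n.
have NB : 2 * B * B' < N%:R.
  have := archi_boundP (ltW (mulr_gt0 (mulr_gt0 (ltr0n R 2) B0) B'0)).
  by move=> h; apply: lt_trans h _; rewrite ltr_nat.
pose pt (k : nat) z := p + (k%:R / N%:R)%:C * (z - p).
have ptp k : pt k p = p by rewrite /pt subrr mulr0 addr0.
have ptr k z : (k <= N)%N -> modulus (z - p) <= r / 2 -> modulus (pt k z - p) <= r / 2.
  move=> kN zr; rewrite /pt addrAC subrr add0r modulusM modulus_real.
  rewrite ger0_norm ?divr_ge0//; apply: le_trans _ zr.
  by rewrite ler_piMl ?modulus_ge0// ler_pdivrMr// mul1r ler_nat.
have r2r x : modulus (x - p) <= r / 2 -> modulus (x - p) <= r by lra.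
have ratio k z : (k < N)%N -> modulus (z - p) <= r / 2 ->
   modulus (F (pt k.+1 z) / F (pt k z) - 1) < 1.
  move=> kN zr; have z1 := ptr _ _ kN zr; have z2 := ptr _ _ (ltnW kN) zr.
  have Fz2 := F0 _ (r2r _ z2).
  have -> : F (pt k.+1 z) / F (pt k z) - 1 = (F (pt k.+1 z) - F (pt k z)) / F (pt k z) by field.
  have dE : pt k.+1 z - pt k z = (N%:R^-1)%:C * (z - p).
    by rewrite /pt -natr1 mulrDl mul1r rmorphD/=; ring.
  have dm : modulus (pt k.+1 z - pt k z) <= (r / 2) / N%:R.
    rewrite dE modulusM modulus_real ger0_norm ?invr_ge0 ?(ltW N0)// mulrC.
    by rewrite ler_wpM2r ?invr_ge0 ?(ltW N0).
  have dr : modulus (pt k.+1 z - pt k z) <= r / 2.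
    by apply: le_trans dm _; rewrite ler_pdivrMr// ler_peMr ?ler1n// divr_ge0// ltW.
  have lip := lipschitz_disc r0 hF hB z2 z1 dr.
  rewrite modulusM.
  have l1 : modulus (F (pt k.+1 z) - F (pt k z)) <= 2 * B / N%:R.
    apply: le_trans lip _.
    have -> : 2 * B / N%:R = 4 * B / r * ((r / 2) / N%:R) by field; rewrite !gt_eqF.
    by rewrite ler_wpM2l// divr_ge0 ?mulr_ge0// ltW.
  have l2 : modulus (F (pt k z))^-1 <= B' by apply: hB' => /=; exact: r2r.
  apply: (@le_lt_trans _ _ (2 * B / N%:R * B')).
    by apply: ler_pM; rewrite ?modulus_ge0.
  by rewrite mulrAC ltr_pdivrMr// mul1r.
have ratioRe k z : (k < N)%N -> modulus (z - p) <= r / 2 ->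
   0 < complex.Re (F (pt k.+1 z) / F (pt k z)).
  move=> kN zr; have := ratio k z kN zr.
  move=> /(le_lt_trans (le_Re_modulus _)); rewrite ReD ReN /= ltr_norml; lra.
have hpt k z : holo (pt k) z.
  apply: holoD; first exact: holo_cst.
  by apply: holoM; [exact: holo_cst|apply: holoB; [exact: holo_id|exact: holo_cst]].
have ind n : (n <= N)%N -> exists L, L p = l /\ forall z, modulus (z - p) <= r / 2 ->
    holo L z /\ cexp (L z) = F (pt n z).
  elim: n => [|n ih] nN.
    exists (fun=> l); split => // z zr; split; first exact: holo_cst.
    by rewrite /pt mul0r mul0r addr0.
  have [L [Lp hL]] := ih (ltnW nN).
  exists (fun z => L z + clog (F (pt n.+1 z) / F (pt n z))); split.
    have Fp : F p != 0 by apply: F0; rewrite subrr modulus0 ltW.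
    by rewrite !ptp divff// clog1 addr0.
  move=> z zr; have [hLz eLz] := hL z zr.
  have Fn : F (pt n z) != 0 by apply: F0; apply: r2r; apply: ptr => //; exact: ltnW.
  split.
    apply: holoD => //; apply: holo_comp; last by apply: holo_clog; exact: ratioRe.
    apply: holoM; first by apply: holo_comp => //; apply: hF; apply: r2r; exact: ptr.
    apply: holoV => //.
    by apply: holo_comp => //; apply: hF; apply: r2r; apply: ptr => //; exact: ltnW.
  by rewrite cexpD eLz clogK ?ratioRe// mulrC divfK.
have [L [Lp hL]] := ind N (leqnn _).
exists L; split => // z zr; have [hLz ->] := hL z zr; split => //.
by rewrite /pt divff ?gt_eqF// mul1r addrC subrK.
Qed.

(** A quantitative open mapping theorem: if [g] omits [c] while g(p) is close to [c], then [g] stays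
    close to [c]. Scaled to have modulus below 1, g - c has a logarithm with negative real part, and
    Harnack's factor 3 becomes the exponent 3. *)
Lemma omitted_value g p r c B : 0 < r -> 0 < B ->
  (forall z, modulus (z - p) <= r -> holo g z) ->
  (forall z, modulus (z - p) <= r -> g z != c) ->
  (forall z, modulus (z - p) <= r -> modulus (g z - c) <= B) ->
  forall z, modulus (z - p) <= r / 4 ->
    modulus (g z - c) ^+ 3 <= 4 * B ^+ 2 * modulus (g p - c).
Proof.
move=> r0 B0 hg gc gB z zr.
have pp : modulus (p - p) <= r by rewrite subrr modulus0 ltW.
have gp0 : g p - c != 0 by rewrite subr_eq0 gc.
have mp0 : 0 < modulus (g p - c) by rewrite modulus_gt0.
(* The unimodular factor makes G(p) positive, so that its logarithm is real as [harnack_disc]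
   requires. *)
pose k : R[i] := ((2 * B)^-1)%:C * ((modulus (g p - c))%:C / (g p - c)).
have mk : modulus k = (2 * B)^-1.
  rewrite /k !modulusM modulusV !modulus_real ger0_norm; last by rewrite invr_ge0 mulr_ge0// ltW.
  by rewrite ger0_norm ?modulus_ge0// divff ?mulr1// gt_eqF.
pose G w := k * (g w - c).
have mG w : modulus (G w) = modulus (g w - c) / (2 * B) by rewrite /G modulusM mk mulrC.
have B20 : 0 < 2 * B by rewrite mulr_gt0.
have hG w : modulus (w - p) <= r -> holo G w.
  move=> wr; apply: holoM; first exact: holo_cst.
  by apply: holoB; [exact: hg|exact: holo_cst].
have G0 w : modulus (w - p) <= r -> G w != 0.
  by move=> wr; rewrite -modulus_gt0 mG divr_gt0// modulus_gt0 subr_eq0 gc.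
have G1 w : modulus (w - p) <= r -> modulus (G w) < 1.
  move=> wr; rewrite mG ltr_pdivrMr// mul1r; have := gB w wr; lra.
have Gp : cexp (ln (modulus (G p)))%:C = G p.
  rewrite /cexp /= cos0 sin0 mulr0 mulr1 lnK ?posrE ?modulus_gt0 ?G0// mG.
  rewrite /G /k -mulrA divfK//; apply/eqP; rewrite eq_complex /=; apply/andP; split; apply/eqP; ring.
have [L [Lp hL]] := holo_log r0 hG G0 Gp.
have ReL w : modulus (w - p) <= r / 2 -> complex.Re (L w) = ln (modulus (G w)).
  by move=> /hL[_ <-]; rewrite modulus_cexp expRK.
have r2 : 0 < r / 2 by rewrite divr_gt0.
have r2r w : modulus (w - p) <= r / 2 -> modulus (w - p) <= r by lra.
have zr2 : modulus (z - p) <= r / 2 / 2 by lra.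
have zr1 : modulus (z - p) <= r / 2 by lra.
have A1 w : modulus (w - p) <= r / 2 -> holo (fun w => - L w) w.
  by move=> /hL[hLw _]; exact: holoN.
have A2 w : modulus (w - p) <= r / 2 -> 0 < complex.Re (- L w).
  move=> wr; rewrite ReN ReL// oppr_gt0; apply: ln_lt0.
  by rewrite modulus_gt0 G0 ?r2r// G1// r2r.
have A3 : - L p = (- ln (modulus (G p)))%:C by rewrite Lp rmorphN.
have [_ + _] := harnack_disc r2 A1 A2 A3 zr2.
rewrite ReN ReL// => h.
have {}h : 3 * ln (modulus (G z)) <= ln (modulus (G p)) by lra.
have Gz0 : 0 < modulus (G z) by rewrite modulus_gt0 G0// r2r.
have Gp0 : 0 < modulus (G p) by rewrite modulus_gt0 G0.
have : modulus (G z) ^+ 3 <= modulus (G p).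
  rewrite -ler_ln ?posrE ?exprn_gt0// lnXn//; apply: le_trans _ h.
  by rewrite mulr_natl.
rewrite !mG exprMn exprVn -/(_ / _) ler_pdivrMr ?exprn_gt0//.
move=> h'; apply: le_trans h' _; rewrite le_eqVlt; apply/orP; left; apply/eqP.
by field; rewrite gt_eqF.
Qed.

(** The maximum principle on the ring s <= |z - p| <= r for g(z) / (z - p) ^ k. The integer k makes
    B / r ^ k at most e (2 / r) ^ k, and d is chosen to give the same bound on the inner circle; at
    |z - p| <= r / 2 the power of 2 is lost again. *)
Lemma two_constants s r B e : 0 < s -> s <= r / 2 -> 0 < B -> 0 < e ->
  exists2 d, 0 < d & forall g p,
    (forall z, modulus (z - p) <= r -> holo g z) ->
    (forall z, modulus (z - p) <= r -> modulus (g z) <= B) ->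
    (forall z, modulus (z - p) <= s -> modulus (g z) <= d) ->
    forall z, modulus (z - p) <= r / 2 -> modulus (g z) <= e.
Proof.
move=> s0 sr B0 e0.
have r0 : 0 < r by lra.
have [k hk] : exists k, B / 2 ^+ k <= e.
  exists (Num.bound (B / e)); rewrite ler_pdivrMr ?exprn_gt0//.
  have := archi_boundP (ltW (divr_gt0 B0 e0)); rewrite ltr_pdivrMr// mulrC => h.
  by apply/ltW/(lt_trans h); rewrite ltr_pM2l// -natrX ltr_nat ltn_expl.
exists (e * (2 * s / r) ^+ k); first by rewrite mulr_gt0// exprn_gt0// divr_gt0// mulr_gt0.
move=> g p hg gB gd z zr.
have sr1 : 2 * s / r <= 1 by rewrite ler_pdivrMr// mul1r; lra.
have sr0 : 0 <= 2 * s / r by rewrite divr_ge0// ?mulr_ge0// ltW.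
have [zs|sz] := leP (modulus (z - p)) s.
  apply: le_trans (gd _ zs) _; rewrite ger_pMr//; exact: exprn_ile1.
pose M := e * (2 / r) ^+ k.
have zpr : s <= modulus (z - p) <= r by rewrite ltW//=; lra.
pose f w := g w / (w - p) ^+ k.
have nz w : s <= modulus (w - p) -> (w - p) ^+ k != 0.
  by move=> h; rewrite expf_neq0// -modulus_gt0; apply: lt_le_trans h.
have hf w : s <= modulus (w - p) <= r -> holo f w.
  move=> /andP[h1 h2]; apply: holoM; first exact: hg.
  apply: holoV; last exact: nz.
  by apply: holoX; apply: holoB; [exact: holo_id|exact: holo_cst].
have p0 w : s <= modulus (w - p) -> 0 < modulus (w - p) ^+ k.
  by move=> h; rewrite exprn_gt0//; apply: lt_le_trans h.
have mf w : modulus (f w) = modulus (g w) / modulus (w - p) ^+ k.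
  by rewrite /f modulusM modulusV modulusX.
have fM : modulus (f z) <= M.
  apply: (max_principle_ring _ _ _ zpr).
  - by move=> w /hf/holo_contat.
  - move=> w /andP[h1 h2]; exists (Num.min (modulus (w - p) - s) (r - modulus (w - p))).
      by rewrite lt_min !subr_gt0 h1.
    move=> w' /andP[_]; rewrite lt_min => /andP[w1 w2]; apply: hf.
    have := modulusD (w' - w) (w - p); have := modulusD (w - w') (w' - p).
    by rewrite (modulusB w) !addrA !subrK => k1 k2; apply/andP; split; lra.
  - move=> w [] wE; rewrite mf ler_pdivrMr ?p0 ?wE//; last lra.
      apply: le_trans (gd w _) _; first by rewrite wE.
      have -> : 2 * s / r = 2 / r * s by ring.
      by rewrite exprMn mulrA.
    apply: le_trans (gB w _) _; first by rewrite wE.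
    rewrite /M -[leRHS]mulrA -exprMn divfK ?gt_eqF//.
    by move: hk; rewrite ler_pdivrMr ?exprn_gt0.
move: fM; rewrite mf ler_pdivrMr ?(p0 _ (ltW sz))// => h; apply: le_trans h _.
rewrite /M -[leLHS]mulrA -exprMn ger_pMr//; apply: exprn_ile1.
  by rewrite mulr_ge0 ?modulus_ge0// divr_ge0// ltW.
by rewrite mulrAC ler_pdivrMr// mul1r; lra.
Qed.

(** On discs large enough to contain a given [z], [two_constants] holds with arbitrarily small [d],
    and f - c vanishes on the small disc. *)
Lemma entire_locally_constant f p s c : (forall z, holo f z) -> 0 < s ->
  (forall z, modulus (z - p) <= s -> f z = c) -> forall z, f z = c.
Proof.
move=> hf s0 fc z; apply/eqP; rewrite -subr_eq0 -modulus_eq0; apply/eqP/le_anti.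
rewrite modulus_ge0 andbT; apply/ler_addgt0Pr => e e0; rewrite add0r.
pose r := 2 * (s + modulus (z - p)).
have sr : s <= r / 2 by rewrite /r; have := modulus_ge0 (z - p); lra.
have hfc w : holo (fun w => f w - c) w by apply: holoB; [exact: hf|exact: holo_cst].
have [B B0 hB] := compact_bound (@compact_disc R p r) (fun w _ => holo_contat (hfc w)).
have [d d0 h] := two_constants s0 sr B0 e0.
apply: (h (fun w => f w - c) p) => // [w ws|].
  by rewrite fc// subrr modulus0 ltW.
by rewrite /r; lra.
Qed.

(** Some z near p has f(z) different from f(p). A value c omitted too close to f(p) would by
    [omitted_value] force f(z) towards c. *)
Lemma open_mapping f p r : (forall z, holo f z) -> ~ (exists c, forall z, f z = c) -> 0 < r ->
  exists2 d, 0 < d & forall c, modulus (c - f p) < d -> exists2 z, modulus (z - p) < r & f z = c.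
Proof.
move=> hf nf r0; apply: contrapT => nd; apply: nf; exists (f p).
have r20 : 0 < r / 2 by rewrite divr_gt0.
have r80 : 0 < r / 2 / 4 by rewrite !divr_gt0.
apply: (entire_locally_constant hf r80) => z zr; apply/eqP; rewrite -subr_eq0.
apply/negPn/negP; rewrite -modulus_gt0 => m0; apply: nd.
set m := modulus (f z - f p) in m0 *.
have [B' B'0 hB'] := compact_bound (@compact_disc R p (r / 2)) (fun w _ => holo_contat (hf w)).
pose B := B' + modulus (f p) + 1.
have B0 : 0 < B by rewrite /B; have := modulus_ge0 (f p); lra.
have q0 : 0 < (m / 2) ^+ 3 / (4 * B ^+ 2) / 2.
  by rewrite !divr_gt0// ?exprn_gt0 ?divr_gt0// mulr_gt0// exprn_gt0.
exists (Num.min 1 (Num.min (m / 2) ((m / 2) ^+ 3 / (4 * B ^+ 2) / 2))).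
  by rewrite !lt_min ltr01 q0 divr_gt0.
move=> c; rewrite !lt_min => /and3P[c1 c2 c3]; apply: contrapT => omit.
have gc w : modulus (w - p) <= r / 2 -> f w != c.
  move=> wr; apply/eqP => fwc; apply: omit; exists w => //; lra.
have gB w : modulus (w - p) <= r / 2 -> modulus (f w - c) <= B.
  move=> wr; apply: le_trans (modulusD _ _) _; rewrite modulusN /B.
  have := hB' w wr; have := ler_modulusB c (f p); lra.
have := omitted_value r20 B0 (fun w _ => hf w) gc gB zr.
have k1 : m / 2 <= modulus (f z - c).
  have := modulusD (f z - c) (c - f p); rewrite addrA subrK -/m; lra.
have k2 : (m / 2) ^+ 3 <= modulus (f z - c) ^+ 3.
  by rewrite ler_pXn2r// nnegrE ?modulus_ge0// divr_ge0// ltW.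
have B2 : 0 < 4 * B ^+ 2 by rewrite mulr_gt0// exprn_gt0.
move: c3; rewrite modulusB -(ltr_pM2l B2) => c3 k3.
have := le_lt_trans (le_trans k2 k3) c3.
have -> : 4 * B ^+ 2 * ((m / 2) ^+ 3 / (4 * B ^+ 2) / 2) = (m / 2) ^+ 3 / 2.
  by field; rewrite gt_eqF.
have : 0 < (m / 2) ^+ 3 by rewrite exprn_gt0// divr_gt0.
by set X := (m / 2) ^+ 3; lra.
Qed.

(* A weak form of Hadamard's three circles theorem: an integral exponent p keeps
   f z / z ^ p single-valued. *)
Lemma three_circles (f : R[i] -> R[i]) (r1 r2 r3 M1 M3 : R) (p : nat) w :
  (forall z, holo f z) -> 0 < r1 -> r1 < r2 -> r2 < r3 ->
  (forall z, modulus z = r1 -> modulus (f z) <= M1) ->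
  (forall z, modulus z = r3 -> modulus (f z) <= M3) ->
  modulus w = r2 ->
  modulus (f w) / r2 ^+ p <= M1 / r1 ^+ p \/ modulus (f w) / r2 ^+ p <= M3 / r3 ^+ p.
Proof.
move=> hf r10 r12 r23 h1 h3 wr.
pose g z := f z / z ^+ p.
have nz z : r1 <= modulus z -> z ^+ p != 0.
  by move=> h; rewrite expf_neq0// -modulus_gt0; apply: lt_le_trans h.
have hg z : r1 <= modulus z -> holo g z.
  by move=> h; apply: holoM => //; apply: holoV; [apply: holoX; exact: holo_id|exact: nz].
have mg z : modulus (g z) = modulus (f z) / modulus z ^+ p.
  by rewrite /g modulusM modulusV modulusX.
have : modulus (g w) <= Num.max (M1 / r1 ^+ p) (M3 / r3 ^+ p).
  apply: (@max_principle_ring _ g 0 r1 r3); last by rewrite subr0 wr !ltW.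
  - by move=> z /andP[+ _]; rewrite subr0 => /hg /holo_contat.
  - move=> z; rewrite subr0 => /andP[z1 z3]; exists (modulus z - r1); first by rewrite subr_gt0.
    move=> z' /andP[_ h]; apply: hg; have := ler_modulusB z z'; rewrite modulusB; lra.
  - move=> z; rewrite subr0 mg => -[] zr; rewrite zr le_max; apply/orP; [left|right].
      by rewrite ler_wpM2r ?h1// invr_ge0 exprn_ge0// ltW.
    by rewrite ler_wpM2r ?h3// invr_ge0 exprn_ge0//; lra.
by rewrite mg wr le_max => /orP[]; [left|right].
Qed.

Lemma nat_between (t : R) : 1 <= t -> exists p : nat, t <= p%:R < 2 * t.
Proof.
move=> t1.
have ex : exists n : nat, t <= n%:R.
  by exists (Num.bound t); apply/ltW/archi_boundP; apply: le_trans t1.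
case: (ex_minnP ex) => p tp pmin; exists p; rewrite tp/=.
case: p tp pmin => [|p] tp pmin; first by move: tp; rewrite mulr0n; lra.
have : p%:R < t by rewrite ltNge; apply/negP => /pmin; rewrite ltnn.
by rewrite -natr1; lra.
Qed.

End DiscTheory.

(** * Montel's theorem for bounded families *)

Section NormalFamilies.
Variable R : realType.
Implicit Types (f g : R[i] -> R[i]) (s : nat -> R[i] -> R[i]) (p z w c : R[i]) (e r B : R).

Lemma uniform_modulusP (W : set R[i]) s g :
  {uniform W, s @ \oo --> g} <->
  forall e, 0 < e -> exists N, forall n, (N <= n)%N -> forall w, W w -> modulus (s n w - g w) < e.
Proof.
split=> [h e e0|h].
  have /h[N _ hN] : nbhs (g : {uniform` W -> R[i]})
      [set k | forall w, W w -> modulus (k w - g w) < e].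
    apply/uniform_nbhs; exists [set xy | modulus (xy.2 - xy.1) < e]; split => //.
    rewrite -entourage_ballE; exists e%:C => /=; first by rewrite ltcR.
    by case=> x y; rewrite /ball /= normE ltcR modulusB.
  by exists N => n Nn; exact: hN.
move=> P /uniform_nbhs[E [+ EP]]; rewrite -entourage_ballE => -[e /= e0 eE].
have ee : e = (complex.Re e)%:C by rewrite RRe_real// realE ltW.
have e0' : 0 < complex.Re e by move: e0; rewrite ee ltcR.
have [N hN] := h _ e0'.
exists N => // n Nn; apply: EP => w Ww; apply: eE.
by rewrite /ball /= normE ee ltcR modulusB; exact: hN.
Qed.

Lemma increasing_selection (P : nat -> nat -> Prop) :
  (forall j N, exists2 k, (N <= k)%N & P j k) ->
  exists phi : nat -> nat, {homo phi : j k / (j < k)%N} /\ forall j, P j (phi j).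
Proof.
move=> h; have /choice[t ht] : forall jN : nat * nat, exists k, (jN.2 <= k)%N /\ P jN.1 k.
  by move=> [j N]; have [k k1 k2] := h j N; exists k.
pose fix phi j := if j is j'.+1 then t (j, (phi j').+1) else t (0%N, 0%N).
exists phi; split.
  by apply: homo_ltn => [k l m|j]; [exact: ltn_trans|exact: (ht (j.+1, _)).1].
by case=> [|j]; [exact: (ht (0%N, 0%N)).2|exact: (ht (j.+1, _)).2].
Qed.

(* Pointwise limits along a free ultrafilter, upgraded by equicontinuity. *)
Lemma montel_bounded r B s : 0 < r ->
  (forall k z, modulus z < r -> holo (s k) z) ->
  (forall k z, modulus z < r -> modulus (s k z) <= B) ->
  exists phi : nat -> nat, {homo phi : j k / (j < k)%N} /\
    exists g, locally_uniformly_cvg [set z | modulus z < r] (s \o phi) g.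
Proof.
move=> r0 hs sB.
have [G [UG ooG]] := ultraFilterLemma (eventually_filter).
have limex (t : nat -> R[i]) A : compact A -> (forall k, A (t k)) ->
    exists2 l, A l & forall e, 0 < e -> G [set k | modulus (t k - l) < e].
  move=> cA At.
  have GA : G (t @^-1` A) by apply: filterS filterT => k _; exact: At.
  have [l [Al cl]] := cA (t @ G) _ GA.
  exists l => // e e0.
  have [//|GC] := in_ultra_setVsetC [set k | modulus (t k - l) < e] UG.
  have lV : nbhs l [set w | modulus (w - l) < e] by apply/nbhs_modulusP; exists e.
  by have [w [/= nw /nw]] := cl [set w | ~ modulus (w - l) < e] _ GC lV.
have /choice[g hg] : forall z, exists l, modulus z < r ->
    forall e, 0 < e -> G [set k | modulus (s k z - l) < e].
  move=> z; have [zr|nzr] := pselect (modulus z < r); last by exists 0.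
  have [|l _ hl] := limex (fun k => s k z) _ (@compact_disc R 0 B).
    by move=> k /=; rewrite subr0; exact: sB.
  by exists l.
have B0 : 0 <= B by apply: le_trans (modulus_ge0 _) (sB 0%N 0 _); rewrite modulus0.
have equi r' z : r' < r -> modulus z <= r' -> forall k w, modulus (w - z) <= (r - r') / 2 ->
    modulus (s k w - s k z) <= 2 * B / ((r - r') / 2) * modulus (w - z).
  move=> r'r zr' k w wz.
  have d0 : 0 < (r - r') / 2 by rewrite divr_gt0// subr_gt0.
  have inD x : modulus (x - z) <= (r - r') / 2 -> modulus x < r.
    by have := modulusD (x - z) z; rewrite subrK; lra.
  apply: (@schwarz _ (fun x => s k x - s k z)) => // [x xz||x xz].
  - by apply: holoB; [exact/hs/inD|exact: holo_cst].
  - exact: subrr.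
  - apply: le_trans (modulusD _ _) _; rewrite modulusN.
    have := sB k x (inD _ xz); have : modulus z < r by lra.
    by move=> /(sB k); lra.
have key r' e N : r' < r -> 0 < e -> exists2 k, (N <= k)%N &
    forall z, modulus z <= r' -> modulus (s k z - g z) <= e.
  move=> r'r e0; pose A := [set k | forall z, modulus z <= r' -> modulus (s k z - g z) <= e].
  have [GA|GnA] := in_ultra_setVsetC A UG.
    have : G ([set k | (N <= k)%N] `&` A).
      by apply: filterI => //; apply: ooG; exists N.
    by move=> /filter_ex [k [/= Nk Ak]]; exists k.
  exfalso.
  have [|r'0] := ltP r' 0.
    move=> r'0; have /filter_ex[k nAk] := GnA; apply: nAk => z.
    by have := modulus_ge0 z; lra.
  (* If uniform closeness failed for almost every index along the ultrafilter, the witnessing points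
     would converge along it to some [l]; equicontinuity moves the estimate from [l] back to the
     witnesses. *)
  have /choice[t ht] : forall k, exists z, modulus z <= r' /\
      (~ A k -> ~ (modulus (s k z - g z) <= e)).
    move=> k; have [Ak|nAk] := pselect (A k); first by exists 0; rewrite modulus0.
    by move: (nAk) => /existsNP[z /not_implyP[z1 z2]]; exists z.
  have [|l lr' tl] := limex t _ (@compact_disc R 0 r').
    by move=> k /=; rewrite subr0; case: (ht k).
  rewrite /= subr0 in lr'.
  have lr : modulus l < r by exact: le_lt_trans r'r.
  pose d := (r - r') / 2; have d0 : 0 < d by rewrite /d divr_gt0// subr_gt0.
  pose K := 2 * B / d + 1.
  have K0 : 0 < K by apply: ltr_wpDl => //; apply: divr_ge0; [apply: mulr_ge0|exact: ltW].
  have e4 : 0 < e / 8 by rewrite divr_gt0.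
  have q0 : 0 < Num.min d (e / 8 / K) by rewrite lt_min d0 divr_gt0.
  have G1 := tl _ q0; have G2 := hg l lr _ e4.
  have /filter_ex [k0 [[nA0 /= B1] B2]] :
     G (~` A `&` [set k | modulus (t k - l) < Num.min d (e / 8 / K)] `&`
        [set k | modulus (s k l - g l) < e / 8]).
    by apply: filterI => //; apply: filterI.
  have [tr' nt] := ht k0; have {}nt := nt nA0; apply: nt.
  move: B1; rewrite lt_min => /andP[td te].
  have tr : modulus (t k0) < r by exact: le_lt_trans r'r.
  have e1 : modulus (s k0 (t k0) - s k0 l) <= e / 8.
    apply: le_trans (equi _ _ r'r lr' k0 (t k0) (ltW td)) _.
    apply: (@le_trans _ _ (K * modulus (t k0 - l))).
      by rewrite ler_wpM2r ?modulus_ge0// -/d /K lerDl.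
    by apply/ltW; rewrite mulrC -ltr_pdivlMr.
  (* g inherits the Lipschitz bound by approximating both values along G *)
  have /filter_ex[k1 [/= C1 C2]] : G ([set k | modulus (s k (t k0) - g (t k0)) < e / 8] `&`
      [set k | modulus (s k l - g l) < e / 8]) by apply: filterI => //; exact: hg.
  have e2 : modulus (s k1 (t k0) - s k1 l) <= e / 8.
    apply: le_trans (equi _ _ r'r lr' k1 (t k0) (ltW td)) _.
    apply: (@le_trans _ _ (K * modulus (t k0 - l))).
      by rewrite ler_wpM2r ?modulus_ge0// -/d /K lerDl.
    by apply/ltW; rewrite mulrC -ltr_pdivlMr.
  have -> : s k0 (t k0) - g (t k0) = (s k0 (t k0) - s k0 l) + ((s k0 l - g l) +
     ((g l - s k1 l) + ((s k1 l - s k1 (t k0)) + (s k1 (t k0) - g (t k0))))) by ring.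
  do 4! [apply: le_trans (modulusD _ _) _; rewrite -lerBrDl].
  move: B2 e1 e2 C1 C2; rewrite [modulus (g l - _)]modulusB [modulus (s k1 l - s k1 _)]modulusB /=; lra.
have keyj j N : exists2 k, (N <= k)%N & forall z,
    modulus z <= r - r / j.+1%:R -> modulus (s k z - g z) <= j.+1%:R^-1.
  by apply: key => //; rewrite ltrBlDr ltrDl divr_gt0.
have [phi [phi_inc hphi]] := increasing_selection keyj.
exists phi; split => //; exists g => z /= zr.
exists [set w | modulus (w - z) < (r - modulus z) / 2].
  by apply/nbhs_modulusP; exists ((r - modulus z) / 2) => //; rewrite divr_gt0// subr_gt0.
apply/uniform_modulusP => e e0.
pose d := (r - modulus z) / 2; have d0 : 0 < d by rewrite divr_gt0// subr_gt0.
have [N1 hN1] : exists N : nat, r / d < N%:R by exists (Num.bound (r / d)); exact/archi_boundP/ltW/divr_gt0.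
have [N2 hN2] : exists N : nat, e^-1 < N%:R.
  by exists (Num.bound e^-1); apply/archi_boundP/ltW; rewrite invr_gt0.
exists (maxn N1 N2) => n; rewrite geq_max => /andP[n1 n2] w /= wz.
have M1 : r / d < n.+1%:R by apply: lt_le_trans hN1 _; rewrite ler_nat ltnW.
have M2 : e^-1 < n.+1%:R by apply: lt_le_trans hN2 _; rewrite ler_nat ltnW.
apply: (@le_lt_trans _ _ n.+1%:R^-1); last by rewrite -[e]invrK ltf_pV2 ?posrE ?invr_gt0.
apply: hphi; have : r / n.+1%:R < d by rewrite ltr_pdivrMr// mulrC -ltr_pdivrMr.
have := modulusD (w - z) z; rewrite subrK; move: wz; rewrite /d; set X := r / _ => h1 h2 h3; set a1 := modulus w in h2 *; set a2 := modulus (w - z) in h1 h2; set a3 := modulus z in h1 h2 h3; lra.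
Qed.

End NormalFamilies.

(** * Growth of entire functions, invariance of the Fatou set *)

Section EntireGrowth.
Variable R : realType.
Implicit Types (f g : R[i] -> R[i]) (p z w c : R[i]) (e r B : R).

Lemma punctured_avoid (s : seq R[i]) z : exists2 d : R, 0 < d &
  forall w, 0 < modulus (w - z) < d -> w \notin s.
Proof.
elim: s => [|x s [d d0 h]]; first by exists 1.
have [->|xz] := eqVneq x z.
  exists d => // w wd; rewrite inE negb_or h// andbT -subr_eq0 -modulus_gt0.
  by case/andP: wd.
have m0 : 0 < modulus (x - z) by rewrite modulus_gt0 subr_eq0.
exists (Num.min d (modulus (x - z))); first by rewrite lt_min d0.
move=> w /andP[w0]; rewrite lt_min => /andP[w1 w2]; rewrite inE negb_or h ?w0// andbT.
by apply: contraTneq w2 => ->; rewrite ltxx.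
Qed.

Lemma fresh_point (s : seq R[i]) : exists x, x \notin s.
Proof.
have [d d0 h] := punctured_avoid s 0; exists (d / 2)%:C; apply: h.
by rewrite subr0 modulus_real gtr0_norm ?divr_gt0//=; lra.
Qed.

(** Liouville's theorem in the form that starts the induction on the degree: the maximum principle
    on discs bounded by the given circles. The finite set [s] collects the interpolation nodes. *)
Lemma vanish_of_small_circles f (s : seq R[i]) B :
  (forall z, contat f z) -> (forall z, z \notin s -> holo f z) ->
  (forall r0, exists2 r, r0 < r & forall z, modulus z = r -> modulus (f z) <= B / r) ->
  forall z, f z = 0.
Proof.
move=> cf hf small z; apply/eqP; rewrite -modulus_eq0; apply/eqP/le_anti.
rewrite modulus_ge0 andbT; apply/ler_addgt0Pr => e e0; rewrite add0r.
have [r rbig hr] := small (`|B| / e + modulus z).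
have Be0 : 0 <= `|B| / e by rewrite divr_ge0// ltW.
have r0 : 0 < r by apply: le_lt_trans rbig; rewrite addr_ge0 ?modulus_ge0.
apply: (@le_trans _ _ (B / r)).
  apply: (@max_principle_disc _ f 0 r) => [w _|w _|w|]; last 1 first.
  - by rewrite subr0; have := modulus_ge0 z; lra.
  - exact: cf.
  - have [d d0 hd] := punctured_avoid s w.
    by exists d => // w' /hd /hf.
  - by rewrite subr0; exact: hr.
rewrite ler_pdivrMr//; apply: le_trans (ler_norm B) _.
rewrite -ler_pdivrMl// mulrC; have := modulus_ge0 z; lra.
Qed.

Lemma contat_divdiff f x q : (forall z, contat f z) -> contat q x ->
  (forall w, f w = f x + q w * (w - x)) -> forall z, contat q z.
Proof.
move=> cf cq fE z; have [->//|zx] := eqVneq z x.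
have zx0 : 0 < modulus (z - x) by rewrite modulus_gt0 subr_eq0.
apply: (contat_ext_near (f := fun w => (f w - f x) / (w - x)) zx0).
  move=> w wz; rewrite fE addrC addKr mulfK// subr_eq0.
  by apply: contraTneq wz => ->; rewrite modulusB ltxx.
apply: contatM; first by apply: contatB => //; exact: contat_cst.
apply: contatV; last by rewrite subr_eq0.
by apply: contatB; [exact: contat_id|exact: contat_cst].
Qed.

Lemma divdiff_growth f x q r B : (forall w, f w = f x + q w * (w - x)) ->
  2 * modulus x + 1 < r -> forall z, modulus z = r -> modulus (f z) <= B ->
  modulus (q z) <= 2 * (B + modulus (f x)) / r.
Proof.
move=> fE xr z zr fz; have x0 := modulus_ge0 x; have r0 : 0 < r by lra.
have zx : r / 2 <= modulus (z - x) by have := ler_modulusB z x; rewrite zr; lra.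
have k : modulus (q z) * modulus (z - x) <= B + modulus (f x).
  rewrite -modulusM; have -> : q z * (z - x) = f z - f x by rewrite [f z]fE; ring.
  by apply: le_trans (modulusD _ _) _; rewrite modulusN lerD2r.
rewrite ler_pdivlMr//.
have : modulus (q z) * (r / 2) <= modulus (q z) * modulus (z - x).
  by rewrite ler_wpM2l ?modulus_ge0.
lra.
Qed.

(* Newton interpolation at fresh nodes: each divided difference is continuous
   everywhere and holomorphic off finitely many points, so that no theorem on
   removable singularities is needed. *)
Lemma poly_of_growth d : forall f (s : seq R[i]) B, 0 <= B ->
  (forall z, contat f z) -> (forall z, z \notin s -> holo f z) ->
  (forall r0, exists2 r, r0 < r & forall z, modulus z = r -> modulus (f z) <= B * r ^+ d) ->
  exists p : {poly R[i]}, forall z, f z = p.[z].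
Proof.
elim: d => [|d ih] f s B B0 cf hf growth; have [x xs] := fresh_point s;
  have [q cq fE] := hf x xs; have cq' := contat_divdiff cf cq fE;
  pose B' := 2 * (B + modulus (f x)).
- have hq z : z \notin x :: s -> holo q z.
    by rewrite inE negb_or => /andP[zx /hf]; exact: holo_divdiff fE _ zx.
  have q0 : forall z, q z = 0.
    apply: (vanish_of_small_circles cq' hq (B := B')) => r0.
    have [r + hr] := growth (Num.max r0 (2 * modulus x + 1)).
    rewrite gt_max => /andP[r0r xr]; exists r => // z zr.
    by apply: (divdiff_growth fE xr zr); have := hr z zr; rewrite mulr1.
  by exists (f x)%:P => z; rewrite fE q0 mul0r addr0 hornerC.
- have hq z : z \notin x :: s -> holo q z.
    by rewrite inE negb_or => /andP[zx /hf]; exact: holo_divdiff fE _ zx.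
  have fx0 := modulus_ge0 (f x).
  have B'0 : 0 <= B' by rewrite /B'; lra.
  have [r0|p hp] := ih q (x :: s) B' B'0 cq' hq.
    have [r + hr] := growth (Num.max r0 (2 * modulus x + 1)).
    rewrite gt_max => /andP[r0r xr]; exists r => // z zr.
    have x0 := modulus_ge0 x; have r1 : 1 <= r by lra.
    have rr : 0 < r by lra.
    apply: le_trans (divdiff_growth fE xr zr (hr z zr)) _.
    rewrite ler_pdivrMr// -mulrA -exprSr /B' -mulrA ler_pM2l// mulrDl lerD2l.
    by rewrite ler_peMr// exprn_ege1.
  exists ((f x)%:P + p * ('X - x%:P)) => z.
  by rewrite fE hp hornerD hornerM hornerXsubC hornerC.
Qed.

Lemma transcendental_growth f : transcendental_entire f ->
  exists r0, forall r, r0 < r -> exists2 z, modulus z = r & r ^+ 2 < modulus (f z).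
Proof.
move=> [/entire_holo hf npoly]; apply: contrapT => nex; apply: npoly.
apply: (@poly_of_growth 2 f [::] 1) => // [z|r0]; first exact/holo_contat/hf.
apply: contrapT => nr; apply: nex; exists r0 => r r0r; apply: contrapT => nz.
apply: nr; exists r => // z zr; rewrite mul1r leNgt; apply/negP => lt; apply: nz.
by exists z.
Qed.

Lemma transcendental_nonconst f : transcendental_entire f -> ~ exists c, forall z, f z = c.
Proof. by move=> [_ npoly] [c fc]; apply: npoly; exists c%:P => z; rewrite hornerC fc. Qed.

End EntireGrowth.

(** * Forward invariance of the Fatou set *)

Section FatouSet.
Variable R : realType.
Implicit Types (p z w c : R[i]) (e r B : R).
Variable f : R[i] -> R[i].
Hypothesis hf : forall z, holo f z.

Lemma holo_iter n z : holo (iter n f) z.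
Proof. by elim: n z => [|n ih] z /=; [exact: holo_id|exact: holo_comp]. Qed.

Lemma open_disc r : open [set z : R[i] | modulus z < r].
Proof.
apply/open_modulusP => z /= zr; exists (r - modulus z); first by rewrite subr_gt0.
by move=> w; have := modulusD (w - z) z; rewrite subrK; lra.
Qed.

Lemma invariant_disc_fatou r : (forall z, modulus z < r -> modulus (f z) < r) ->
  forall z, modulus z < r -> fatou f z.
Proof.
move=> fr z zr; have r0 : 0 < r by apply: le_lt_trans zr; exact: modulus_ge0.
exists [set z | modulus z < r]; first by split => //; exact: open_disc.
move=> s hs.
have sE k : exists n, s k = iter n f by have [n _ <-] := hs k; exists n.
have iterr n w : modulus w < r -> modulus (iter n f w) < r.
  by move=> wr; elim: n => //= n; exact: fr.
have [|k w wr|phi [hphi [g hg]]] := @montel_bounded R r r s r0.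
- by move=> k w _; have [n ->] := sE k; exact: holo_iter.
- by have [n ->] := sE k; rewrite ltW// iterr.
by exists phi; split => //; left; exists g.
Qed.

Hypothesis nf : ~ exists c, forall z, f z = c.

Lemma image_open (V : set R[i]) : open V -> open (f @` V).
Proof.
move=> /open_modulusP oV; apply/open_modulusP => _ [z Vz <-].
have [e e0 h] := oV z Vz; have [d d0 hd] := open_mapping z hf nf e0.
by exists d => // c /hd[w /h Vw <-]; exists w.
Qed.

Lemma image_iter_open n (V : set R[i]) : open V -> open (iter n f @` V).
Proof.
elim: n => [|n ih] oV; first by rewrite (_ : iter 0 f = id)// image_id.
have -> : iter n.+1 f @` V = f @` (iter n f @` V) by rewrite -image_comp.
by apply: image_open; exact: ih.
Qed.

(** By the open mapping theorem, discs about a point of [V] cover discs about its image, so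
    convergence of the maps composed with [f] near y passes to convergence near f(y). *)
Lemma fatou_forward z : fatou f z -> fatou f (f z).
Proof.
move=> [V [oV Vz] nV]; exists (f @` V).
  by split; [exact: image_open|exists z].
move=> s hs.
have hs' k : [set iter n f | n in [set n | (0 < n)%N]] (s k \o f).
  have [n n0 sn] := hs k; exists n.+1 => //; apply/funext => w.
  by rewrite /= -sn -iterSr.
have [phi [hphi cases]] := nV _ hs'; exists phi; split => //.
have oV' := (open_modulusP _).1 oV.
case: cases => [[g cg]|cinf]; [left|right].
  (* The limit on f(V) is read off at a chosen preimage; [gE] shows that the choice does not matter.
     Outside f(V) the value is arbitrary. *)
  have /choice[sec hsec] : forall w, exists y, (f @` V) w -> V y /\ f y = w.
    move=> w; have [[y Vy yw]|nw] := pselect ((f @` V) w); first by exists y.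
    by exists w.
  have ptw y : V y -> forall e, 0 < e -> exists N, forall n, (N <= n)%N ->
      modulus (s (phi n) (f y) - g y) < e.
    move=> Vy e e0; have [W /nbhs_modulusP[d d0 hd] /uniform_modulusP /(_ e e0)[N hN]] := cg y Vy.
    by exists N => n /hN; apply; apply: hd; rewrite subrr modulus0.
  have gE y y' : V y -> V y' -> f y = f y' -> g y = g y'.
    move=> Vy Vy' yy'; apply/eqP; rewrite -subr_eq0 -modulus_eq0; apply/eqP/le_anti.
    rewrite modulus_ge0 andbT; apply/ler_addgt0Pr => e e0; rewrite add0r.
    have e2 : 0 < e / 2 by rewrite divr_gt0.
    have [N hN] := ptw y Vy _ e2; have [N' hN'] := ptw y' Vy' _ e2.
    have := hN (maxn N N') (leq_maxl _ _); have := hN' (maxn N N') (leq_maxr _ _).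
    rewrite -yy'; set t := s _ _.
    have := modulusD (t - g y') (g y - t).
    have -> : t - g y' + (g y - t) = g y - g y' by ring.
    by rewrite (modulusB (g y) t); lra.
  exists (g \o sec) => _ [y Vy <-].
  have [W /nbhs_modulusP[d d0 hd] uW] := cg y Vy.
  have [d' d'0 hd'] := oV' y Vy.
  have m0 : 0 < Num.min d d' by rewrite lt_min d0.
  have [t t0 ht] := open_mapping y hf nf m0.
  exists [set w | modulus (w - f y) < t]; first by apply/nbhs_modulusP; exists t.
  apply/uniform_modulusP => e e0.
  have /uniform_modulusP /(_ e e0)[N hN] := uW.
  exists N => n Nn w /ht[x]; rewrite lt_min => /andP[xd xd'] <-.
  have Vx := hd' x xd'.
  have [Vsx fsx] := hsec (f x) (ex_intro2 _ _ x Vx erefl).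
  by rewrite /= (gE (sec (f x)) x Vsx Vx fsx); apply: hN => //; exact: hd.
move=> _ [y Vy <-].
have [W /nbhs_modulusP[d d0 hd] uW] := cinf y Vy.
have [t t0 ht] := open_mapping y hf nf d0.
exists [set w | modulus (w - f y) < t]; first by apply/nbhs_modulusP; exists t.
move=> M; have [N _ hN] := uW M.
by exists N => // n Nn w /ht[x xd <-]; apply: (hN n Nn); exact: hd.
Qed.

Lemma fatou_iter n z : fatou f z -> fatou f (iter n f z).
Proof. by elim: n => //= n ih /ih; exact: fatou_forward. Qed.

Lemma connected_image_iter n (A : set R[i]) : connected A -> connected (iter n f @` A).
Proof.
move=> cA; apply: connected_continuous_connected => //.
apply: continuous_subspaceT => z V /nbhs_modulusP[e e0 hV].
have [d d0 hd] := holo_contat (holo_iter n z) e0.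
by apply/nbhs_modulusP; exists d => // w /hd; exact: hV.
Qed.

End FatouSet.

(** * Wandering domains containing circles *)

Section Dynamics.
Variable R : realType.
Implicit Types (f : R[i] -> R[i]) (x y z w c : R[i]) (e t : R) (U V A : set R[i]).

Lemma connected_modulus_lt A x t : connected A -> A x -> modulus x < t ->
  (forall y, A y -> modulus y <> t) -> forall y, A y -> modulus y < t.
Proof.
move=> cA Ax xt nt.
have E : A `&` [set y | modulus y < t] = A.
  apply: cA; first by exists x.
    by exists [set y | modulus y < t] => //; exact: open_disc.
  exists [set y | modulus y <= t].
    rewrite (_ : [set y | _] = [set y | modulus (y - 0) <= t]); last first.
      by apply/seteqP; split=> y /=; rewrite subr0.
    apply: closed_modulusP => y /= /negP; rewrite -ltNge subr0 => yt.
    exists (modulus y - t); first by rewrite subr_gt0.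
    by move=> w; have := ler_modulusB y w; rewrite subr0 modulusB; lra.
  apply/seteqP; split=> y /= [Ay]; first by move/ltW.
  by rewrite le_eqVlt => /orP[/eqP /(nt y Ay)|].
by move=> y; rewrite -{1}E => -[].
Qed.

Lemma connected_modulus_gt A x t : connected A -> A x -> t < modulus x ->
  (forall y, A y -> modulus y <> t) -> forall y, A y -> t < modulus y.
Proof.
move=> cA Ax tx nt y Ay; rewrite ltNge le_eqVlt; apply/negP => /orP[/eqP /(nt y Ay)//|yt].
by have := connected_modulus_lt cA Ay yt nt Ax; rewrite ltNge ltW.
Qed.

Lemma connected_disc t : connected [set z : R[i] | modulus z < t].
Proof.
have -> : [set z : R[i] | modulus z < t] =
   \bigcup_(z in [set z | modulus z < t]) [set u%:C * z | u in `[0, 1] : set R].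
  apply/seteqP; split => [z zt|_ [z /= zt [u] + <-]].
    by exists z => //=; exists 1; rewrite ?mul1r//= in_itv/= ler01 lexx.
  rewrite /= in_itv/= => /andP[u0 u1]; rewrite modulusM modulus_real ger0_norm//.
  by apply: le_lt_trans zt; rewrite ler_piMl// modulus_ge0.
apply: bigcup_connected.
  by exists 0 => z _; exists 0; rewrite ?mul0r//= in_itv/= ler01 lexx.
move=> z _; apply: connected_continuous_connected; first exact: segment_connected.
apply: continuous_subspaceT => u V /nbhs_modulusP[e e0 hV].
have m1 : 0 < modulus z + 1 by rewrite ltr_wpDl// modulus_ge0.
apply/nbhs_ballP; exists (e / (modulus z + 1)) => /=; first exact: divr_gt0.
move=> v; rewrite /ball /= distrC ltr_pdivlMr// => uv; apply: hV.
rewrite -mulrBl -rmorphB modulusM modulus_real; apply: le_lt_trans uv.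
by rewrite ler_wpM2l// lerDl.
Qed.

Lemma strict_max_disc f t M : (forall z, holo f z) -> 0 <= t ->
  (forall z, modulus z = t -> modulus (f z) < M) ->
  forall z, modulus z <= t -> modulus (f z) < M.
Proof.
move=> hf t0 fM z zt.
have ne : [set w : R[i] | t <= modulus (w - 0) <= t] !=set0.
  by exists t%:C; rewrite /mkset subr0 modulus_real ger0_norm// lexx.
have [c /= /andP[tc ct] cmax] := compact_max (@compact_ring R 0 t t) ne
   (fun w _ => contatR_modulus (holo_contat (hf w))).
rewrite subr0 in tc ct.
have {tc ct} tc : modulus c = t by apply/le_anti; rewrite tc ct.
apply: le_lt_trans (fM c tc).
apply: (@max_principle_disc _ f 0 t) => [w _|w _|w|]; last by rewrite subr0.
- exact/holo_contat/hf.
- by exists 1.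
- by rewrite subr0 => wt; apply: cmax; rewrite /= subr0 wt lexx.
Qed.

(** * Components met by the orbit of a wandering domain *)

Section Wandering.
Variables (f : R[i] -> R[i]) (U : set R[i]).
Hypothesis hf : forall z, holo f z.
Hypothesis nf : ~ exists c, forall z, f z = c.
Hypothesis wU : wandering_domain f U.

Lemma wandering_fatou n x : U x -> fatou f (iter n f x).
Proof.
case: wU => [[z _ ->] _] /connected_component_sub; exact: fatou_iter.
Qed.

Lemma wandering_connected : connected U.
Proof. by case: wU => [[z _ ->] _]; exact: component_connected. Qed.

Lemma component_orbitE n x : U x ->
  component_orbit f U n = connected_component (fatou f) (iter n f x).
Proof.
move=> Ux; apply/seteqP; split; last by move=> w h; exists x.
move=> w [y Uy]; suff -> : connected_component (fatou f) (iter n f y) =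
   connected_component (fatou f) (iter n f x) by [].
apply: same_connected_component.
apply: (@connected_component_max _ _ (iter n f @` U)); [by exists y| | |by exists x].
  by move=> _ [y' Uy' <-]; exact: wandering_fatou.
by apply: connected_image_iter => //; exact: wandering_connected.
Qed.

(** If A meets both images with n < m, then U_n = U_m; applying further iterates to A makes the
    components periodic from index n on, with period m - n. *)
Lemma wandering_separated A n m x y : connected A -> A `<=` fatou f -> U x -> U y ->
  A (iter n f x) -> A (iter m f y) -> n = m.
Proof.
wlog nm : n m x y / (n < m)%N.
  move=> wl cA Af Ux Uy An Am; have [nm|mn|//] := ltngtP n m; first exact: (wl n m x y).
  by apply/esym; exact: (wl m n y x).
move=> cA Af Ux Uy An Am; exfalso; case: wU => _; apply.
exists n, (m - n)%N; rewrite subn_gt0; split => // k nk.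
have -> : (k + (m - n) = (k - n) + m)%N by lia.
rewrite (component_orbitE _ Uy) (component_orbitE _ Ux).
have -> : k = ((k - n) + n)%N by lia.
rewrite addnK !iterD; apply: same_connected_component.
apply: (@connected_component_max _ _ (iter (k - n) f @` A)).
- by exists (iter m f y).
- by move=> _ [w Aw <-]; apply: fatou_iter => //; exact: Af.
- exact: connected_image_iter.
- by exists (iter n f x).
Qed.

Lemma wandering_no_invariant_disc t n m x y : (forall z, modulus z < t -> modulus (f z) < t) ->
  U x -> U y -> modulus (iter n f x) < t -> modulus (iter m f y) < t -> n = m.
Proof.
move=> ft Ux Uy xt yt.
apply: (@wandering_separated [set z | modulus z < t] n m x y) => //.
  exact: connected_disc.
exact: invariant_disc_fatou.
Qed.

(** * The radii of the circles contained in the images *)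

Variables (z0 : R[i]) (n0 : nat).
Hypothesis Uz0 : U z0.
Let r n := modulus (iter n f z0).
Hypothesis circ : forall n, (n0 <= n)%N -> forall z, modulus z = r n -> (iter n f @` U) z.

Let imf n z : (iter n f @` U) z -> (iter n.+1 f @` U) (f z).
Proof. by case=> x Ux <-; exists x. Qed.

Lemma circle_avoid n m : (n0 <= m)%N -> n != m ->
  forall y, (iter n f @` U) y -> modulus y <> r m.
Proof.
move=> hm nm y [x Ux xy] ym; have [x' Ux' x'y] := circ hm ym.
move/eqP: nm; apply; apply: (@wandering_separated (iter n f @` U) n m x x') => //.
- by apply: connected_image_iter => //; exact: wandering_connected.
- by move=> _ [w Uw <-]; exact: wandering_fatou.
- by exists x; rewrite // x'y xy.
Qed.

Lemma radius_neq n m : (n0 <= m)%N -> n != m -> r n != r m.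
Proof.
by move=> hm nm; apply/eqP; apply: (@circle_avoid n m hm nm (iter n f z0)); exists z0.
Qed.

Lemma image_inside n m : (n0 <= m)%N -> r n < r m ->
  forall y, (iter n f @` U) y -> modulus y < r m.
Proof.
move=> hm rnm; have nm : n != m by apply: contraTneq rnm => ->; rewrite ltxx.
apply: (@connected_modulus_lt _ (iter n f z0)) => //; last exact: circle_avoid.
by apply: connected_image_iter => //; exact: wandering_connected.
Qed.

Lemma image_outside n m : (n0 <= m)%N -> r m < r n ->
  forall y, (iter n f @` U) y -> r m < modulus y.
Proof.
move=> hm rnm; have nm : n != m by apply: contraTneq rnm => ->; rewrite ltxx.
apply: (@connected_modulus_gt _ (iter n f z0)) => //; last exact: circle_avoid.
by apply: connected_image_iter => //; exact: wandering_connected.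
Qed.

(** [f] sends the circle of radius r_n into f^(n+1)(U), which lies inside the circle of radius r_m
    as soon as one of its points does; the maximum principle fills the disc. *)
Lemma disc_image n m : (n0 <= n)%N -> (n0 <= m)%N -> r n.+1 < r m ->
  forall z, modulus z <= r n -> modulus (f z) < r m.
Proof.
move=> hn hm nm; apply: strict_max_disc => //; first exact: modulus_ge0.
by move=> z /(circ hn)/imf; exact: image_inside.
Qed.

(** Otherwise the disc of radius r_n, which contains f^m(z0), would be mapped strictly inside the
    circle of radius r_(m+1), where f^(m+1)(z0) lies. *)
Lemma radius_order n m : (n0 <= n)%N -> (n0 <= m)%N -> r m < r n -> r m.+1 < r n.+1.
Proof.
move=> hn hm mn; rewrite ltNge; apply/negP; rewrite le_eqVlt => /orP[/eqP E|lt].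
  have nm : n.+1 != m.+1 by apply: contraTneq mn => -[->]; rewrite ltxx.
  by have /eqP := radius_neq (leqW hm) nm.
by have := disc_image hn (leqW hm) lt (ltW mn); rewrite -/(r m.+1) ltxx.
Qed.

(** By [radius_order] one ascent propagates for ever. A descent at [n0] would make the disc of
    radius r_(n0) invariant, with two points of the orbit inside. *)
Lemma radius_increasing n : (n0 <= n)%N -> r n < r n.+1.
Proof.
have up k : r n0 < r n0.+1 -> r (n0 + k)%N < r (n0 + k).+1.
  by move=> h; elim: k => [|k ih]; rewrite ?addn0// addnS radius_order ?leq_addr// leqW// leq_addr.
move=> hn; rewrite -(subnKC hn); apply: up.
rewrite ltNge; apply/negP; rewrite le_eqVlt => /orP[/eqP E|down].
  have ne : n0.+1 != n0 by rewrite gtn_eqF.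
  by have := radius_neq (leqnn n0) ne; rewrite E eqxx.
have down' : r n0.+2 < r n0.+1 by apply: radius_order.
have inv z : modulus z < r n0 -> modulus (f z) < r n0.
  by move=> /ltW; apply: disc_image.
have := @wandering_no_invariant_disc (r n0) n0.+1 n0.+2 z0 z0 inv Uz0 Uz0 down (lt_trans down' down).
by lia.
Qed.

Lemma radius_mono n m : (n0 <= n)%N -> (n < m)%N -> r n < r m.
Proof.
move=> hn; elim: m => // m ih; rewrite ltnS leq_eqVlt => /orP[/eqP <-|nm].
  exact: radius_increasing.
by apply: lt_trans (ih nm) _; apply: radius_increasing; apply: leq_trans hn (ltnW nm).
Qed.

(** If the radii were bounded, the open disc whose radius is their supremum would be invariant. *)
Lemma radius_unbounded M : exists N, forall n, (N <= n)%N -> M < r n.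
Proof.
suff [N hN MN] : exists2 N, (n0 <= N)%N & M < r N.
  exists N => n; rewrite leq_eqVlt => /orP[/eqP <-//|Nn].
  by apply: lt_trans MN _; exact: radius_mono.
apply: contrapT => nb.
pose S := [set r n | n in [set n | (n0 <= n)%N]].
have supS : has_sup S.
  split; first by exists (r n0); exists n0 => /=.
  exists M => _ [n hn <-]; rewrite leNgt; apply/negP => Mn; apply: nb; by exists n.
have ltS n : (n0 <= n)%N -> r n < sup S.
  move=> hn; apply: lt_le_trans (radius_increasing hn) _.
  by apply: sup_upper_bound => //; exists n.+1 => //=; exact: leqW.
have inv z : modulus z < sup S -> modulus (f z) < sup S.
  move=> zS; have e0 : 0 < sup S - modulus z by rewrite subr_gt0.
  have [_ [n hn <-]] := sup_adherent e0 supS; rewrite opprB addrC subrK => zn.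
  apply: lt_trans (ltS n.+2 (leqW (leqW hn))).
  exact: (disc_image hn (leqW (leqW hn)) (radius_increasing (leqW hn)) (ltW zn)).
have := @wandering_no_invariant_disc (sup S) n0 n0.+1 z0 z0 inv Uz0 Uz0 (ltS _ (leqnn _)) (ltS _ (leqnSn _)).
lia.
Qed.

(** On the circle of radius r_n some value exceeds r_n ^ 2 in modulus. All these values lie in
    f^(n+1)(U), hence inside the circle of radius r_(n+2); this is why the index advances by two. *)
Lemma radius_growth : (exists t0, forall t, t0 < t -> exists2 z, modulus z = t & t ^+ 2 < modulus (f z)) ->
  exists N, forall n, (N <= n)%N -> r n ^+ 2 < r n.+2.
Proof.
move=> [t0 ht]; have [N hN] := radius_unbounded t0.
exists (maxn n0 N) => n; rewrite geq_max => /andP[hn /hN /ht[z zr lt]].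
apply: lt_trans lt _.
by apply: (disc_image hn (leqW (leqW hn)) (radius_increasing (leqW hn))); rewrite zr.
Qed.

(* If log|f^n| varied little, relative to its size, between the circles of radii
   r m and t, then by convexity it would vary little between those of radii r k
   and r m; but it at least doubles there. *)
Lemma radius_oscillation k t : (n0 <= k)%N -> (forall n, (k <= n)%N -> 1 < r n) ->
  (forall n, (k <= n)%N -> r n ^+ 2 < r n.+2) -> r (k + 3)%N < t ->
  (forall z, modulus z = t -> (iter (k + 3) f @` U) z) ->
  exists kap N, 0 < kap /\ forall n, (N <= n)%N -> exists2 z, modulus z = t &
    (1 + kap) * ln (r (k + 3 + n)%N) <= ln (modulus (iter n f z)).
Proof.
move=> kn0 rgt1 growth mt circt.
have r_gt0 n : (k <= n)%N -> 0 < r n by move=> /rgt1; exact: lt_trans.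
have rk0 := r_gt0 k (leqnn k).
have rm0 := r_gt0 (k + 3)%N (leq_addr _ _).
have t0 : 0 < t by exact: lt_trans mt.
have km : r k < r (k + 3)%N by apply: radius_mono => //; rewrite -addn1 leq_add2l.
pose Lam := ln (r (k + 3)%N) - ln (r k); pose Lam' := ln t - ln (r (k + 3)%N).
have Lam0 : 0 < Lam by rewrite subr_gt0 ltr_ln ?posrE.
have Lam'0 : 0 < Lam' by rewrite subr_gt0 ltr_ln ?posrE.
pose kap := Lam' / (8 * Lam).
have kap0 : 0 < kap by rewrite divr_gt0// mulr_gt0.
have kE : kap * (8 * Lam) = Lam' by rewrite /kap divfK// gt_eqF// mulr_gt0.
have [N hN] := radius_unbounded (expR (4 * Lam)).
exists kap, N; split => // n Nn; apply: contrapT => nosc.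
set nu := ln (r (k + 3 + n)%N) in nosc.
have rmn0 : 0 < r (k + 3 + n)%N by apply: r_gt0; rewrite -addnA leq_addr.
have nu4 : 4 * Lam < nu.
  by rewrite -ltr_expR lnK ?posrE//; apply: hN; apply: leq_trans Nn (leq_addl _ _).
have small z : modulus z = t -> modulus (iter n f z) <= expR ((1 + kap) * nu).
  move=> zt; have zU : (iter (k + 3 + n) f @` U) (iter n f z).
    by have [x Ux <-] := circt z zt; exists x; rewrite // addnC iterD.
  have F0 : 0 < modulus (iter n f z).
    apply: lt_trans rk0 _; apply: (image_outside kn0 _ zU).
    by apply: radius_mono => //; rewrite -addnA -addn1 leq_add2l.
  rewrite -[leLHS]lnK ?posrE// ler_expR leNgt; apply/negP => lt.
  by apply: nosc; exists z => //; exact: ltW.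
(* The upper bound p < nu / (2 Lam) excludes the inner circle in the three circles estimate. The
   lower bound, with the 8 in [kap], excludes the outer one: it would give p Lam' <= kap nu <= p
   Lam' / 2. *)
have [p /andP[p1 p2]] : exists p : nat, nu / (4 * Lam) <= p%:R < 2 * (nu / (4 * Lam)).
  by apply: nat_between; rewrite ler_pdivlMr ?mulr_gt0// mul1r ltW.
(* On the circle of radius r_k the iterate f^n stays inside the circle of index k + n + 1, and two
   further indices square the radius; hence the offset 3 and ln q <= nu / 2. *)
pose q := r (k + n.+1)%N.
have q0 : 0 < q by apply: r_gt0; exact: leq_addr.
have q1 : q ^+ 2 < r (k + 3 + n)%N.
  have -> : (k + 3 + n)%N = (k + n.+1).+2 by rewrite addnAC !addnS addn0.
  by apply: growth; exact: leq_addr.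
have lnm (x y : R) : 0 < x -> x <= y -> ln x <= ln y.
  by move=> x0 xy; rewrite ler_ln ?posrE//; exact: lt_le_trans xy.
have qnu : ln q *+ 2 <= nu.
  by rewrite -lnXn//; apply: lnm; [exact: exprn_gt0|exact: ltW].
have bigk z : modulus z = r k -> modulus (iter n f z) <= q.
  move=> /(circ kn0)[x Ux <-].
  apply/ltW/(@image_inside (k + n)%N); last by exists x; rewrite // addnC iterD.
    exact: leq_trans kn0 (leq_addr _ _).
  by apply: radius_mono; rewrite ?addnS//; exact: leq_trans kn0 (leq_addr _ _).
have lnq (x y : R) : 0 < x -> 0 < y -> ln (x / y ^+ p) = ln x - p%:R * ln y.
  by move=> x0 y0; rewrite ln_div ?posrE ?exprn_gt0// lnXn// mulr_natl.
have np : nu <= p%:R * (4 * Lam) by rewrite -ler_pdivrMr// mulr_gt0.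
have pn : p%:R * (2 * Lam) < nu.
  rewrite -ltr_pdivlMr ?mulr_gt0//; move: p2.
  by have -> : 2 * (nu / (4 * Lam)) = nu / (2 * Lam) by field; rewrite gt_eqF.
have [] := three_circles p (holo_iter hf n) rk0 km mt bigk small (w := iter (k + 3) f z0) erefl;
  rewrite -iterD [(n + _)%N]addnC => /lnm; rewrite divr_gt0 ?exprn_gt0// => /(_ isT);
  rewrite !lnq ?expR_gt0//.
  by rewrite -/nu mulr2n in qnu *; rewrite /Lam in pn; lra.
rewrite -/nu expRK => h.
have k1 : p%:R * Lam' <= kap * nu by rewrite /Lam'; lra.
have k2 : kap * nu <= kap * (p%:R * (4 * Lam)) by rewrite ler_pM2l.
have k3 : kap * (p%:R * (4 * Lam)) = p%:R * Lam' / 2 by rewrite -kE; field.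
have p0 : 0 < p%:R * Lam'.
  rewrite mulr_gt0//; apply: lt_le_trans p1; rewrite divr_gt0 ?mulr_gt0//.
  by apply: lt_trans nu4; rewrite mulr_gt0.
have := le_trans k1 k2; rewrite k3 leNgt => /negP; apply.
by rewrite ltr_pdivrMr// ltr_pMr// ltr1n.
Qed.

End Wandering.
End Dynamics.

(** * Annuli in the image of a domain *)

Section Propagation.
Variable R : realType.
Implicit Types (p q z w c : R[i]) (e r s d : R) (W K E : set R[i]).

(** The hypothesis makes [E] locally constant, so it cuts out a relatively open and closed part of
    [W]. The radius [d] may depend on p, but not on the point q at which [E] is known. *)
Lemma connected_propagate W E p0 : connected W -> W p0 -> E p0 ->
  (forall p, W p -> exists2 d, 0 < d & forall q, modulus (q - p) < d -> E q ->
     forall q', modulus (q' - p) < d -> E q') ->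
  forall q, W q -> E q.
Proof.
move=> cW Wp0 Ep0 prop.
have WE : W `&` E = W.
  apply: cW; first by exists p0.
    exists [set z | exists p d, [/\ W p, 0 < d, modulus (z - p) < d &
        forall q, modulus (q - p) < d -> E q]].
      apply/open_modulusP => z [p [d [Wp d0 zd Ed]]].
      exists (d - modulus (z - p)); first by rewrite subr_gt0.
      move=> w wz; exists p, d; split => //.
      by have := modulusD (w - z) (z - p); rewrite addrA subrK; lra.
    apply/seteqP; split => z [Wz].
      move=> Ez; split => //; have [d d0 hd] := prop z Wz.
      exists z, d; split => //; first by rewrite subrr modulus0.
      by apply: (hd z) => //; rewrite subrr modulus0.
    by move=> [p [d [Wp d0 zd Ed]]]; split => //; exact: Ed.
  pose O := [set z | exists p d, [/\ W p, 0 < d, modulus (z - p) < d &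
      forall q, modulus (q - p) < d -> ~ E q]].
  exists (~` O).
    apply: open_closedC; apply/open_modulusP => z [p [d [Wp d0 zd Ed]]].
    exists (d - modulus (z - p)); first by rewrite subr_gt0.
    move=> w wz; exists p, d; split => //.
    by have := modulusD (w - z) (z - p); rewrite addrA subrK; lra.
  apply/seteqP; split => z [Wz].
    by move=> Ez; split => // -[p [d [Wp d0 zd Ed]]]; exact: (Ed z).
  move=> nOz; split => //; apply: contrapT => nEz; apply: nOz.
  have [d d0 hd] := prop z Wz; exists z, d; split => //.
    by rewrite subrr modulus0.
  by move=> q qd Eq; apply: nEz; apply: (hd q) => //; rewrite subrr modulus0.
by move=> q; rewrite -{1}WE => -[].
Qed.

Lemma compact_uniform K (Q : nat -> R[i] -> Prop) : compact K ->
  (forall p, K p -> exists d N, 0 < d /\ forall n, (N <= n)%N -> forall z, modulus (z - p) < d -> Q n z) ->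
  exists N, forall n, (N <= n)%N -> forall z, K z -> Q n z.
Proof.
move=> /compact_near_coveringP cK h.
have [N _ hN] : \forall n \near \oo, K `<=` Q n.
  apply: cK => p Kp; have [d [N [d0 hN]]] := h p Kp.
  exists ([set z | modulus (z - p) < d], [set n | (N <= n)%N]).
    by split; [apply/nbhs_modulusP; exists d|exists N].
  by case=> z n [/= zd Nn]; exact: hN.
by exists N => n Nn z; exact: hN.
Qed.

End Propagation.

(** * Large annuli covered by functions whose logarithmic modulus oscillates *)

Section Covering.
Variable R : realType.
Implicit Types (p q z w c : R[i]) (e r s d : R) (K E : set R[i]).
Variables (W : set R[i]) (F : nat -> R[i] -> R[i]) (lam : nat -> R).
Let u n z := ln (modulus (F n z)).
Hypothesis oW : open W.
Hypothesis cW : connected W.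
Hypothesis hF : forall n z, W z -> holo (F n) z.
Hypothesis lamF : forall n z, W z -> 0 < lam n <= u n z.

Lemma ln_pos_gt1 (x : R) : 0 < ln x -> 1 < x.
Proof.
move=> x0; rewrite ltNge; apply/negP => x1.
have : ln x <= 0 by apply: ln_le0.
by rewrite leNgt x0.
Qed.

Lemma u_gt0 n z : W z -> 0 < u n z.
Proof. by move=> /(lamF n)/andP[]; exact: lt_le_trans. Qed.

Lemma F_gt1 n z : W z -> 1 < modulus (F n z).
Proof. by move=> /(u_gt0 n)/ln_pos_gt1. Qed.

(** The logarithm is rotated by the bounded phase [t] to be real at [p], which lets Harnack's
    inequality control its whole modulus and not only its real part. *)
Lemma local_log n p r : 0 < r -> (forall z, modulus (z - p) <= r -> W z) ->
  exists L t, [/\ L p = (u n p)%:C, `|t| <= pi &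
    forall z, modulus (z - p) <= r / 4 ->
    [/\ holo L z, cexp (L z + 0 +i* t) = F n z, complex.Re (L z) = u n z,
       modulus (L z) <= 3 * u n p &
       u n p / 3 <= u n z /\ modulus (L z - (u n p)%:C) <= 8 / r * u n p * modulus (z - p)]].
Proof.
move=> r0 Wp.
have pp : modulus (p - p) <= r by rewrite subrr modulus0 ltW.
have F0 z : modulus (z - p) <= r -> F n z != 0.
  by move=> /Wp /(F_gt1 n) h; rewrite -modulus_gt0; apply: lt_trans h.
have [t tpi Fp] := polar (F0 p pp).
have [L [Lp hL]] := holo_log r0 (fun z zr => hF n (Wp z zr)) F0 (esym Fp).
have r2 : 0 < r / 2 by rewrite divr_gt0.
pose L0 z := L z - 0 +i* t.
have ReL z : modulus (z - p) <= r / 2 -> complex.Re (L0 z) = u n z.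
  by move=> /hL[_ E]; rewrite /u -E modulus_cexp expRK /L0 ReD /= oppr0 addr0.
have hL0 z : modulus (z - p) <= r / 2 -> holo L0 z.
  by move=> /hL[h _]; apply: holoB => //; exact: holo_cst.
have pL0 z : modulus (z - p) <= r / 2 -> 0 < complex.Re (L0 z).
  by move=> zr; rewrite ReL//; apply/u_gt0/Wp; lra.
have L0p : L0 p = (u n p)%:C.
  by rewrite /L0 Lp; apply/eqP; rewrite eq_complex /= oppr0 addr0 subrr !eqxx.
exists L0, t; split => // z zr.
have zr2 : modulus (z - p) <= r / 2 / 2 by lra.
have zr1 : modulus (z - p) <= r / 2 by lra.
have [h1 h2 h3] := harnack_disc r2 hL0 pL0 L0p zr2.
split => //.
- exact: hL0.
- by rewrite /L0 subrK; case: (hL z zr1).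
- exact: ReL.
split; first by rewrite -(ReL z zr1).
apply: le_trans h3 _; rewrite le_eqVlt; apply/orP; left; apply/eqP.
by field; rewrite gt_eqF.
Qed.

(** Let g = L / u(p) - 1. Where Re g is small, Harnack's inequality for g + d / 4, which has
    positive real part, makes |g| at most 3 d / 4 + d / 4 = d. The two-constants estimate carries
    this to the larger disc. *)
Lemma flat_spread r s e : 0 < r -> 0 < s -> s <= r / 8 -> 0 < e ->
  exists2 d, 0 < d & forall n p, (forall z, modulus (z - p) <= r -> W z) ->
    (forall z, modulus (z - p) <= s -> `|u n z - u n p| <= d * u n p) ->
    forall z, modulus (z - p) <= r / 8 -> `|u n z - u n p| <= e * u n p.
Proof.
move=> r0 s0 sr e0.
have s2 : 0 < s / 2 by rewrite divr_gt0.
have sr2 : s / 2 <= r / 4 / 2 by lra.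
have [d d0 hd] := two_constants s2 sr2 (ltr0n R 4) e0.
exists (d / 8); first by rewrite divr_gt0.
move=> n p Wp flat z zr.
have u0 : 0 < u n p by apply/u_gt0/Wp; rewrite subrr modulus0 ltW.
have uC0 : (u n p)%:C != 0 :> R[i] by rewrite -modulus_gt0 modulus_real normr_gt0 gt_eqF.
have [L [t [Lp _ hL]]] := local_log n r0 Wp.
pose g w := L w / (u n p)%:C - 1.
have gRe w : complex.Re (g w) = complex.Re (L w) / u n p - 1.
  by rewrite /g ReD ReN -fmorphV ReMr.
have hg w : modulus (w - p) <= r / 4 -> holo g w.
  move=> /hL[h _ _ _ _]; apply: holoB; last exact: holo_cst.
  by apply: holoM => //; exact: holo_cst.
have mu : modulus (u n p)%:C = u n p by rewrite modulus_real gtr0_norm.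
have g4 w : modulus (w - p) <= r / 4 -> modulus (g w) <= 4.
  move=> /hL[_ _ _ h _]; apply: le_trans (modulusD _ _) _.
  rewrite modulusN modulus1 modulusM modulusV mu.
  have : modulus (L w) / u n p <= 3 by rewrite ler_pdivrMr.
  lra.
have gd w : modulus (w - p) <= s / 2 -> modulus (g w) <= d.
  move=> ws.
  pose g' w := g w + (d / 4)%:C.
  have inr x : modulus (x - p) <= s -> modulus (x - p) <= r / 4 by lra.
  have A1 x : modulus (x - p) <= s -> holo g' x.
    by move=> xs; apply: holoD; [apply/hg/inr|exact: holo_cst].
  have A2 x : modulus (x - p) <= s -> 0 < complex.Re (g' x).
    move=> xs; rewrite /g' ReD gRe /=; have [_ _ -> _ _] := hL x (inr x xs).
    have := flat x xs; rewrite ler_norml => /andP[+ _].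
    move=> h; have {}h : 1 - d / 8 <= u n x / u n p by rewrite ler_pdivlMr//; lra.
    by rewrite -/(u n x); lra.
  have A3 : g' p = (d / 4)%:C.
    by rewrite /g' /g Lp divff// subrr add0r.
  have [h _ _] := harnack_disc s0 A1 A2 A3 ws.
  have -> : g w = g' w - (d / 4)%:C by rewrite /g' addrK.
  apply: le_trans (modulusD _ _) _; rewrite modulusN modulus_real gtr0_norm ?divr_gt0//; lra.
have := hd g p hg g4 gd z; have zr' : modulus (z - p) <= r / 4 / 2 by lra.
move=> /(_ zr') /(le_trans (le_Re_modulus _)).
have zr4 : modulus (z - p) <= r / 4 by lra.
have [_ _ E _ _] := hL z zr4; rewrite gRe E.
have -> : u n z / u n p - 1 = (u n z - u n p) / u n p by field; rewrite gt_eqF.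
by rewrite normrM normfV (gtr0_norm u0) ler_pdivrMr.
Qed.

Section FlatSequence.
Variables (idx : nat -> nat) (nu : nat -> R).
Hypothesis nu0 : forall j, 0 < nu j.

(** Along the subsequence [idx] the quotients u / nu tend to 1 uniformly near [q]. *)
Definition flat_at q := exists2 s, 0 < s & forall e, 0 < e -> exists J, forall j, (J <= j)%N ->
  forall z, modulus (z - q) < s -> `|u (idx j) z - nu j| <= e * nu j.

(** [flat_spread] compares with the value at the centre, whereas flatness refers to the fixed [nu].
    Since u(q) and nu differ by a small proportion of nu, one passes from one to the other and
    back. *)
Lemma flat_everywhere p0 : W p0 -> flat_at p0 -> forall q, W q -> flat_at q.
Proof.
move=> Wp0 Fp0; apply: (connected_propagate cW Wp0 Fp0) => p Wp.
have /open_modulusP /(_ p Wp)[r r0 hr] := oW.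
have r64 : 0 < r / 64 by rewrite divr_gt0.
exists (r / 64) => // q qp [s s0 flat] q' q'p.
have Wq z : modulus (z - q) <= r / 2 -> W z.
  by move=> zq; apply: hr; have := modulusD (z - q) (q - p); rewrite addrA subrK; lra.
have r2 : 0 < r / 2 by rewrite divr_gt0.
have [s' [s'0 s's s'r]] : exists s', [/\ 0 < s', s' < s & s' <= r / 2 / 8].
  exists (Num.min (s / 2) (r / 2 / 8)); rewrite lt_min !gt_min !ge_min lexx orbT !divr_gt0//.
  by split => //; apply/orP; left; lra.
exists (r / 64) => // e e0.
have e4 : 0 < e / 4 by rewrite divr_gt0.
have [d d0 hd] := flat_spread r2 s'0 s'r e4.
have [d' [d'0 d'1 d'd d'e]] : exists d', [/\ 0 < d', d' <= 1 / 2, d' <= d / 4 & d' <= e / 4].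
  exists (Num.min (1 / 2) (Num.min (d / 4) (e / 4))).
  by rewrite !lt_min !ge_min !lexx !orbT !divr_gt0.
have [J hJ] := flat d' d'0; exists J => j Jj z zq'.
have nj := nu0 j.
have uq : `|u (idx j) q - nu j| <= d' * nu j by apply: hJ => //; rewrite subrr modulus0.
have d1n : d' * nu j <= nu j / 2.
  have -> : nu j / 2 = 1 / 2 * nu j by ring.
  by rewrite ler_wpM2r// ltW.
have uq2 : nu j / 2 <= u (idx j) q.
  by move: uq; rewrite ler_norml => /andP[+ _]; lra.
have A x : modulus (x - q) <= s' -> `|u (idx j) x - u (idx j) q| <= d * u (idx j) q.
  move=> xq; have ux : `|u (idx j) x - nu j| <= d' * nu j by apply: hJ => //; lra.
  have -> : u (idx j) x - u (idx j) q = (u (idx j) x - nu j) - (u (idx j) q - nu j) by ring.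
  apply: le_trans (ler_normB _ _) _.
  have : d * (nu j / 2) <= d * u (idx j) q by rewrite ler_wpM2l// ltW.
  have : d' * nu j <= d / 4 * nu j by rewrite ler_wpM2r// ltW.
  lra.
have zq : modulus (z - q) <= r / 2 / 8.
  have := modulusD (z - q') (q' - p); have := modulusD (z - p) (p - q).
  by rewrite !addrA !subrK (modulusB p q); lra.
have B := hd (idx j) q Wq A z zq.
have -> : u (idx j) z - nu j = (u (idx j) z - u (idx j) q) + (u (idx j) q - nu j) by ring.
apply: le_trans (ler_normD _ _) _.
have uq3 : u (idx j) q <= 2 * nu j.
  by move: uq; rewrite ler_norml => /andP[_ +]; lra.
have : e / 4 * u (idx j) q <= e / 4 * (2 * nu j) by rewrite ler_wpM2l// ltW.
have : d' * nu j <= e / 4 * nu j by rewrite ler_wpM2r// ltW.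
have : 0 < e * nu j by rewrite mulr_gt0.
lra.
Qed.

Lemma flat_compact p0 K : W p0 -> flat_at p0 -> compact K -> K `<=` W ->
  forall e, 0 < e -> exists J, forall j, (J <= j)%N -> forall z, K z ->
    `|u (idx j) z - nu j| <= e * nu j.
Proof.
move=> Wp0 Fp0 cK KW e e0; apply: (compact_uniform cK) => p Kp.
have [s s0 h] := flat_everywhere Wp0 Fp0 (KW p Kp).
by have [J hJ] := h e e0; exists s, J.
Qed.

End FlatSequence.

Hypothesis lam_infty : forall M : R, exists N, forall n, (N <= n)%N -> M < lam n.
Variables (w0 : R[i]) (K0 : set R[i]) (kap : R) (N0 : nat).
Hypothesis Ww0 : W w0.
Hypothesis cK0 : compact K0.
Hypothesis K0W : K0 `<=` W.
Hypothesis kap0 : 0 < kap.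
Hypothesis oscF : forall n, (N0 <= n)%N -> exists2 z, K0 z & (1 + kap) * u n w0 <= u n z.

(** Flatness with error e on [K0] and at [w0] gives (1 + kap) (1 - e) <= 1 + e, that is kap <= e (2
    + kap), which is kap / 2 for the chosen e. *)
Lemma not_flat (idx : nat -> nat) nu p0 : (forall j, (j <= idx j)%N) -> (forall j, 0 < nu j) ->
  W p0 -> ~ flat_at idx nu p0.
Proof.
move=> idx_ge nu0 Wp0 Fp0; pose e := kap / (2 * (2 + kap)).
have e0 : 0 < e by rewrite divr_gt0// mulr_gt0// addr_gt0.
have ee : e * (2 * (2 + kap)) = kap by rewrite divfK// gt_eqF// mulr_gt0// addr_gt0.
have [J1 hJ1] := flat_compact nu0 Wp0 Fp0 cK0 K0W e0.
have cw0 : compact [set w0] by exact: compact_set1.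
have w0W : [set w0] `<=` W by move=> _ ->.
have [J2 hJ2] := flat_compact nu0 Wp0 Fp0 cw0 w0W e0.
pose j := maxn N0 (maxn J1 J2).
have j1 : (J1 <= j)%N by rewrite /j !leq_max leqnn orbT.
have j2 : (J2 <= j)%N by rewrite /j !leq_max leqnn !orbT.
have j0 : (N0 <= idx j)%N by apply: leq_trans (idx_ge j); rewrite leq_max leqnn.
have [z K0z hz] := oscF j0.
have := hJ1 j j1 z K0z; have := hJ2 j j2 w0 erefl.
rewrite !ler_norml => /andP[h1 _] /andP[_ h2].
have h3 : (1 - e) * nu j <= u (idx j) w0 by lra.
have h4 : (1 + kap) * ((1 - e) * nu j) <= (1 + kap) * u (idx j) w0.
  by apply: ler_wpM2l h3; rewrite addr_ge0// ltW.
have h5 : (1 + kap) * (1 - e) * nu j <= (1 + e) * nu j by lra.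
move: h5 kap0; rewrite ler_pM2r//; lra.
Qed.

(** Otherwise there are indices n_k >= k and omitted points w_k whose logarithmic moduli are ever
    closer to u(p) in proportion. Then [omitted_value] makes the normalised logarithms nearly
    constant near p, which is flatness. *)
Lemma covering_at p r : 0 < r -> (forall z, modulus (z - p) <= r -> W z) ->
  exists2 al, 0 < al & exists N, forall n, (N <= n)%N -> forall w, 0 < modulus w ->
    `|ln (modulus w) - u n p| <= al * u n p -> exists2 z, W z & F n z = w.
Proof.
move=> r0 Wr; apply: contrapT => nc.
have Wp : W p by apply: Wr; rewrite subrr modulus0 ltW.
have /choice[nw hnw] : forall k : nat, exists nw : nat * R[i],
   [/\ (k <= nw.1)%N, 0 < modulus nw.2,
     `|ln (modulus nw.2) - u nw.1 p| <= k.+1%:R^-1 * u nw.1 p &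
     forall z, W z -> F nw.1 z <> nw.2].
  move=> k; apply: contrapT => nk; apply: nc; exists k.+1%:R^-1; first by rewrite invr_gt0.
  exists k => n kn w w0' hw; apply: contrapT => nz; apply: nk; exists (n, w); split => //=.
  by move=> z Wz Fz; apply: nz; exists z.
apply: (@not_flat (fun k => (nw k).1) (fun k => u (nw k).1 p) p) => //.
- by move=> k; case: (hnw k).
- by move=> k; exact: u_gt0.
exists (r / 16) => [|e e0]; first by rewrite divr_gt0.
(* A bound for |g - c|: Harnack gives |g| <= 3, and |c| <= 1 + (1 + 2 pi). *)
pose B : R := 3 + (2 + 2 * pi).
have pi0 : 0 < pi :> R := pi_gt0 R.
have B0 : 0 < B by rewrite /B; lra.
have [e1 [e10 e1e e11]] : exists e1, [/\ 0 < e1, e1 <= e / 2 & 4 * B ^+ 2 * e1 <= (e / 2) ^+ 3].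
  have q0 : 0 < 4 * B ^+ 2 by rewrite mulr_gt0// exprn_gt0.
  exists (Num.min (e / 2) ((e / 2) ^+ 3 / (4 * B ^+ 2))).
  rewrite lt_min ge_min lexx !divr_gt0 ?exprn_gt0 ?divr_gt0//; split => //.
  by rewrite mulrC -ler_pdivlMr// ge_min lexx orbT.
have [k1 hk1] : exists k1 : nat, 2 / e1 < k1%:R.
  by exists (Num.bound (2 / e1)); apply/archi_boundP/ltW/divr_gt0.
have [k2 hk2] := lam_infty (Num.max 1 (4 * pi / e1)).
exists (maxn k1 k2) => k; rewrite geq_max => /andP[kk1 kk2] z zp.
have [kn w0' wln womit] := hnw k.
set n := (nw k).1 in kn wln womit *; set w := (nw k).2 in w0' wln womit.
have /andP[lam0 lamu] := lamF n Wp.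
have := hk2 n (leq_trans kk2 kn); rewrite gt_max => /andP[lam1 lampi].
have u0 := u_gt0 n Wp.
have u1 : 1 < u n p by exact: lt_le_trans lamu.
have upi : 2 * pi / u n p <= e1 / 2.
  rewrite ler_pdivrMr//; move: (lt_le_trans lampi lamu); rewrite ltr_pdivrMr//; lra.
have [L [t [Lp tpi hL]]] := local_log n r0 Wr.
have wn0 : w != 0 by rewrite -modulus_gt0.
have [th thpi wE] := polar wn0.
have mu : modulus (u n p)%:C = u n p by rewrite modulus_real gtr0_norm.
have uC0 : (u n p)%:C != 0 :> R[i] by rewrite -modulus_gt0 mu.
(* A logarithm of w, shifted by the phase t and scaled like g; a point where g = c would be mapped
   to w. *)
pose c : R[i] := (ln (modulus w) +i* (th - t)) / (u n p)%:C.
pose g x := L x / (u n p)%:C.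
have gp : g p = 1 by rewrite /g Lp divff.
have gc x : modulus (x - p) <= r / 4 -> g x != c.
  move=> xr; apply/eqP => /(mulIf (invr_neq0 uC0)) Lx.
  have [_ E _ _ _] := hL x xr; apply: (womit x).
    by apply: Wr; lra.
  rewrite -E Lx [RHS]wE; congr cexp; apply/eqP; rewrite eq_complex /= addr0 subrK !eqxx//.
have c1 : modulus (c - 1) <= k.+1%:R^-1 + 2 * pi / u n p.
  have -> : c - 1 = ((ln (modulus w) - u n p) +i* (th - t)) / (u n p)%:C.
    rewrite -[X in c - X](divff uC0) /c -mulrBl; congr (_ / _).
    by apply/eqP; rewrite eq_complex /= subr0 !eqxx.
  rewrite modulusM modulusV mu ler_pdivrMr//.
  apply: le_trans (modulus_le_ReIm _) _ => /=.
  rewrite mulrDl divfK ?gt_eqF// lerD//.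
  by apply: le_trans (ler_normB _ _) _; lra.
have k1e : k.+1%:R^-1 <= e1 / 2.
  have : 2 / e1 < k.+1%:R by apply: lt_le_trans hk1 _; rewrite ler_nat ltnW.
  rewrite ltr_pdivrMr// => h.
  rewrite -[X in X <= _]mul1r ler_pdivrMr ?ltr0n//; move: h; set K := k.+1%:R; lra.
have ce : modulus (c - 1) <= e1.
  by apply: le_trans c1 _; rewrite [leRHS]splitr lerD.
have k1' : k.+1%:R^-1 <= 1 :> R by rewrite invf_le1 ?ltr0n// ler1n.
have upi2 : 2 * pi / u n p <= 2 * pi.
  by rewrite ler_pdivrMr// ler_peMr ?mulr_ge0// ltW.
have c2 : modulus (c - 1) <= 1 + 2 * pi by apply: le_trans c1 _; rewrite lerD.
have r4 : 0 < r / 4 by rewrite divr_gt0.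
have hg x : modulus (x - p) <= r / 4 -> holo g x.
  by move=> /hL[h _ _ _ _]; apply: holoM => //; exact: holo_cst.
have gB x : modulus (x - p) <= r / 4 -> modulus (g x - c) <= B.
  move=> /hL[_ _ _ h _].
  have -> : g x - c = g x - (1 + (c - 1)) by ring.
  apply: le_trans (modulusD _ _) _; rewrite modulusN.
  have := modulusD 1 (c - 1); rewrite modulus1.
  have : modulus (g x) <= 3 by rewrite /g modulusM modulusV mu ler_pdivrMr.
  rewrite /B; lra.
have zr : modulus (z - p) <= r / 4 / 4 by lra.
have := omitted_value r4 B0 hg gc gB zr; rewrite gp [modulus (1 - c)]modulusB => h.
have h3 : modulus (g z - c) ^+ 3 <= (e / 2) ^+ 3.
  apply: le_trans h _; apply: le_trans _ e11; rewrite ler_wpM2l//.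
  by rewrite mulr_ge0// sqr_ge0.
have {h3} h3 : modulus (g z - c) <= e / 2.
  by move: h3; rewrite ler_pXn2r// nnegrE ?modulus_ge0// divr_ge0// ltW.
have g1 : modulus (g z - 1) <= e.
  have -> : g z - 1 = (g z - c) + (c - 1) by ring.
  by apply: le_trans (modulusD _ _) _; lra.
have zr4 : modulus (z - p) <= r / 4 by lra.
have [_ _ E _ _] := hL z zr4.
have := le_trans (le_Re_modulus _) g1; rewrite /g ReD ReN -fmorphV ReMr E.
have -> : u n z / u n p - 1 = (u n z - u n p) / u n p by field; rewrite gt_eqF.
by rewrite normrM normfV (gtr0_norm u0) ler_pdivrMr.
Qed.

(** The annulus at [p] serves all nearby centres z with a quarter of its exponent, because u(z) and
    u(p) differ by a fraction of al u(p). The third clause puts F n p into the annulus about F n z,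
    so neighbouring annuli overlap. *)
Theorem covering_near p : W p -> exists d al N, [/\ 0 < d, 0 < al &
  forall n, (N <= n)%N -> forall z, modulus (z - p) < d ->
    [/\ W z, u n p / 3 <= u n z <= 3 * u n p, `|u n z - u n p| < al * u n z & forall w, 0 < modulus w ->
       `|ln (modulus w) - u n z| <= al * u n z -> exists2 y, W y & F n y = w]].
Proof.
move=> Wp; have /open_modulusP /(_ p Wp)[r' r'0 hr'] := oW.
pose r := r' / 2; have r0 : 0 < r by rewrite divr_gt0.
have Wr z : modulus (z - p) <= r -> W z by move=> h; apply: hr'; move: h; rewrite /r; lra.
have [al' al'0 [N hN]] := covering_at r0 Wr.
have [al [al0 al1 ala]] : exists al, [/\ 0 < al, al <= 1 & al <= al'].
  by exists (Num.min 1 al'); rewrite lt_min !ge_min !lexx orbT ltr01.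
pose d := Num.min (r / 4) (al / 64 * r).
have [d0 d1 d2] : [/\ 0 < d, d <= r / 4 & d <= al / 64 * r].
  rewrite /d !ge_min !lexx orbT; split => //.
  by rewrite lt_min divr_gt0//= mulr_gt0// divr_gt0.
exists d, (al / 4), N; split => //; first by rewrite divr_gt0.
move=> n Nn z zd.
have [L [t [Lp _ hL]]] := local_log n r0 Wr.
have zr4 : modulus (z - p) <= r / 4 by lra.
have [_ _ E _ [u3 h]] := hL z zr4.
have u0 := u_gt0 n Wp.
have k : `|u n z - u n p| <= al / 8 * u n p.
  have -> : u n z - u n p = complex.Re (L z - (u n p)%:C) by rewrite ReD ReN E.
  apply: le_trans (le_Re_modulus _) _; apply: le_trans h _.
  have -> : al / 8 * u n p = 8 / r * u n p * (al / 64 * r) by field; rewrite gt_eqF.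
  by apply: ler_wpM2l; [apply/ltW/mulr_gt0 => //; exact: divr_gt0|lra].
have aup : al * u n p <= u n p by rewrite ler_piMl// ltW.
have k2 : u n p <= 8 / 7 * u n z by move: k; rewrite ler_norml => /andP[+ _]; lra.
have k3 : u n z <= 9 / 8 * u n p by move: k; rewrite ler_norml => /andP[_ +]; lra.
have k4 : al * u n p <= al * (8 / 7 * u n z) by rewrite ler_wpM2l// ltW.
have k5 : al * u n z <= al * (9 / 8 * u n p) by rewrite ler_wpM2l// ltW.
have k6 : al * u n p <= al' * u n p by rewrite ler_wpM2r// ltW.
have k7 : 0 < al * u n p by rewrite mulr_gt0.
split; [by apply: Wr; lra|by rewrite u3/=; lra| |].
  by apply: le_lt_trans k _; lra.
move=> w w0' hw; apply: (hN n Nn w w0').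
have -> : ln (modulus w) - u n p = (ln (modulus w) - u n z) + (u n z - u n p) by ring.
by apply: le_trans (ler_normD _ _) _; lra.
Qed.

End Covering.

(** * Annuli *)

Section Annuli.
Variable R : realType.
Implicit Types (V : set R[i]) (x z w : R[i]) (s t : R).

Lemma annulus_subset (s t s' t' : R) : 0 < s' < t' -> annulus s' t' `<=` (annulus s t : set R[i]) ->
  s <= s' /\ t' <= t.
Proof.
move=> /andP[s'0 st'] sub.
have pt (y : R) : s' < y < t' -> s < y < t.
  move=> /andP[y1 y2]; have y0 : 0 < y by apply: lt_trans y1.
  have := sub (y%:C); rewrite /annulus /mkset modulus_real gtr0_norm// y1 y2; exact.
split; rewrite leNgt; apply/negP => lt.
  have [y [y1 y2 y3]] : exists y, [/\ s' < y, y < t' & y <= s].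
    exists ((s' + Num.min t' s) / 2); have : s' < Num.min t' s by rewrite lt_min st' lt.
    have : Num.min t' s <= t' by rewrite ge_min lexx.
    have : Num.min t' s <= s by rewrite ge_min lexx orbT.
    by set k := Num.min _ _ => *; split; lra.
  by have := pt y; rewrite y1 y2 => /(_ isT)/andP[]; rewrite ltNge y3.
have [y [y1 y2 y3]] : exists y, [/\ s' < y, y < t' & t <= y].
  exists ((t' + Num.max s' t) / 2); have : Num.max s' t < t' by rewrite gt_max st' lt.
  have : s' <= Num.max s' t by rewrite le_max lexx.
  have : t <= Num.max s' t by rewrite le_max lexx orbT.
  by set k := Num.max _ _ => *; split; lra.
by have := pt y; rewrite y1 y2 => /(_ isT)/andP[_]; rewrite ltNge y3.
Qed.

(** Maximality concerns annuli through [x], which the second annulus need not contain. Two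
    concentric annuli with a common point have an annulus as union, and this union does contain
    [x]. *)
Lemma maximal_annulus_absorb V x s t s' t' y : maximal_annulus V x s t -> 0 < s' < t' ->
  annulus s' t' `<=` V -> annulus s' t' y -> annulus s t y -> annulus s' t' `<=` annulus s t.
Proof.
move=> [/andP[s0 st] sV sx maxi] /andP[s'0 st'] s'V y' y0.
have sub : annulus (Num.min s s') (Num.max t t') `<=` (annulus s t : set R[i]).
  apply: maxi.
  - by rewrite lt_min s0 s'0 gt_min !lt_max st.
  - move=> w /andP[]; rewrite gt_min lt_max => h1 h2.
    move: y' y0 => /andP[y1 y2] /andP[y3 y4].
    have [wy|yw] := ltP (modulus w) (modulus y).
      case/orP: h1 => h1; [apply: sV|apply: s'V]; rewrite /annulus /= h1 /=.
        exact: lt_trans y4.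
      exact: lt_trans y2.
    case/orP: h2 => h2; [apply: sV|apply: s'V]; rewrite /annulus /= h2 andbT.
      exact: lt_le_trans yw.
    exact: lt_le_trans yw.
  - move: sx => /andP[x1 x2]; rewrite /annulus /=.
    by rewrite gt_min x1 lt_max x2.
move=> w /andP[w1 w2]; apply: sub; rewrite /annulus /=.
by rewrite gt_min w1 lt_max w2 !orbT.
Qed.

Lemma powR_exp (t x : R) : 0 < t -> t `^ x = expR (x * ln t).
Proof. by move=> t0; rewrite /powR gt_eqF. Qed.

(** With S the square root of ln rho, delta ln rho = S while u >= c S ^ 2. The gap al u therefore
    exceeds 2 pi S below, and the factor 1 + al outweighs 1 - 3 pi / S above; the two thresholds on
    S say this. *)
Lemma log_deep_in_annulus (rho a b u al c : R) : 1 < rho -> 0 < al -> 0 < c ->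
  a * ln rho <= (1 - al) * u -> (1 + al) * u <= b * ln rho -> c * ln rho <= u ->
  2 * pi / (al * c) < Num.sqrt (ln rho) -> 6 * pi * (1 + al) / al < Num.sqrt (ln rho) ->
  (a + 2 * pi * (1 / Num.sqrt (ln rho))) * ln rho < u /\
  u < b * (1 - 3 * pi * (1 / Num.sqrt (ln rho))) * ln rho.
Proof.
move=> rho1 al0 c0 h1 h2 h3; have nu0 : 0 < ln rho by exact: ln_gt0.
set nu := ln rho in nu0 h1 h2 h3 *; set S := Num.sqrt nu.
have S0 : 0 < S by rewrite sqrtr_gt0.
have SS : nu = S * S by rewrite -expr2 sqr_sqrtr// ltW.
have pi0 := pi_gt0 R.
have u0 : 0 < u by apply: lt_le_trans h3; rewrite mulr_gt0.
rewrite ltr_pdivrMr ?mulr_gt0// ltr_pdivrMr// => h4 h5.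
have id1 : 1 / S * nu = S by rewrite SS; field; rewrite gt_eqF.
split.
  have -> : (a + 2 * pi * (1 / S)) * nu = a * nu + 2 * pi * (1 / S * nu) by ring.
  rewrite id1.
  have k1 : 2 * pi * S < S * (al * c) * S by rewrite ltr_pM2r.
  have k2 : S * (al * c) * S = al * (c * nu) by rewrite SS; ring.
  have k3 : al * (c * nu) <= al * u by rewrite ler_pM2l.
  lra.
have e0 : 3 * pi * (1 / S) * (2 * (1 + al)) < al.
  have -> : 3 * pi * (1 / S) * (2 * (1 + al)) = 6 * pi * (1 + al) / S by ring.
  by rewrite ltr_pdivrMr// [al * S]mulrC.
set D := 3 * pi * (1 / S) in e0 *.
have D1 : D <= 1.
  have : D * (2 * (1 + al)) < 2 * (1 + al) by apply: lt_le_trans e0 _; lra.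
  by rewrite gtr_pMl ?mulr_gt0 ?addr_gt0// => /ltW.
have -> : b * (1 - D) * nu = (b * nu) * (1 - D) by ring.
have k1 : (1 + al) * u * (1 - D) <= b * nu * (1 - D) by rewrite ler_wpM2r// subr_ge0.
apply: lt_le_trans _ k1.
have k2 : D * (2 * (1 + al)) * u < al * u by rewrite ltr_pM2r.
have : 0 < al * u by rewrite mulr_gt0.
lra.
Qed.

End Annuli.

(** * The theorem *)

Lemma compact_image_iter (R : realType) (f : R[i] -> R[i]) n (K : set R[i]) :
  (forall z, holo f z) -> compact K -> compact (iter n f @` K).
Proof.
move=> hf cK; apply: continuous_compact => //.
apply: continuous_subspaceT => z V /nbhs_modulusP[e e0 hV].
have [d d0 hd] := holo_contat (holo_iter hf n z) e0.
by apply/nbhs_modulusP; exists d => // w /hd; exact: hV.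
Qed.

Theorem theorem1p3 (R : realType) (f : R[i] -> R[i]) (U : set R[i]) (z0 : R[i])
    (a b : nat -> R)
    (r := fun n : nat => modulus (iter n f z0))
    (delta := fun n : nat => 1 / Num.sqrt (ln (r n)))
    (B := fun n : nat => annulus (r n `^ a n) (r n `^ b n))
    (C := fun n : nat =>
       annulus (r n `^ (a n + 2 * pi * delta n))
               (r n `^ (b n * (1 - 3 * pi * delta n)))) :
  transcendental_entire f ->
  wandering_domain f U ->
  multiply_connected U ->
  U z0 ->
  (\forall n \near \oo,
     maximal_annulus (iter n f @` U) (iter n f z0) (r n `^ a n) (r n `^ b n)) ->
  (forall K : set R[i], compact K -> K `<=` U ->
     exists N : nat, forall n : nat, (N <= n)%N -> iter n f @` K `<=` B n) /\
  (forall K : set R[i], compact K -> K `<=` U ->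
     exists N : nat, forall n : nat, (N <= n)%N -> iter n f @` K `<=` C n).
Proof.
move=> tf wU [[oU cU _] _] Uz0 [n0 _ maxB].
have hf := entire_holo tf.1; have nf := transcendental_nonconst tf.
have circ n : (n0 <= n)%N -> forall z, modulus z = r n -> (iter n f @` U) z.
  by move=> /maxB[_ sub + _] z zr; rewrite /annulus /mkset => /= h; apply: sub; rewrite /annulus /= zr.
have mono n m : (n0 <= n)%N -> (n < m)%N -> r n < r m.
  exact: (radius_mono hf nf wU Uz0 circ).
have unbd := radius_unbounded hf nf wU Uz0 circ.
have outside n m y : (n0 <= m)%N -> (m < n)%N -> (iter n f @` U) y -> r m < modulus y.
  by move=> hm mn; apply: (image_outside hf nf wU Uz0 circ hm); exact: mono.
have [N1 hN1] := radius_growth hf nf wU Uz0 circ (transcendental_growth tf).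
have [N2 hN2] := unbd 1.
have [k [kn0 kN1 kN2]] : exists k, [/\ (n0 <= k)%N, (N1 <= k)%N & (N2 <= k)%N].
  by exists (maxn n0 (maxn N1 N2)); rewrite !leq_max !leqnn !orbT.
have rgt1 n : 1 < r (k + n)%N by apply: hN2; apply: leq_trans kN2 (leq_addr _ _).
(* Three iterates beyond [k], the offset demanded by [radius_oscillation]. *)
have [m mE] : exists m, m = (k + 3)%N by exists (k + 3)%N.
have mn0 : (n0 <= m)%N by rewrite mE; apply: leq_trans kn0 (leq_addr _ _).
pose W := iter m f @` U; pose w0 := iter m f z0.
have oW : open W by exact: image_iter_open.
have cW : connected W by exact: connected_image_iter.
have Ww0 : W w0 by exists z0.
pose F j := iter j f.
have FW j z : W z -> (iter (m + j) f @` U) (F j z).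
  by move=> [x Ux <-]; exists x => //; rewrite addnC iterD.
have FWsub j z : (exists2 y, W y & F j y = z) -> (iter (m + j) f @` U) z.
  by move=> [y Wy <-]; exact: FW.
have hF n z : W z -> holo (F n) z by move=> _; exact: holo_iter.
(* The image f^(m+j)(U) lies outside the circle of index m + j - 1 = k + 2 + j, which gives a lower
   bound valid on all of W. *)
pose lam j := ln (r (k + 2 + j)%N).
have lamF j z : W z -> 0 < lam j <= ln (modulus (F j z)).
  move=> Wz; have r1 : 1 < r (k + 2 + j)%N by rewrite -addnA; exact: rgt1.
  have lt : r (k + 2 + j)%N < modulus (F j z).
    apply: (outside (m + j)%N); last exact: FW; last by rewrite mE; lia.
    by rewrite -addnA; apply: leq_trans kn0 (leq_addr _ _).
  rewrite ln_gt0//= ler_ln ?posrE ?ltW//; first by apply: lt_trans r1.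
  by apply: lt_trans lt; apply: lt_trans r1.
have lam_infty (M : R) : exists N, forall n, (N <= n)%N -> M < lam n.
  have [N hN] := unbd (expR M); exists N => n Nn.
  rewrite -ltr_expR lnK; first by apply: hN; lia.
  by rewrite posrE; apply: lt_trans (_ : 1 < _) => //; rewrite -addnA; exact: rgt1.
have rw0 j : modulus (F j w0) = r (m + j)%N by rewrite /r /F /w0 -iterD addnC.
have nuE j : ln (modulus (F j w0)) = ln (r (m + j)%N) by rewrite rw0.
have rm0 n : 0 < r (k + n)%N by apply: lt_trans (rgt1 n).
have [/andP[s0 st] subm /andP[sm mt] _] := maxB m mn0.
(* A second circle in W, halfway between the one through w0 and the outer boundary of B_m; the
   oscillation is measured on it. *)
pose r' := (r m + r m `^ b m) / 2.
have mr' : r m < r' by rewrite /r' -/(r m) in mt *; lra.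
have r't : r' < r m `^ b m by rewrite /r' -/(r m) in mt *; lra.
pose K0 : set R[i] := [set z | r' <= modulus (z - 0) <= r'].
have cK0 : compact K0 by exact: compact_ring.
have K0W : K0 `<=` W.
  move=> z K0z; have : r' <= modulus (z - 0) <= r' by [].
  rewrite subr0 => /andP[z1 z2]; apply: subm; rewrite /annulus /=.
  by rewrite (lt_le_trans (lt_trans sm mr') z1) (le_lt_trans z2 r't).
have growth n : (k <= n)%N -> r n ^+ 2 < r n.+2 by move=> kn; apply/hN1/(leq_trans kN1).
have circ' z : modulus z = r' -> W z by move=> zr; apply: K0W; rewrite /K0 /mkset subr0 zr lexx.
have rgt1' n : (k <= n)%N -> 1 < r n by move=> kn; apply/hN2/(leq_trans kN2).
have [kap [N3 [kap0 osc]]] : exists kap N, 0 < kap /\ forall n, (N <= n)%N ->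
    exists2 z, modulus z = r' & (1 + kap) * ln (r (m + n)%N) <= ln (modulus (F n z)).
  have := @radius_oscillation _ f U hf nf wU z0 n0 Uz0 circ k r' kn0 rgt1' growth.
  by rewrite -mE; apply.
have oscF n : (N3 <= n)%N -> exists2 z, K0 z &
    (1 + kap) * ln (modulus (F n w0)) <= ln (modulus (F n z)).
  move=> /osc[z zr h]; exists z; last by rewrite rw0.
  by rewrite /K0 /mkset subr0 zr lexx.
have cover := covering_near oW cW hF lamF lam_infty Ww0 cK0 K0W kap0 oscF.
pose u j z := ln (modulus (F j z)).
(* The property carried through W: near p the covered annuli lie in B_(m+j), and u_j is at least a
   fixed proportion of u_j(w0) = ln r_(m+j). All constants may depend on p. *)
pose E p := exists d al c N, [/\ 0 < d, 0 < al, 0 < c & forall j, (N <= j)%N ->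
  forall z, modulus (z - p) < d ->
    annulus (expR ((1 - al) * u j z)) (expR ((1 + al) * u j z)) `<=` (B (m + j)%N) /\
    c * u j w0 <= u j z].
have u_pos j z : W z -> 0 < u j z by move=> /(lamF j)/andP[]; exact: lt_le_trans.
have F_pos j z : W z -> 0 < modulus (F j z).
  by move=> /(u_pos j)/ln_pos_gt1; exact: lt_trans.
have ann_pos j z al : 0 < al -> W z -> 0 < expR ((1 - al) * u j z) < expR ((1 + al) * u j z).
  move=> al0 Wz; rewrite expR_gt0 ltr_expR ltr_pM2r ?u_pos//.
  by rewrite ltrD2l gt0_cp.
have ann_mem j z w al : W z -> 0 < modulus w -> `|ln (modulus w) - u j z| < al * u j z ->
    annulus (expR ((1 - al) * u j z)) (expR ((1 + al) * u j z)) w.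
  move=> Wz w_pos; rewrite ltr_norml => /andP[h1 h2].
  by rewrite /annulus /= -{1 2}(lnK (x := modulus w)) ?posrE// !ltr_expR; apply/andP; split; lra.
have ann_memV j z w al : annulus (expR ((1 - al) * u j z)) (expR ((1 + al) * u j z)) w ->
    0 < modulus w /\ `|ln (modulus w) - u j z| <= al * u j z.
  move=> /andP[h1 h2]; have w_pos : 0 < modulus w by apply: lt_trans h1; exact: expR_gt0.
  split => //; move: h1 h2; rewrite -(lnK (x := modulus w)) ?posrE// !ltr_expR expRK => h1 h2.
  by rewrite ler_norml; apply/andP; split; lra.
have Bmax j : (n0 <= m + j)%N by apply: leq_trans mn0 (leq_addr _ _).
have Ew0 : E w0.
  have [d [al [N [d0 al0 h]]]] := cover w0 Ww0.
  exists d, al, 3^-1, N; split => // j jN z zd.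
  have [Wz /andP[u3 u3'] uz cov] := h j jN z zd.
  have sub : annulus (expR ((1 - al) * u j z)) (expR ((1 + al) * u j z)) `<=` iter (m + j) f @` U.
    by move=> w /ann_memV[w_pos wu]; apply: FWsub; exact: cov.
  split; last by rewrite mulrC.
  have w0z : annulus (expR ((1 - al) * u j z)) (expR ((1 + al) * u j z)) (iter (m + j) f z0).
    rewrite addnC iterD; apply: ann_mem => //; first exact: F_pos.
    by rewrite distrC.
  apply: (maximal_annulus_absorb (maxB _ (Bmax j)) (ann_pos j z al al0 Wz) sub w0z).
  by have [_ _ ? _] := maxB _ (Bmax j).
have Eall p : W p -> E p.
  apply: (connected_propagate cW Ww0 Ew0) => {}p Wp.
  have [d [al [N [d0 al0 h]]]] := cover p Wp.
  exists d => // q qd [dq [alq [cq [Nq [dq0 alq0 cq0 hq]]]]] q' q'd.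
  (* This radius keeps z in the disc about p. The constant is divided by 9 for two Harnack
     comparisons, from q to p and from p to z. *)
  exists (d - modulus (q' - p)), al, (cq / 9), (maxn N Nq); split => //.
  - by rewrite subr_gt0.
  - by rewrite divr_gt0.
  move=> j; rewrite geq_max => /andP[jN jNq] z zq'.
  have zd : modulus (z - p) < d.
    by have := modulusD (z - q') (q' - p); rewrite addrA subrK; lra.
  have [Wq /andP[uq3 uq3'] uq covq] := h j jN q qd.
  have [Wz /andP[uz3 uz3'] uz covz] := h j jN z zd.
  have qq : modulus (q - q) < dq by rewrite subrr modulus0.
  have [sq cu] := hq j jNq q qq.
  have subz x : W x -> (forall w, 0 < modulus w -> `|ln (modulus w) - u j x| <= al * u j x ->
      exists2 y, W y & F j y = w) ->
      annulus (expR ((1 - al) * u j x)) (expR ((1 + al) * u j x)) `<=` iter (m + j) f @` U.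
    by move=> Wx cov w /ann_memV[w_pos wu]; apply: FWsub; exact: cov.
  have selfm x al' : 0 < al' -> W x ->
      annulus (expR ((1 - al') * u j x)) (expR ((1 + al') * u j x)) (F j x).
    move=> al'0 Wx; apply: ann_mem => //; first exact: F_pos.
    by rewrite subrr normr0 mulr_gt0// u_pos.
  have BFq : B (m + j)%N (F j q) by apply: sq; exact: selfm.
  have memp x : W x -> `|u j x - u j p| < al * u j x ->
      annulus (expR ((1 - al) * u j x)) (expR ((1 + al) * u j x)) (F j p).
    by move=> Wx ux; apply: ann_mem => //; [exact: F_pos|rewrite distrC].
  have absorb := maximal_annulus_absorb (maxB _ (Bmax j)).
  (* The link between q and z is F j p: it lies in the annulus about F j q, hence in B, and also in
     the annulus about F j z, which is then absorbed in turn. *)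
  have BFp : B (m + j)%N (F j p).
    apply: (absorb _ _ (F j q) (ann_pos j q al al0 Wq) (subz q Wq covq) (selfm q al al0 Wq) BFq).
    exact: memp.
  split.
    exact: (absorb _ _ (F j p) (ann_pos j z al al0 Wz) (subz z Wz covz) (memp z Wz uz) BFp).
  have : cq * u j w0 <= 9 * u j z by apply: le_trans cu _; move: uq3' uz3; rewrite /u; lra.
  lra.
have main K : compact K -> K `<=` U -> exists N, forall n, (N <= n)%N ->
    forall z, K z -> B n (iter n f z) /\ C n (iter n f z).
  move=> cK KU.
  have cK' : compact (iter m f @` K) by exact: compact_image_iter.
  have [N hN] : exists N, forall j, (N <= j)%N -> forall z, (iter m f @` K) z ->
      B (m + j)%N (F j z) /\ C (m + j)%N (F j z).
    apply: (compact_uniform cK') => p Kp.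
    have Wp : W p by case: Kp => x Kx <-; exists x => //; exact: KU.
    have [d [al [c [N [d0 al0 c0 h]]]]] := Eall p Wp.
    have /open_modulusP /(_ p Wp)[d' d'0 hd'] := oW.
    (* Squares of the two thresholds of [log_deep_in_annulus], since [lam] bounds the logarithm of
       the radius and not its square root. *)
    have [N' hN'] := lam_infty (Num.max ((2 * pi / (al * c)) ^+ 2) ((6 * pi * (1 + al) / al) ^+ 2)).
    exists (Num.min d d'), (maxn N N'); split; first by rewrite lt_min d0.
    move=> j; rewrite geq_max => /andP[jN jN'] z; rewrite lt_min => /andP[zd zd'].
    have Wz := hd' z zd'.
    have [sub cu] := h j jN z zd.
    have [lo hi] := annulus_subset (ann_pos j z al al0 Wz) sub.
    have FB : B (m + j)%N (F j z).
      apply: sub; apply: ann_mem => //; first exact: F_pos.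
      by rewrite subrr normr0 mulr_gt0// u_pos.
    split => //.
    have rho1 : 1 < r (m + j)%N by rewrite mE -addnA; exact: rgt1.
    have rho0 : 0 < r (m + j)%N by exact: lt_trans rho1.
    rewrite !powR_exp// ler_expR in lo; rewrite !powR_exp// ler_expR in hi.
    have lamnu : lam j <= ln (r (m + j)%N) by rewrite -nuE; case/andP: (lamF j w0 Ww0).
    have big (x : R) : x ^+ 2 < lam j -> x < Num.sqrt (ln (r (m + j)%N)).
      move=> /lt_le_trans /(_ lamnu) hx; apply: le_lt_trans (ler_norm x) _.
      by rewrite -sqrtr_sqr ltr_sqrt// (le_lt_trans _ hx)// sqr_ge0.
    have := hN' j jN'; rewrite gt_max => /andP[/big b1 /big b2].
    have cu' : c * ln (r (m + j)%N) <= u j z by rewrite -nuE.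
    have [l1 l2] := log_deep_in_annulus rho1 al0 c0 lo hi cu' b1 b2.
    rewrite /C /annulus /= !powR_exp// -(lnK (x := modulus (F j z))) ?posrE ?F_pos//.
    by rewrite !ltr_expR /delta l1 l2.
  exists (m + N)%N => n mNn z Kz.
  have nE : n = (m + (n - m))%N by rewrite subnKC// (leq_trans _ mNn)// leq_addr.
  have := hN (n - m)%N _ (iter m f z) (ex_intro2 _ _ z Kz erefl).
  rewrite -nE /F -iterD subnK; last by rewrite (leq_trans _ mNn)// leq_addr.
  by apply; rewrite leq_subRL// (leq_trans _ mNn)// leq_addr.
split => K cK KU; have [N hN] := main K cK KU; exists N => n Nn _ [z Kz <-].
  exact: (hN n Nn z Kz).1.
exact: (hN n Nn z Kz).2.
Qed.
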